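(* Let $m>2$ be an integer with $m\notin\{4,6\}$, and let $K=\mathbb{F}_{2^m}$. Let $\sigma\colon x\mapsto x^{2^k}$ and $\tau\colon x\mapsto x^{2^l}$ be field automorphisms of $K$ with $\gcd(k,m)=\gcd(l,m)=1$, and let $\alpha_1,\alpha_2\in K$ be such that $X^{\sigma+1}+X+\alpha_1$ and $X^{\tau+1}+X+\alpha_2$ have no roots in $K$. Then $F_{\alpha_1,\sigma}$ and $F_{\alpha_2,\tau}$ are CCZ-equivalent if and only if $\sigma=\tau$ or $\sigma=\overline{\tau}$, where $\overline{\tau}$ is the inverse of $\tau$ in the automorphism group of $K$. Moreover, the family of all functions $F_{\alpha,\sigma}$ on $K^2$, where $\sigma\colon x\mapsto x^{2^k}$ ranges over the automorphisms of $K$ with $\gcd(k,m)=1$ and $\alpha$ ranges over the elements of $K$ such that $X^{\sigma+1}+X+\alpha$ has no root in $K$, contains in total $\varphi(m)/2$ pairwise CCZ-inequivalent functions (i.e., it meets exactly $\varphi(m)/2$ CCZ-equivalence classes), where $\varphi$ is Euler's totient function.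
   Context: For $K=\mathbb{F}_{2^m}$, a field automorphism $\sigma\colon x\mapsto x^{2^k}$ of $K$ with $\gcd(k,m)=1$, and $\alpha\in K$, define $F_{\alpha,\sigma}\colon K^2\to K^2$ by $F_{\alpha,\sigma}=(f_{\alpha,\sigma},g_{\alpha,\sigma})$ with $$f_{\alpha,\sigma}(x,y)=x^{\sigma+1}+xy^\sigma+\alpha y^{\sigma+1},$$ $$g_{\alpha,\sigma}(x,y)=x^{\sigma^2+1}+\alpha x^{\sigma^2}y+(1+\alpha^\sigma)xy^{\sigma^2}+\alpha y^{\sigma^2+1}.$$ Exponent notation: $x^\sigma=\sigma(x)=x^{2^k}$, $x^{\sigma+1}=\sigma(x)\,x$, $x^{\sigma^2}=\sigma(\sigma(x))$, $x^{\sigma^2+1}=\sigma(\sigma(x))\,x$. It is known that $F_{\alpha,\sigma}$ is APN whenever $X^{\sigma+1}+X+\alpha$ has no root in $K$ (a function $F$ on an $\mathbb{F}_2$-vector space $V$ is APN if for all $a\neq 0$ and all $b$ the equation $F(x+a)+F(x)=b$ has at most $2$ solutions $x\in V$). Two functions $F,G\colon V\to V$ on a finite-dimensional $\mathbb{F}_2$-vector space $V$ (here $V=K^2$) are CCZ-equivalent if there is an $\mathbb{F}_2$-affine permutation $\mathcal{A}$ of $V\times V$ with $\mathcal{A}(\Gamma_F)=\Gamma_G$, where $\Gamma_F=\{(v,F(v)) : v\in V\}$ is the graph of $F$. *)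

(* Defs.v *)
From HB Require Import structures.
From mathcomp Require Import all_boot all_order all_algebra all_fingroup.

Set Implicit Arguments.
Unset Strict Implicit.
Unset Printing Implicit Defensive.

Import GRing.Theory.
Local Open Scope ring_scope.

(* Products of finZmodTypes have no declared finZmodType join otherwise. *)
HB.saturate prod.

Section CCZ.

Variable V : finZmodType.

(* Used for groups of exponent 2, i.e. F_2-vector spaces: the only scalars
   being 0 and 1, F_2-linear means additive. *)
Definition F2linear (L : V -> V) : bool :=
  [forall u, forall v, L (u + v) == L u + L v].

Definition F2affine (f : V -> V) : bool :=
  [exists L : {ffun V -> V}, exists c : V,
    F2linear L && [forall v, f v == L v + c]].

End CCZ.

Definition graph (V : finZmodType) (F : {ffun V -> V}) : {set V * V} :=
  [set (v, F v) | v in [set: V]].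

Definition ccz (V : finZmodType) (F G : {ffun V -> V}) : bool :=
  [exists A : {perm V * V}, F2affine A && (A @: graph F == graph G)].

Section Biprojective.

Variable K : finFieldType.

(* The automorphism x |-> x ^ (2 ^ k) is kept as a permutation of K (Aut K is a
   subgroup of {perm K}), so that inverses are those of a group. *)
Definition is_frob (k : nat) (s : {perm K}) : bool :=
  [forall x, s x == x ^+ (2 ^ k)].

Definition no_root (s : K -> K) (a : K) : bool :=
  [forall x, s x * x + x + a != 0].

Definition fpart (a : K) (s : K -> K) (x y : K) : K :=
  s x * x + x * s y + a * (s y * y).

Definition gpart (a : K) (s : K -> K) (x y : K) : K :=
  s (s x) * x + a * s (s x) * y + (1 + s a) * x * s (s y)
  + a * (s (s y) * y).

Definition bipF (a : K) (s : K -> K) : {ffun K * K -> K * K} :=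
  [ffun v => (fpart a s v.1 v.2, gpart a s v.1 v.2)].

(* When #|K| = 2 ^ m, the map x |-> x ^ (2 ^ k) depends only on k modulo m, as
   does coprimality with m, so k < m loses nothing. *)
Definition bip_family (m : nat) : {set {ffun K * K -> K * K}} :=
  [set F | [exists s : {perm K}, exists k : 'I_m, exists a : K,
    [&& coprime k m, is_frob k s, no_root s a & F == bipF a s]]].

End Biprojective.

(* Main.v *)
Require Import Defs.
From mathcomp Require Import all_boot all_order all_algebra all_fingroup.
From mathcomp Require Import all_solvable all_field.
From mathcomp Require Import zify ring.

(**
Write s for the automorphism, det for the alternating form on K^2, and T for the s-semilinear map
(x, y) -> (alpha s(y), s(x) + s(y)). Then F_(alpha,s)(v) = (det (T v) v, det (T (T v)) v), and the
absence of roots says that T maps no line into itself. Everything is proved for the map quadF T :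
v -> (det (T v) v, det (T (T v)) v) of an arbitrary such irreducible semilinear T.

Equivalence. T^m is K-linear and commutes with T, so its trace and determinant lie in F_2; it is
not the identity, since otherwise a Galois average would be a vector fixed by T
(iter_order_nontrivial). Hence T^m has order 3 (commutant). If T' is another irreducible
s-semilinear map, T^m and T'^m are therefore conjugate, and averaging a conjugating map over the
powers of T and T' conjugates T to T' (intertwiner). Since K-linear maps change det by a scalar,
all F_(alpha,s) with the same s are equivalent. As T itself multiplies det by a scalar up to s,
the maps of T and of its inverse differ by an additive bijection (inverse_quadF), which exchanges
s and its inverse.

Inequivalence. For m = 3 any two exponents give equal or inverse automorphisms, so let m > 4.
Scalars act on the graph of quadF T: they multiply the two coordinates by x^(s+1) and x^(s^2+1).
This torus contains elements of order p for a primitive prime divisor p of 2^m - 1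
(primitive_prime), and such an element generates K as a ring (p_element_generates). An affine
equivalence can be made additive (ccz_graph_map); suppose that it moreover conjugates such a torus
element to a torus element. Then it preserves the subspace of second coordinates (graph_map_zero).
This rests on the analysis of the polar form at a point u: its kernel is {0, u}, so its image is a
hyperplane, and the vector defining that hyperplane never has first coordinate 0 (polF_ker,
annih1_neq0). Consequently the map is semilinear on arguments and compatible with the whole torus
(graph_map_structure), and its components on values intertwine the weights s+1, s^2+1 with t+1,
t^2+1. Two weights are intertwined only if the automorphisms are equal or inverse (weight_lemma),
which leaves s = t, s t = 1 and an exchange of the two coordinates; the exchange is possible for m
= 5 only, and there it would give T^5 = 1 (semi_weights).

The same analysis applied to automorphisms shows that one that commutes with a nontrivial torus
element of p-power order has its cube in the torus, because a linear map commuting with T is a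
scalar or of order 3. So the Sylow p-subgroup of the torus is a Sylow subgroup of the group of all
additive automorphisms of the graph (torus_Sylow), and Sylow's theorem provides, for any
equivalence, another one with the conjugation property supposed above.

Finally, some alpha is admissible for each s, because x^(s+1) + x takes the value 0 twice; so the
classes correspond to the pairs {k, m - k} of exponents coprime to m (card_classes).
*)

Set Implicit Arguments.
Unset Strict Implicit.
Unset Printing Implicit Defensive.
Import Order.TTheory GRing.Theory Num.Theory.
Local Open Scope ring_scope.

(** * Primitive prime divisors of 2 ^ m - 1 *)

Definition cycval (n : nat) (z : int) : int := ('Phi_n).[z].

Lemma prod_cycval n z : (0 < n)%N ->
  \prod_(d <- divisors n) cycval d z = z ^+ n - 1.
Proof.
move=> n_gt0; rewrite -horner_prod prod_Cyclotomic //.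
by rewrite hornerD hornerXn hornerN hornerC.
Qed.

(** Each factor z - w, with w on the unit circle, has absolute value between z - 1 and z + 1. *)
Lemma cycval_bounds n (z : int) : (0 < n)%N -> 1 < z ->
  (z - 1) ^+ totient n <= `|cycval n z| <= (z + 1) ^+ totient n.
Proof.
move=> n_gt0 z_gt1.
have [w prim_w] := C_prim_root_exists n_gt0.
have w1 : `|w| = 1 by apply/eqP; rewrite -(@pexpr_eq1 _ _ n) // -normrX prim_expr_order // normr1.
have EC : (cycval n z)%:~R = \prod_(k < n | coprime k n) (z%:~R - w ^+ k).
  rewrite /cycval -horner_map /= (Cintr_Cyclotomic prim_w) /cyclotomic horner_prod.
  by apply: eq_bigr => k _; rewrite hornerXsubC.
have z0 : 0 <= (z%:~R : algC) by rewrite ler0z; lia.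
have card_tot : totient n = #|[pred k : 'I_n | coprime k n]|.
  rewrite totient_count_coprime -big_mkcond big_mkord -sum1_card.
  by apply: eq_bigl => i; rewrite inE coprime_sym.
have EN : (`|cycval n z|%:~R : algC) = \prod_(k < n | coprime k n) `|z%:~R - w ^+ k|.
  by rewrite intr_norm EC normr_prod.
have nw k : `|w ^+ k| = 1 by rewrite normrX w1 expr1n.
apply/andP; split; rewrite -(ler_int algC) EN rmorphXn /= card_tot -prodr_const.
  apply: ler_prod => k _; rewrite ler0z; apply/andP; split; first lia.
  by apply: le_trans (lerB_dist _ _); rewrite nw (ger0_norm z0) intrD.
apply: ler_prod => k _; rewrite normr_ge0 /=.
by apply: le_trans (ler_normB _ _) _; rewrite nw (ger0_norm z0) intrD.
Qed.

Lemma cycval_neq0 n (z : int) : (0 < n)%N -> 1 < z -> cycval n z != 0.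
Proof.
move=> n_gt0 z_gt1; have /andP[h _] := cycval_bounds n_gt0 z_gt1.
rewrite -normr_gt0; apply: lt_le_trans h; apply: exprn_gt0; lia.
Qed.

(** A divisor of p^(e+1) n that is not a multiple of p^(e+1) already divides p^e n. *)
Lemma prod_divisors_pexp (p e n : nat) (F : nat -> int) :
  prime p -> (0 < n)%N -> ~~ (p %| n)%N ->
  \prod_(d <- divisors (p ^ e.+1 * n)) F d =
  (\prod_(d <- divisors n) F (p ^ e.+1 * d)%N) *
  \prod_(d <- divisors (p ^ e * n)) F d.
Proof.
move=> pp n0 pn; have p0 := prime_gt0 pp.
rewrite -(big_map (muln (p ^ e.+1)) xpredT F) -big_cat; apply: perm_big.
have pe0 i : (0 < p ^ i)%N by rewrite expn_gt0 p0.
have N0 i : (0 < p ^ i * n)%N by rewrite muln_gt0 pe0.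
apply: uniq_perm.
- exact: divisors_uniq.
- rewrite cat_uniq map_inj_uniq ?divisors_uniq //=; last first.
    by move=> a b /eqP; rewrite eqn_pmul2l // => /eqP.
  rewrite andbT; apply/hasPn => d /=; rewrite -dvdn_divisors // => dd.
  apply/negP => /mapP[c]; rewrite -dvdn_divisors // => cn dE; move: dd; rewrite dE expnSr -mulnA.
  rewrite dvdn_pmul2l // => h; case/negP: pn.
  exact: dvdn_trans (dvdn_mulr _ _) h.
move=> d; rewrite mem_cat -!dvdn_divisors //; apply/idP/idP; last first.
  case/orP => [/mapP[c]|]; first by rewrite -dvdn_divisors // => cn ->; rewrite dvdn_mul.
  by move/dvdn_trans; apply; rewrite dvdn_mul // expnS dvdn_mull.
move=> dd; have d0 := dvdn_gt0 (N0 _) dd.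
have [pd|pd] := boolP (p ^ e.+1 %| d)%N; apply/orP; [left|right].
  case/dvdnP: pd => c dE; apply/mapP; exists c; last by rewrite dE mulnC.
  by rewrite -dvdn_divisors // -(@dvdn_pmul2l (p ^ e.+1)) // mulnC -dE.
have [f [pf fE]] := pfactor_coprime pp d0.
have cpn i : coprime (p ^ i) n by rewrite coprimeXl // prime_coprime.
set l := logn p d in fE.
have le : (l <= e)%N by rewrite leqNgt; apply: contra pd => h; rewrite fE dvdn_mull // dvdn_exp2l.
rewrite fE mulnC dvdn_mul ?dvdn_exp2l //.
have : (f %| p ^ e.+1 * n)%N by apply: dvdn_trans dd; rewrite fE dvdn_mulr.
by rewrite Gauss_dvdr // coprimeXr // coprime_sym.
Qed.

(** Multiplied over all divisors of r, this is an instance of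
    (z^(p^(e+1) r) - 1) = (product of the new factors) (z^(p^e r) - 1); induction on r cancels
    the proper divisors. *)
Lemma cycval_pexp (p e r : nat) (z : int) :
  prime p -> (0 < r)%N -> ~~ (p %| r)%N -> 1 < z ->
  cycval (p ^ e.+1 * r) z * cycval r (z ^+ (p ^ e)) = cycval r (z ^+ (p ^ e.+1)).
Proof.
move=> pp r0 pr z1; have p0 := prime_gt0 pp.
have zX i : 1 < z ^+ (p ^ i) by rewrite exprn_egt1 // -lt0n expn_gt0 p0.
move: r {-2}r (leqnn r) r0 pr; elim=> [|k IH] n nk n0 pn; first lia.
have key : (\prod_(d <- divisors n) (cycval (p ^ e.+1 * d) z * cycval d (z ^+ (p ^ e)))
     = \prod_(d <- divisors n) cycval d (z ^+ (p ^ e.+1))).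
  rewrite big_split /= !prod_cycval //.
  have := prod_divisors_pexp e (cycval^~ z) pp n0 pn.
  have N0 i : (0 < p ^ i * n)%N by rewrite muln_gt0 expn_gt0 p0.
  by rewrite !prod_cycval // -!exprM => ->.
move: key; rewrite !(big_rem n (divisors_id n0)) /=.
set A := (X in _ * X = _); set B := (X in _ = _ * X).
have AB : A = B.
  apply: eq_big_seq => d; rewrite mem_rem_uniq ?divisors_uniq // inE -dvdn_divisors //.
  move=> /andP[dn dd]; have d0 := dvdn_gt0 n0 dd; have := dvdn_leq n0 dd => dle.
  apply: IH => //; first by have := ltn_neqAle d n; lia.
  by apply: contra pn => /dvdn_trans; apply.
rewrite AB => /mulIf; apply.
rewrite /B prodf_seq_neq0; apply/allP => d /mem_rem; rewrite -dvdn_divisors // => dd.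
by rewrite cycval_neq0 // (dvdn_gt0 n0 dd).
Qed.

Lemma pow1_expansion (t n : nat) : exists k, ((1 + t) ^ n = 1 + n * t + t * t * k)%N.
Proof.
elim: n => [|n [k IH]]; first by exists 0%N; rewrite muln0.
by exists (n + k + t * k)%N; rewrite expnS IH; nia.
Qed.

Lemma geom_expansion (t n : nat) :
  exists k, (\sum_(i < n) (1 + t) ^ i = n + t * 'C(n, 2) + t * t * k)%N.
Proof.
elim: n => [|n [k IH]]; first by exists 0%N; rewrite big_ord0 !muln0.
have [l El] := pow1_expansion t n.
exists (k + l)%N; rewrite big_ord_recr /= IH El binS bin1; nia.
Qed.

(** With x = 2^(m/q), both x^q - 1 and x - 1 are products of cyclotomic values, and the value of
    index m occurs only in the former. *)
Lemma cycval2_dvd_geom (m q : nat) : (0 < m)%N -> prime q -> (q %| m)%N ->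
  (`|cycval m 2|%N %| \sum_(i < q) (2 ^ (m %/ q)) ^ i)%N.
Proof.
move=> m0 pq /dvdnP[n mE]; have q0 := prime_gt0 pq.
have n0 : (0 < n)%N by move: m0; rewrite mE muln_gt0 => /andP[].
have -> : (m %/ q)%N = n by rewrite mE mulnK.
have absX i : `|(2 : int) ^+ i - 1|%N = (2 ^ i).-1.
  have : (0 < 2 ^ i)%N by rewrite expn_gt0.
  have -> : (2 : int) ^+ i = (2 ^ i)%N by elim: (i) => // j IH; rewrite exprS IH expnS PoszM.
  lia.
have x0 : (0 < (2 ^ n).-1)%N.
  by rewrite -subn1 subn_gt0 -[1%N](expn0 2) ltn_exp2l.
rewrite -(dvdn_pmul2l x0) -predn_exp -expnM -mE mulnC.
rewrite -!absX -!prod_cycval // -abszM.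
rewrite [X in (_ %| `|X|)%N](bigID (fun d => d %| n)%N) /= abszM.
have -> : \prod_(d <- divisors m | (d %| n)%N) cycval d 2 = \prod_(d <- divisors n) cycval d 2.
  rewrite -big_filter; apply: perm_big; apply: uniq_perm; rewrite ?filter_uniq ?divisors_uniq //.
  move=> d; rewrite mem_filter -!dvdn_divisors //; case: (boolP (d %| n)%N) => //= dn.
  by rewrite mE dvdn_mulr.
rewrite abszM mulnC dvdn_mul //.
rewrite (big_rem m) ?divisors_id //=.
have -> : (m %| n)%N = false.
  by apply/negbTE/negP => /(dvdn_leq n0); rewrite mE -{2}[n]muln1 leq_pmul2l // leqNgt prime_gt1.
by rewrite abszM dvdn_mulr.
Qed.

Lemma pred_pow2_mod (p i : nat) : prime p -> (p %| (2 ^ i).-1)%N = (2 ^ i == 1 %[mod p]).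
Proof. by move=> pp; rewrite eqn_mod_dvd ?expn_gt0 // subn1. Qed.

Lemma odd_of_dvd_pred_pow2 (p i : nat) : prime p -> (0 < i)%N -> (p %| (2 ^ i).-1)%N -> odd p.
Proof.
move=> pp i0 h; case: (even_prime pp) => // p2; move: h.
have : (0 < 2 ^ i)%N by rewrite expn_gt0.
by rewrite p2; case: i i0 => // i _; rewrite expnS dvdn2; case: (2 ^ i)%N => // n _; rewrite mulnS /= oddM.
Qed.

(** Let r be the order of 2 modulo p. If a prime q divides m / r, then x = 2^(m/q) is 1 modulo p,
    and the cyclotomic value divides 1 + x + ... + x^(q-1), which is q modulo p; so q = p.
    Expanding that sum modulo p^2 shows that p divides it only once. *)
Lemma nonprimitive_prime (m p i : nat) : prime p -> (p %| `|cycval m 2|)%N ->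
  (0 < i < m)%N -> (p %| (2 ^ i).-1)%N ->
  exists e r, [/\ m = (p ^ e.+1 * r)%N, (1 < r < p)%N, odd p & ~~ (p ^ 2 %| `|cycval m 2|)%N].
Proof.
move=> pp pc /andP[i0 im] pi; have m0 : (0 < m)%N by lia.
have podd := odd_of_dvd_pred_pow2 pp i0 pi.
have exr : exists r, (0 < r)%N && (p %| (2 ^ r).-1)%N by exists i; rewrite i0.
case: (ex_minnP exr) => r /andP[r0 pr] rmin.
have rdvd j : (p %| (2 ^ j).-1)%N -> (r %| j)%N.
  rewrite pred_pow2_mod // => hj; rewrite /dvdn; apply/negPn/negP; rewrite -lt0n => js.
  have := rmin (j %% r)%N; rewrite js pred_pow2_mod //=.
  have -> : (2 ^ (j %% r) == 1 %[mod p]).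
    have h1 : ((2 ^ r) ^ (j %/ r) = 1 %[mod p])%N.
      move: pr; rewrite pred_pow2_mod // => /eqP pr.
      by rewrite -modnXm pr modnXm exp1n.
    move: hj; rewrite {1}(divn_eq j r) expnD [(_ %/ _ * _)%N]mulnC expnM => /eqP hj; apply/eqP.
    by rewrite -hj -[in RHS]modnMml h1 modnMml mul1n.
  by move/(_ isT); rewrite leqNgt ltn_pmod.
have pm : (p %| (2 ^ m).-1)%N.
  have p2 : prime (pdiv m) by apply: pdiv_prime; lia.
  have x0 : (0 < 2 ^ (m %/ pdiv m))%N by rewrite expn_gt0.
  have := cycval2_dvd_geom m0 p2 (pdiv_dvd m) => /(dvdn_trans pc) h.
  by have := dvdn_mull (2 ^ (m %/ pdiv m)).-1 h; rewrite -predn_exp -expnM divnK ?pdiv_dvd.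
have r_gt1 : (1 < r)%N.
  by rewrite ltn_neqAle r0 andbT eq_sym; apply: contraTneq pr => ->; rewrite dvdn1 neq_ltn prime_gt1 // orbT.
have rp : (r < p)%N.
  have : (r %| p.-1)%N.
    apply: rdvd; rewrite pred_pow2_mod // -(totient_prime pp); apply/eqP; apply: Euler_exp_totient.
    by rewrite coprime_sym prime_coprime // dvdn_prime2 //; apply: contraTneq podd => ->.
  by have := prime_gt1 pp => p1 /dvdn_leq; lia.
have rm := rdvd _ pm.
have [n mE] := dvdnP rm.
have n0 : (0 < n)%N by move: m0; rewrite mE muln_gt0 => /andP[].
have n1 : (1 < n)%N.
  have := rmin i; rewrite i0 pi => /(_ isT); rewrite ltn_neqAle n0 andbT => ri.
  by apply/eqP => n1; move: im; rewrite mE -n1 mul1n; lia.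
have onlyp q : prime q -> (q %| n)%N -> q = p /\ ~~ (p ^ 2 %| `|cycval m 2|)%N.
  move=> pq /dvdnP[n' nE].
  have qm : (q %| m)%N by rewrite mE nE dvdn_mulr // dvdn_mull.
  have mq : (m %/ q)%N = (n' * r)%N by rewrite mE nE mulnAC mulnK // prime_gt0.
  have h := cycval2_dvd_geom m0 pq qm.
  have px : (p %| (2 ^ (m %/ q)).-1)%N by rewrite mq mulnC expnM predn_exp dvdn_mulr.
  have [y yE] := dvdnP px.
  have xE : (2 ^ (m %/ q) = 1 + p * y)%N.
    have : (0 < 2 ^ (m %/ q))%N by rewrite expn_gt0.
    by move=> h0; rewrite mulnC -yE add1n prednK.
  rewrite xE in h; have [k gE] := geom_expansion (p * y) q; rewrite gE in h.
  have pq' : p = q.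
    have := dvdn_trans pc h; rewrite -addnA dvdn_addl.
      by move/prime_nt_dvdP => /(_ pq) ->; rewrite // neq_ltn prime_gt1 // orbT.
    by rewrite dvdn_add // ?expnS -?mulnA dvdn_mulr.
  split=> //; apply/negP => h2; have := dvdn_trans h2 h.
  rewrite -pq' -addnA dvdn_addl.
    by move/(dvdn_leq (prime_gt0 pp)); rewrite leqNgt -{1}[p]expn1 ltn_exp2l ?prime_gt1.
  rewrite dvdn_add //; last by rewrite mulnACA mulnn -mulnA dvdn_mulr.
  by rewrite bin2odd // -mulnn mulnAC -mulnA dvdn_mul // dvdn_mulr // dvdn_mulr.
have pn : n = (p ^ (logn p n))%N.
  have := @part_pnat_id (p : nat_pred) n; rewrite p_part => -> //.
  by apply/pnatP => // q pq /(onlyp q pq)[-> _]; rewrite inE.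
have e0 : (0 < logn p n)%N.
  by rewrite lt0n; apply/eqP => e0; move: n1; rewrite pn e0.
have p2 := proj2 (onlyp _ (pdiv_prime n1) (pdiv_dvd n)).
exists (logn p n).-1, r; rewrite prednK // -pn r_gt1 rp; split=> //.
Qed.

Definition primitive (p m : nat) := [/\ prime p, (p %| (2 ^ m).-1)%N &
                forall i, (0 < i < m)%N -> ~~ (p %| (2 ^ i).-1)%N].

Lemma triple_le_pow2 (p : nat) : (5 <= p)%N -> (3 * p <= 2 ^ p.-1)%N.
Proof.
case: p => // p; rewrite ltnS /= => p4; rewrite -(subnKC p4).
elim: (p - 4)%N => [|n IH] //; rewrite addnS expnS; move: IH; set x := (2 ^ _)%N; lia.
Qed.

Lemma expn_gap (y p : nat) : (1 < y)%N -> (5 <= p)%N -> (p * y.+1 + 1 < y ^ p)%N.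
Proof.
move=> y1 p5; have p0 : (0 < p)%N by lia.
rewrite -(prednK p0) expnS prednK //.
have h : (2 ^ p.-1 <= y ^ p.-1)%N by rewrite leq_exp2r; lia.
have := leq_trans (triple_le_pow2 p5) h; set x := (y ^ _)%N => {}h.
have : (y * (3 * p) <= y * x)%N by rewrite leq_mul2l h orbT.
by move: p5 y1; clear; nia.
Qed.

(** With m = p^(e+1) r and y = 2^(p^e), the cyclotomic value is the quotient of two values that
    have the same number of factors, close to y^p and to y. *)
Lemma cycval2_lower (p e r N : nat) : prime p -> (0 < r)%N -> ~~ (p %| r)%N ->
  let y := (2 ^ (p ^ e))%N in
  (`|cycval (p ^ e.+1 * r) 2|%N <= N)%N -> (N * y.+1 + 1 < y ^ p)%N -> (0 < N)%N -> False.
Proof.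
move=> pp r0 pr y hN gap N0.
have p0 := prime_gt0 pp.
have y1 : (1 < y)%N by rewrite /y -[1%N](expn0 2) ltn_exp2l // expn_gt0 p0.
have yZ : (2 : int) ^+ (p ^ e) = y by rewrite /y; elim: (_ ^ _)%N => // j IH; rewrite exprS IH expnS PoszM.
have yZ1 : (2 : int) ^+ (p ^ e.+1) = (y ^ p)%N.
  by rewrite expnSr exprM yZ; elim: (p) => // j IH; rewrite exprS IH expnS PoszM.
have yp1 : (1 < y ^ p)%N by rewrite -(exp1n p) ltn_exp2r.
have := cycval_pexp e pp r0 pr (isT : (1 < 2 :> int)%R); rewrite yZ yZ1 => /(congr1 Num.norm).
rewrite normrM.
have /andP[_ h2] := @cycval_bounds r y r0 y1.
have /andP[h3 _] := @cycval_bounds r (y ^ p)%N r0 yp1.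
move=> E; move: h3; rewrite -E => h3.
have h4 : (`|cycval (p ^ e.+1 * r) 2| * `|cycval r y| <= N%:Z * (y%:Z + 1) ^+ totient r)%R.
  by apply: ler_pM => //; lia.
have := le_trans h3 h4.
have trace : (0 < totient r)%N by rewrite totient_gt0.
have : (N%:Z * (y%:Z + 1) ^+ totient r <= (N%:Z * (y%:Z + 1)) ^+ totient r)%R.
  rewrite exprMn; apply: ler_wpM2r; first by apply: exprn_ge0; lia.
  by rewrite -(prednK trace) exprS ler_peMr //; apply: exprn_ege1; lia.
have : ((N%:Z * (y%:Z + 1)) ^+ totient r < ((y ^ p)%N%:Z - 1) ^+ totient r)%R.
  rewrite ltrXn2r ?nnegrE; try lia.
set a := (_ ^+ _)%R; set b := (_ ^+ _)%R; set c := (_ * _ ^+ _)%R; lia.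
Qed.

(** Zsigmondy's theorem for base 2: if no prime divisor of the cyclotomic value N of index m at 2
    were primitive, N would be 1 or a single prime divisor of m, which cycval2_lower excludes. *)
Lemma primitive_prime (m : nat) : (2 < m)%N -> m <> 6%N -> exists p, primitive p m.
Proof.
move=> m2 m6; have m0 : (0 < m)%N by lia.
set N := `|cycval m 2|%N.
have N0 : (0 < N)%N by rewrite absz_gt0 cycval_neq0.
have N1 : (1 < N)%N.
  rewrite ltnNge; apply/negP => N1.
  (* The lower bound is nontrivial for p = 2 if 4 divides m, and for any odd p otherwise. *)
  have [p [e [r [pp r0 pr mE gap]]]] : exists p e r, [/\ prime p, (0 < r)%N, ~~ (p %| r)%N,
      m = (p ^ e.+1 * r)%N & (1 * (2 ^ (p ^ e)).+1 + 1 < (2 ^ (p ^ e)) ^ p)%N].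
    have [/dvdnP[n mE]|m4] := boolP (4 %| m)%N.
      have n0 : (0 < n)%N by lia.
      have [r r2 nE] := pfactor_coprime (isT : prime 2) n0.
      exists 2, (logn 2 n).+1, r; split=> //.
      - by move: r2; rewrite prime_coprime //; case: (r) => //=; rewrite nE in n0 *; lia.
      - by move: r2; rewrite prime_coprime.
      - rewrite mE {1}nE !expnS; set x := (2 ^ logn 2 n)%N; clear; lia.
      have : (2 ^ 2 <= 2 ^ (2 ^ (logn 2 n).+1))%N.
        by rewrite leq_exp2l // -{1}[2%N]expn1 leq_exp2l.
      by set y := (2 ^ (2 ^ _))%N; rewrite -mulnn; nia.
    have [p pp [podd pm]] : exists2 p, prime p & odd p /\ (p %| m)%N.
      have [modd|modd] := boolP (odd m).
        exists (pdiv m); first by apply: pdiv_prime; lia.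
        by split; [apply: dvdn_odd modd|]; apply: pdiv_dvd.
      have hm : (2 * m./2)%N = m by lia.
      exists (pdiv m./2); first by apply: pdiv_prime; lia.
      split; last by rewrite -[X in (_ %| X)%N]hm dvdn_mull // pdiv_dvd.
      apply: (dvdn_odd (pdiv_dvd _)); apply: contraR m4 => h.
      by rewrite -[X in (_ %| X)%N]hm -[4%N]/(2 * 2)%N dvdn_pmul2l // dvdn2.
    have [r rp mE] := pfactor_coprime pp m0.
    have e0 : (0 < logn p m)%N by rewrite logn_gt0 mem_primes pp m0.
    exists p, (logn p m).-1, r; rewrite prednK //; split=> //.
    - by move: m0; rewrite mE muln_gt0 => /andP[].
    - by rewrite -prime_coprime.
    - by rewrite mulnC.
    have y2 : (2 ^ 1 <= 2 ^ (p ^ (logn p m).-1))%N by rewrite leq_exp2l // expn_gt0 prime_gt0.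
    move: y2; set y := (2 ^ (p ^ _))%N => y2.
    have p3 : (3 <= p)%N by have := prime_gt1 pp; lia.
    apply: (@leq_trans (y ^ 3)); last by rewrite leq_pexp2l; lia.
    by rewrite !expnS expn0 muln1; nia.
  by apply: (@cycval2_lower p e r 1) => //; rewrite -mE.
have noprim p : prime p -> (p %| N)%N ->
    (exists2 i, (0 < i < m)%N & (p %| (2 ^ i).-1)%N) ->
    exists e r, [/\ m = (p ^ e.+1 * r)%N, (1 < r < p)%N, odd p & ~~ (p ^ 2 %| N)%N].
  by move=> pp pN [i im pi]; apply: nonprimitive_prime pi.
have pm p : prime p -> (p %| N)%N -> (p %| (2 ^ m).-1)%N.
  move=> pp pN; have p2 : prime (pdiv m) by apply: pdiv_prime; lia.
  have x0 : (0 < 2 ^ (m %/ pdiv m))%N by rewrite expn_gt0.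
  have := cycval2_dvd_geom m0 p2 (pdiv_dvd m) => /(dvdn_trans pN) h.
  by have := dvdn_mull (2 ^ (m %/ pdiv m)).-1 h; rewrite -predn_exp -expnM divnK ?pdiv_dvd.
have dec p : prime p -> (p %| N)%N ->
   (forall i, (0 < i < m)%N -> ~~ (p %| (2 ^ i).-1)%N) \/
   (exists2 i, (0 < i < m)%N & (p %| (2 ^ i).-1)%N).
  move=> pp pN; have [h|h] := boolP [exists i : 'I_m, (0 < i)%N && (p %| (2 ^ i).-1)%N].
    by case/existsP: h => i /andP[i0 pi]; right; exists i => //; rewrite i0 /=.
  left=> i /andP[i0 im]; apply: contra h => pi; apply/existsP; exists (Ordinal im).
  by rewrite i0.
set p := pdiv N; have pp : prime p by apply: pdiv_prime.
have pN : (p %| N)%N by apply: pdiv_dvd.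
case: (dec p pp pN) => [h|/(noprim p pp pN)[e [r [mE /andP[r1 rp] podd p2]]]].
  by exists p; split=> //; apply: pm.
have [h|h] := boolP (p.-nat N); last first.
  have : exists2 q, prime q & (q %| N)%N && (q != p).
    have /hasP[q] : has (fun q => q != p) (primes N).
      apply/negP => /negP; rewrite -all_predC => /allP hh; case/negP: h.
      by rewrite /pnat N0; apply/allP => q /hh /=; rewrite negbK inE.
    by rewrite mem_primes => /and3P[pq _ qN] qp; exists q => //; rewrite qN.
  case=> q pq /andP[qN qp]; case: (dec q pq qN) => [hq|/(noprim q pq qN)[e' [r' [mE' /andP[r1' rq] _ _]]]].
    by exists q; split=> //; apply: pm.
  exfalso.
  have qr : (q <= r)%N.
    apply: dvdn_leq; first lia.
    have : (q %| p ^ e.+1 * r)%N by rewrite -mE mE' expnS -mulnA dvdn_mulr.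
    by rewrite Euclid_dvdM // Euclid_dvdX // dvdn_prime2 // (negbTE qp).
  have pr : (p <= r')%N.
    apply: dvdn_leq; first lia.
    have : (p %| q ^ e'.+1 * r')%N by rewrite -mE' mE expnS -mulnA dvdn_mulr.
    by rewrite Euclid_dvdM // Euclid_dvdX // dvdn_prime2 // eq_sym (negbTE qp).
  lia.
exfalso.
have NE : N = p.
  have NE : N = (p ^ logn p N)%N by rewrite -p_part part_pnat_id.
  have : (logn p N <= 1)%N by rewrite leqNgt -pfactor_dvdn.
  by move: NE N1; case: (logn p N) => [|[|//]] ->.
have pr : ~~ (p %| r)%N by apply/negP => /dvdn_leq; lia.
apply: (@cycval2_lower p e r p) => //; [lia | by rewrite -mE -NE | | exact: prime_gt0].
have y1 : (1 < 2 ^ (p ^ e))%N by rewrite -[1%N](expn0 2) ltn_exp2l // expn_gt0 prime_gt0.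
have [p5|p5] := leqP 5 p; first exact: expn_gap.
have p3 : p = 3 by move: podd r1 rp p5; case: (p) => [|[|[|[|[|?]]]]] //; lia.
have r2 : r = 2 by lia.
have e1 : (0 < e)%N by rewrite lt0n; apply/eqP => e0; apply: m6; rewrite mE p3 r2 e0.
have : (2 ^ 3 <= 2 ^ (p ^ e))%N by rewrite leq_exp2l // p3 -(prednK e1) expnS leq_pmulr // expn_gt0.
rewrite p3; set y := (2 ^ (3 ^ _))%N => y8.
by rewrite !expnS expn0 muln1; clear -y8; nia.
Qed.

(** * Additive maps of finite groups *)

Definition additive_map (U V : zmodType) (f : U -> V) := forall u v, f (u + v) = f u + f v.

Lemma additive_map0 (U V : zmodType) (f : U -> V) : additive_map f -> f 0 = 0.
Proof. by move=> fD; apply: (addrI (f 0)); rewrite -fD !addr0. Qed.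

Lemma additive_map_sum (U V : zmodType) (f : U -> V) (I : Type) (r : seq I) (P : pred I) (g : I -> U) :
  additive_map f -> f (\sum_(i <- r | P i) g i) = \sum_(i <- r | P i) f (g i).
Proof. by move=> fD; apply: (big_morph f fD (additive_map0 fD)). Qed.

Lemma additive_map_inj (U V : zmodType) (f : U -> V) : additive_map f -> (forall u, f u = 0 -> u = 0) -> injective f.
Proof.
move=> fD f0 u v e; apply/eqP; rewrite -subr_eq0; apply/eqP/f0.
by apply: (addIr (f v)); rewrite -fD subrK add0r.
Qed.

Lemma surj_inj (T : finType) (f : T -> T) : (forall y, exists x, f x = y) -> injective f.
Proof.
move=> /fin_all_exists[g gK] x y e.
have gi : injective g by apply: (can_inj gK).
by rewrite -(f_invF gi x) -(f_invF gi y) !gK in e *; rewrite e.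
Qed.

Lemma inj_surj (T : finType) (f : T -> T) : injective f -> forall y, exists x, f x = y.
Proof. by move=> fi y; exists (invF fi y); rewrite f_invF. Qed.

Section IndexTwo.
Variables (V : finZmodType) (R : nzRingType) (exp2 : forall x : V, x + x = 0).
Variables (f : V -> V) (phi : V -> R) (a : V).
Hypotheses (fD : additive_map f) (phiD : additive_map phi).
Hypothesis kerf : forall x, f x = 0 -> x = 0 \/ x = a.
Hypothesis phif : forall x, phi (f x) = 0.

(** The image of f has index at most 2, since the kernel has at most two elements, and it lies in
    the kernel of phi, which has index 2. *)
Lemma index_two_image w0 : phi w0 <> 0 -> forall w, phi w = 0 -> exists x, w = f x.
Proof.
move=> phiw0 w phiw.
have fK x y : f x = f y -> y = x \/ y = x + a.
  move=> e; have : f (x + y) = 0 by rewrite fD e exp2.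
  by case/kerf => h; [left|right]; rewrite -[y]add0r -(exp2 x) -addrA h ?addr0.
pose I := [set f x | x in [set: V]]; pose H := [set x | phi x == 0].
have IH : I \subset H by apply/subsetP => _ /imsetP[x _ ->]; rewrite inE phif.
have cI : (#|V| <= #|I| * 2)%N.
  rewrite -cardsT -sum1_card (partition_big f (mem I)) /=; last by move=> x _; apply: imset_f.
  rewrite -sum_nat_const; apply: leq_sum => _ /imsetP[x _ ->].
  rewrite sum1dep_card; apply: (@leq_trans #|[set x; x + a]|); last by rewrite cards2; case: eqP.
  by apply/subset_leq_card/subsetP => y; rewrite !inE => /eqP/esym/fK[] ->; rewrite eqxx ?orbT.
have cH : (#|H| * 2 <= #|V|)%N.
  rewrite -(cardC (mem H)) muln2 -addnn leq_add2l.
  rewrite -(card_imset (mem H) (addrI w0)); apply/subset_leq_card/subsetP => _ /imsetP[x xH ->].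
  move: xH; rewrite !inE phiD => /eqP ->; rewrite addr0; exact/eqP.
have : I == H by rewrite eqEcard IH -(leq_pmul2r (isT : 0 < 2)%N) (leq_trans cH).
move/eqP => EIH; have : w \in I by rewrite EIH inE phiw.
by case/imsetP => x _ ->; exists x.
Qed.
End IndexTwo.

(** * Frobenius powers and the trace of a field of order 2 ^ m *)

Section Frobenius.
Variables (K : finFieldType) (m : nat).
Hypothesis cardK : #|K| = (2 ^ m)%N.
Hypothesis m_gt1 : (1 < m)%N.

Definition frob (k : nat) (x : K) : K := x ^+ (2 ^ k).

Lemma pchar2 : 2 \in [pchar K].
Proof. exact: card_finPcharP cardK _. Qed.

Lemma two0 : 2%:R = 0 :> K.
Proof. exact: pcharf0 pchar2. Qed.

Lemma three1 : 3%:R = 1 :> K.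
Proof. by rewrite -[3%:R]/((2 + 1)%:R) natrD two0 add0r. Qed.

Lemma four0 : 4%:R = 0 :> K.
Proof. by rewrite -[4%:R]/((2 + 2)%:R) natrD two0 addr0. Qed.

Lemma opp1 : - 1 = 1 :> K.
Proof. exact: oppr_pchar2 pchar2 _. Qed.

Lemma addKK (x : K) : x + x = 0.
Proof. exact: addrr_pchar2 pchar2 x. Qed.

Lemma addK_eq0 (x y : K) : x + y = 0 -> x = y.
Proof. by move=> h; rewrite -[x]addr0 -(addKK y) addrA h add0r. Qed.

Lemma frD k : additive_map (frob k).
Proof.
move=> x y; apply: exprDn_pchar; apply/pnatP => [|p pp]; first by rewrite expn_gt0.
by rewrite Euclid_dvdX // => /andP[]; rewrite dvdn_prime2 // => /eqP -> _; apply: pchar2.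
Qed.

Lemma frM k x y : frob k (x * y) = frob k x * frob k y.
Proof. exact: exprMn. Qed.

Lemma fr0 k : frob k 0 = 0. Proof. exact: additive_map0 (frD k). Qed.
Lemma fr1 k : frob k 1 = 1. Proof. exact: expr1n. Qed.
Lemma fr0E x : frob 0 x = x. Proof. by rewrite /frob expr1. Qed.
Lemma fr1E x : frob 1 x = x * x. Proof. by rewrite /frob expn1 expr2. Qed.
Lemma frV k x : frob k x^-1 = (frob k x)^-1. Proof. exact: exprVn. Qed.
Lemma fr_eq0 k x : (frob k x == 0) = (x == 0).
Proof. by rewrite /frob expf_eq0 expn_gt0. Qed.

Lemma fr_comp i j x : frob i (frob j x) = frob (i + j) x.
Proof. by rewrite /frob -exprM -expnD addnC. Qed.

Lemma frC i j x : frob i (frob j x) = frob j (frob i x).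
Proof. by rewrite !fr_comp addnC. Qed.

Lemma fr_inj k : injective (frob k).
Proof.
apply: additive_map_inj; first exact: frD.
by move=> x /eqP; rewrite fr_eq0 => /eqP.
Qed.

Lemma fr_surj k y : exists x, frob k x = y.
Proof. exact: inj_surj (@fr_inj k) y. Qed.

Lemma frm x : frob m x = x.
Proof. by rewrite /frob -cardK expf_card. Qed.

Lemma frmM i x : frob (m * i) x = x.
Proof. by elim: i => [|i IH]; rewrite ?muln0 // mulnS -fr_comp IH frm. Qed.

Lemma fr_mod k x : frob (k %% m) x = frob k x.
Proof. by rewrite {2}(divn_eq k m) -fr_comp mulnC frmM. Qed.

Lemma fr_sum k (I : Type) (r : seq I) (P : pred I) (g : I -> K) :
  frob k (\sum_(i <- r | P i) g i) = \sum_(i <- r | P i) frob k (g i).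
Proof. exact: additive_map_sum (frD k). Qed.

(** Distinct powers of Frobenius are linearly independent, as a combination of them is a
    polynomial of degree less than the order of the field. *)
Lemma fr_indep (e : 'I_m -> 'I_m) (c : 'I_m -> K) : injective e ->
  (forall x, \sum_(i < m) c i * frob (e i) x = 0) -> forall i, c i = 0.
Proof.
move=> ei h i.
pose P : {poly K} := \sum_(i < m) c i *: 'X^(2 ^ e i).
have P0 : P = 0.
  apply/eqP/negPn/negP => Pn0.
  have := max_poly_roots Pn0 (rs := enum K); rewrite -cardT cardK enum_uniq.
  have -> : all (root P) (enum K).
    apply/allP => x _; rewrite /root /P horner_sum -[X in _ == X](h x); apply/eqP.
    by apply: eq_bigr => j _; rewrite hornerZ hornerXn.
  move=> /(_ isT isT); apply/negP; rewrite -leqNgt /P.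
  apply: (leq_trans (size_sum _ _ _)); apply/bigmax_leqP => j _.
  apply: (leq_trans (size_scale_leq _ _)); rewrite size_polyXn.
  by rewrite ltn_exp2l.
have := congr1 (fun p : {poly K} => p`_(2 ^ e i)) P0.
rewrite coef0 /P coef_sum (bigD1 i) //= coefZ coefXn eqxx mulr1 big1 ?addr0 // => j ji.
rewrite coefZ coefXn eqn_exp2l //.
case: eqP => [/val_inj/ei jE|_]; last by rewrite mulr0.
by rewrite jE eqxx in ji.
Qed.

Lemma fr_id_dvd k : (forall x, frob k x = x) -> (m %| k)%N.
Proof.
move=> h; have m0 : (0 < m)%N by lia.
have kn := ltn_pmod k m0; pose i0 : 'I_m := Ordinal m0; pose i1 : 'I_m := Ordinal kn.
apply/negPn/negP; rewrite /dvdn => km.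
have ne : i1 != i0 by [].
have := @fr_indep id (fun i => if (i == i0) || (i == i1) then 1 else 0) (@inj_id _) _ i0.
rewrite eqxx => H; suff /eqP : 1 = 0 :> K by rewrite oner_eq0.
apply: H => x.
rewrite (bigD1 i0) // (bigD1 i1) //= big1 => [|i /andP[/negbTE -> /negbTE ->]]; last by rewrite mul0r.
by rewrite !eqxx orbT !mul1r addr0 fr_mod h addKK.
Qed.

Lemma coprime_gt0 k : coprime k m -> (0 < k)%N.
Proof. by case: k => //; rewrite /coprime gcd0n => /eqP m1; move: m_gt1; rewrite m1. Qed.

(** As k is invertible modulo m, such an x is fixed by the squaring map. *)
Lemma fr_fix k x : coprime k m -> frob k x = x -> x = 0 \/ x = 1.
Proof.
move=> co h.
have hM j : frob (k * j) x = x by elim: j => [|j IH]; rewrite ?muln0 ?mulnS -?fr_comp ?IH.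
case/(coprimeP _ (coprime_gt0 co)): co => [[u v] /= E].
have : frob (u * k) x = frob (v * m + 1) x by congr frob; lia.
rewrite mulnC hM addnC -fr_comp mulnC frmM /frob expn1 expr2 => e.
have /eqP : x * (x - 1) = 0 by rewrite mulrBr -e mulr1 subrr.
by rewrite mulf_eq0 subr_eq0 => /orP[]/eqP; [left|right].
Qed.

Lemma mul_mod_inj k i j : coprime k m -> (i < m)%N -> (j < m)%N ->
  (k * i = k * j %[mod m])%N -> i = j.
Proof.
move=> co im jm /eqP e.
have cop i' j' : (i' <= j')%N -> (j' < m)%N -> (k * i' == k * j' %[mod m])%N -> i' = j'.
  move=> le lt; rewrite eq_sym eqn_mod_dvd ?leq_mul2l ?le ?orbT // -mulnBr.
  rewrite Gauss_dvdr 1?coprime_sym // => /dvdnP[q]; case: q => [|q]; first lia.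
  by rewrite mulSn; lia.
case: (leqP i j) => ij; first by apply: cop.
by apply/esym/cop; [exact: ltnW | exact: im | rewrite eq_sym].
Qed.

Lemma frk_indep k d (c : nat -> K) : coprime k m -> (d <= m)%N ->
  (forall x, \sum_(i < d) c i * frob (k * i) x = 0) -> forall i, (i < d)%N -> c i = 0.
Proof.
move=> co dm h i id; have m0 : (0 < m)%N by lia.
pose e (i : 'I_m) : 'I_m := Ordinal (ltn_pmod (k * i) m0).
have ei : injective e.
  by move=> a b /(congr1 val) /= /(mul_mod_inj co (ltn_ord _) (ltn_ord _)) /val_inj.
pose c' (i : 'I_m) := if (i < d)%N then c i else 0.
have := @fr_indep e c' ei _ (Ordinal (leq_trans id dm)); rewrite /c' /= id; apply => x.
rewrite -[RHS](h x) (big_ord_widen_cond m predT (fun i => c i * frob (k * i) x)) //= [RHS]big_mkcond /=.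
by apply: eq_bigr => j _; case: ifP => _; rewrite ?mul0r // fr_mod.
Qed.

Definition trace (x : K) : K := \sum_(i < m) frob i x.

Lemma trD : additive_map trace.
Proof. by move=> x y; rewrite /trace -big_split; apply: eq_bigr => i _; apply: frD. Qed.

Lemma tr0 : trace 0 = 0. Proof. exact: additive_map0 trD. Qed.

Lemma tr_fr1 x : trace (frob 1 x) = trace x.
Proof.
have m0 : (0 < m)%N by lia.
have E : \sum_(i < m.-1.+1) frob i (frob 1 x) = \sum_(i < m.-1.+1) frob i x.
  rewrite big_ord_recr [RHS]big_ord_recl /= addrC fr_comp addn1 prednK // frm.
  rewrite [in RHS]/frob expr1; congr (_ + _).
  by apply: eq_bigr => i _; rewrite fr_comp addn1.
by move: E; rewrite prednK.
Qed.

Lemma tr_fr k x : trace (frob k x) = trace x.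
Proof. by elim: k => [|k IH]; [rewrite /frob expr1 | rewrite -addn1 addnC -fr_comp tr_fr1]. Qed.

Lemma fr_tr k x : frob k (trace x) = trace x.
Proof. by rewrite /trace fr_sum -[RHS](tr_fr k); apply: eq_bigr => i _; rewrite frC. Qed.

Lemma tr01 x : trace x = 0 \/ trace x = 1.
Proof. by apply: (@fr_fix 1); rewrite ?coprime1n // fr_tr. Qed.

(** The map x -> trace (c x) is a combination of distinct powers of Frobenius. *)
Lemma tr_nondeg c : (forall x, trace (c * x) = 0) -> c = 0.
Proof.
move=> h; have m0 : (0 < m)%N by lia.
have := @fr_indep id (fun i => frob i c) (@inj_id _) _ (Ordinal m0); rewrite /frob expr1; apply=> x.
by rewrite -[RHS](h x) /trace; apply: eq_bigr => i _; rewrite -frM.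
Qed.

End Frobenius.

(* The four rewrite rules reduce modulo 2 the coefficients that arise when a ring identity in
   characteristic 2 is normalized over the integers. *)
Ltac ring2 H := ring: (two0 H) (three1 H) (four0 H) (opp1 H).

(** * Semilinear maps of the plane *)

Section Plane.
Variable K : finFieldType.
Implicit Types (a b : K) (u v w : K * K).

Definition scale a v : K * K := (a * v.1, a * v.2).
(** The sign is dropped, as the form is used in characteristic 2 only. *)
Definition det u v : K := u.1 * v.2 + u.2 * v.1.
Definition semilinear (r : K -> K) (L : K * K -> K * K) :=
  additive_map L /\ forall a v, L (scale a v) = scale (r a) (L v).

Lemma scaleD a u v : scale a (u + v) = scale a u + scale a v.
Proof. by rewrite /scale /= !mulrDr. Qed.
Lemma scaleDl a b v : scale (a + b) v = scale a v + scale b v.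
Proof. by rewrite /scale /= !mulrDl. Qed.
Lemma scaleA a b v : scale a (scale b v) = scale (a * b) v.
Proof. by rewrite /scale /= !mulrA. Qed.
Lemma scale1 v : scale 1 v = v.
Proof. by case: v => x y; rewrite /scale /= !mul1r. Qed.
Lemma scale0 v : scale 0 v = 0.
Proof. by rewrite /scale !mul0r. Qed.
Lemma scaler0 a : scale a 0 = 0.
Proof. by rewrite /scale /= !mulr0. Qed.

Lemma scale_eq0 a v : scale a v = 0 -> a = 0 \/ v = 0.
Proof.
move=> h; have [->|/eqP an0] := eqVneq a 0; [by left | right].
by rewrite -[v]scale1 -(mulVf (introN eqP an0)) -scaleA h scaler0.
Qed.

Lemma detDl u v w : det (u + v) w = det u w + det v w.
Proof. by rewrite /det /=; ring. Qed.
Lemma detDr u v w : det w (u + v) = det w u + det w v.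
Proof. by rewrite /det /=; ring. Qed.
Lemma detZl a u v : det (scale a u) v = a * det u v.
Proof. by rewrite /det /=; ring. Qed.
Lemma detZr a u v : det u (scale a v) = a * det u v.
Proof. by rewrite /det /=; ring. Qed.
Lemma detC u v : det u v = det v u.
Proof. by rewrite /det; ring. Qed.
Lemma det0l u : det 0 u = 0.
Proof. by rewrite /det /=; ring. Qed.
Lemma det0r u : det u 0 = 0.
Proof. by rewrite /det /=; ring. Qed.

Lemma coordE v : v = scale v.1 (1, 0) + scale v.2 (0, 1).
Proof. by case: v => x y; congr (_, _) => /=; ring. Qed.

Lemma det_nondeg u : (forall v, det u v = 0) -> u = 0.
Proof.
case: u => x y h; have := h (0, 1); have := h (1, 0); rewrite /det /=.
by rewrite !mulr0 !mulr1 addr0 add0r => -> ->.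
Qed.

Lemma exists_det u : u <> 0 -> exists v, det u v <> 0.
Proof.
move=> u0; have [/existsP[v /eqP h]|/existsPn h] := boolP [exists v, det u v != 0]; first by exists v.
by case: u0; apply: det_nondeg => v; apply/eqP; have := h v; rewrite negbK.
Qed.

End Plane.

Section Char2.
Variables (K : finFieldType) (m : nat).
Hypothesis cardK : #|K| = (2 ^ m)%N.
Hypothesis m_gt1 : (1 < m)%N.
Implicit Types (a b : K) (u v w x : K * K).

Lemma det_id u : det u u = 0.
Proof. by rewrite /det; ring2 cardK. Qed.

Lemma addVV v : v + v = 0.
Proof. by case: v => x y; congr (_, _) => /=; ring2 cardK. Qed.

Lemma addV_eq0 u v : u + v = 0 -> u = v.
Proof. by move=> h; rewrite -[u]addr0 -(addVV v) addrA h add0r. Qed.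

Lemma det_basis u w : det u w <> 0 ->
  forall x, x = scale (det x w / det u w) u + scale (det x u / det u w) w.
Proof.
move=> /eqP; case: u w => u1 u2 [w1 w2]; rewrite /det /scale /= => h [x y].
by congr (_, _) => /=; field: (two0 cardK).
Qed.

Lemma det_eq0 u v : u <> 0 -> det v u = 0 -> exists c, v = scale c u.
Proof.
move=> u0 h; have [w uw] := exists_det u0; exists (det v w / det u w).
by rewrite {1}(det_basis uw v) h mul0r scale0 addr0.
Qed.

Lemma semilinear_det (r : K -> K) L : additive_map r -> (forall a b, r (a * b) = r a * r b) -> semilinear r L ->
  forall u v, det (L u) (L v) = det (L (1, 0)) (L (0, 1)) * r (det u v).
Proof.
move=> rD rM [LD LZ] u v; rewrite {1}(coordE u) {1}(coordE v) !LD !LZ.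
by rewrite /det /= rD !rM; ring2 cardK.
Qed.

End Char2.

Definition frob_semilinear (K : finFieldType) k (T : K * K -> K * K) := semilinear (@frob K k) T.
(** No line is mapped into itself. *)
Definition irred (K : finFieldType) (T : K * K -> K * K) := forall v, v <> 0 -> det (T v) v <> 0.
(** For a semilinear map T this is a pair of biprojective forms; every bipF arises in this way, and
    the equivalence problem becomes one about the operators T. *)
Definition quadF (K : finFieldType) (T : K * K -> K * K) (v : K * K) : K * K :=
  (det (T v) v, det (T (T v)) v).
(** The polar form of quadF T. *)
Definition polF (K : finFieldType) (T : K * K -> K * K) (u v : K * K) : K * K :=
  (det (T u) v + det (T v) u, det (T (T u)) v + det (T (T v)) u).
(** How quadF T transforms when its argument is multiplied by a. *)
Definition torus (K : finFieldType) k (a : K) (w : K * K) : K * K :=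
  (frob k a * a * w.1, frob k (frob k a) * a * w.2).
Definition trace_pairing (K : finFieldType) (m : nat) (p w : K * K) : K := trace m (p.1 * w.1 + p.2 * w.2).

(** * The polar form at a point *)

Section Local.
Variables (K : finFieldType) (m k : nat).
Hypothesis cardK : #|K| = (2 ^ m)%N.
Hypothesis m_gt1 : (1 < m)%N.
Hypothesis co : coprime k m.
Variable T : K * K -> K * K.
Hypothesis Tlin : frob_semilinear k T.
Hypothesis Tirr : irred T.
Local Notation s := (@frob K k).
Implicit Types (a b : K) (u v w x : K * K).

Let TD : additive_map T := proj1 Tlin.
Let TZ : forall a v, T (scale a v) = scale (s a) (T v) := proj2 Tlin.
Let sD : additive_map s := frD cardK k.
Let sM := @frM K k.

Lemma T_inj : injective T.
Proof.
apply: additive_map_inj TD _ => u h; have [//|/eqP/Tirr] := eqVneq u 0.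
by rewrite h det0l.
Qed.

Lemma quadF_polar u v : quadF T (u + v) = quadF T u + quadF T v + polF T u v.
Proof. by rewrite /quadF /polF !TD !detDl !detDr; congr (_, _) => /=; ring. Qed.

Lemma quadF0 : quadF T 0 = 0.
Proof. by rewrite /quadF !det0r. Qed.

Lemma polFD u : additive_map (polF T u).
Proof. by move=> v w; rewrite /polF !TD !detDl !detDr; congr (_, _) => /=; ring. Qed.

Lemma polFC u v : polF T u v = polF T v u.
Proof. by rewrite /polF; congr (_, _); rewrite addrC. Qed.

Lemma torusD a : additive_map (@torus K k a).
Proof. by move=> v w; rewrite /torus; congr (_, _) => /=; ring. Qed.

Lemma torusM a b w : torus k a (torus k b w) = torus k (a * b) w.
Proof. by rewrite /torus /= !frM; congr (_, _); ring. Qed.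

Lemma torus1 w : torus k 1 w = w.
Proof. by case: w => x y; rewrite /torus !fr1 !mul1r. Qed.

Lemma quadF_sc a v : quadF T (scale a v) = torus k a (quadF T v).
Proof. by rewrite /quadF /torus !TZ !detZl !detZr; congr (_, _) => /=; ring. Qed.

Lemma polF_sc a u v : polF T (scale a u) (scale a v) = torus k a (polF T u v).
Proof. by rewrite /polF /torus !TZ !detZl !detZr; congr (_, _) => /=; ring. Qed.

Lemma trace_pairingD p : additive_map (@trace_pairing K m p).
Proof. by move=> v w; rewrite /trace_pairing -(trD cardK) /=; congr trace; ring. Qed.

Lemma trace_pairing_torus a p w : trace_pairing m (torus k a p) w = trace_pairing m p (torus k a w).
Proof. by rewrite /trace_pairing /torus /=; congr trace; ring. Qed.

Section AtPoint.
Variable u : K * K.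
Hypothesis u0 : u <> 0.
Let f := det (T u) u.
Let f0 : f != 0. Proof. exact/eqP/Tirr. Qed.
Let a := det (T (T u)) u / f.
Let b := det (T (T u)) (T u) / f.

Lemma TTu : T (T u) = scale a (T u) + scale b u.
Proof. exact: (det_basis cardK (Tirr u0) (T (T u))). Qed.

Lemma pairE x : x = scale (det x (T u) / f) u + scale (det x u / f) (T u).
Proof. by rewrite addrC; exact: (det_basis cardK (Tirr u0) x). Qed.

(** A root z would make the line of z u + T u stable under T. *)
Lemma noroot z : s z * z + a * z + b <> 0.
Proof.
have zn0 : scale z u + T u <> 0.
  move=> h; have := congr1 (fun w => det w u) h.
  by rewrite detDl detZl (det_id cardK) mulr0 add0r det0l => /eqP; rewrite (negbTE f0).
move=> h; apply: (Tirr zn0); rewrite TD TZ TTu.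
transitivity (f * (s z * z + a * z + b)); last by rewrite h mulr0.
by rewrite /f /det /=; ring2 cardK.
Qed.

Lemma b_neq0 : b <> 0.
Proof. by have := noroot (z := 0); rewrite !mulr0 !add0r. Qed.

Lemma polF_coord p r : polF T u (scale p u + scale r (T u)) =
  (f * (p + s p + s r * a),
   f * (a * (p + s (s p)) + r * b + s (s r) * (s a * a + s b))).
Proof.
have T3 : T (T (T u)) = scale (s a) (T (T u)) + scale (s b) (T u) by rewrite {1}TTu TD !TZ.
rewrite /polF !TD !TZ T3 !TTu.
by congr (_, _); rewrite /f /det /=; ring2 cardK.
Qed.

(** Almost perfect nonlinearity: a solution with nonzero second coordinate r yields the root
    b / y of z^(s+1) + a z + b, where y^2 = b r / s r. *)
Lemma polF_ker x : polF T u x = 0 -> x = 0 \/ x = u.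
Proof.
rewrite (pairE x); set p := _ / f; set r := _ / f; clearbody p r.
rewrite polF_coord => -[] /eqP; rewrite mulf_eq0 (negbTE f0) /= => /eqP E1.
move=> /eqP; rewrite mulf_eq0 (negbTE f0) /= => /eqP E2.
have [r0|rn0] := eqVneq r 0.
  have [|->|->] := fr_fix cardK m_gt1 co (x := p); [| left | right].
  - by apply/esym/(addK_eq0 cardK); rewrite -[RHS]E1 r0 (fr0 cardK) mul0r addr0.
  - by rewrite r0 !scale0 addr0.
  - by rewrite r0 scale0 scale1 addr0.
exfalso; have nr := noroot; have bne := b_neq0; clearbody a b.
have srn0 : s r != 0 by rewrite fr_eq0.
have ssrn0 : s (s r) != 0 by rewrite !fr_eq0.
have sbn0 : s b != 0 by rewrite fr_eq0; apply/eqP.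
have bn0 : b != 0 by apply/eqP.
have E3 : s r * (a * a) + r * b + s (s r) * s b = 0.
  have e : p + s p = s r * a.
    by apply: (addK_eq0 cardK).
  have e2 : s p + s (s p) = s (s r) * s a by rewrite -sM -e sD.
  have e3 : p + s (s p) = s r * a + s (s r) * s a by rewrite -e -e2; ring2 cardK.
  by rewrite -[RHS]E2 e3; ring2 cardK.
have [y yE] := fr_surj cardK 1 (b * r / s r); rewrite fr1E in yE.
have y0 : y != 0.
  by apply/eqP => y0; move/eqP: yE; rewrite y0 mulr0 eq_sym !mulf_eq0 invr_eq0 (negbTE bn0) (negbTE rn0) (negbTE srn0).
have sy0 : s y != 0 by rewrite fr_eq0.
have yS : s y * s y = s b * s r / s (s r) by rewrite -sM yE !sM frV.
have E4 : s y * (y + a) = s b.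
  apply: (fr_inj cardK (k := 1)); rewrite !fr1E.
  transitivity (s y * s y * (y * y + a * a)); first by ring2 cardK.
  rewrite yS yE; apply: (addK_eq0 cardK).
  transitivity (s b / s (s r) * (s r * (a * a) + r * b + s (s r) * s b)); last by rewrite E3 mulr0.
  by field; rewrite srn0 ssrn0.
apply: (nr (b / y)); rewrite sM frV -E4; field: (two0 cardK); by rewrite y0.
Qed.

(** In the basis (u, T u), the pair (eqn1, eqn2) is the adjoint of polF T u with respect to the
    trace, twisted by the square of the automorphism to avoid its inverse. *)
Definition eqn1 (p : K * K) : K :=
  s (s (p.1 * f)) + s (p.1 * f) + s (s (p.2 * f * a)) + p.2 * f * a.
Definition eqn2 (p : K * K) : K :=
  s (p.1 * f * a) + s (s (p.2 * f * b)) + p.2 * f * (s a * a + s b).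

Lemma trace_pairing_polF (pi : K * K) p r : trace_pairing m pi (polF T u (scale p u + scale r (T u))) =
  trace m (eqn1 pi * s (s p) + eqn2 pi * s (s r)).
Proof.
rewrite polF_coord /trace_pairing /eqn1 /eqn2 /=; set c1 := pi.1 * f; set c2 := pi.2 * f.
have trs (x : K) : trace m x = trace m (s x) by rewrite (tr_fr cardK m_gt1).
transitivity (trace m (c1 * p) + trace m (c1 * s p) + trace m (c2 * a * p) + trace m (c2 * a * s (s p))
   + (trace m (c1 * a * s r) + trace m (c2 * b * r) + trace m (c2 * (s a * a + s b) * s (s r)))).
  by rewrite -!(trD cardK); congr trace; rewrite /c1 /c2; ring.
rewrite (trs (c1 * p)) (trs (s (c1 * p))) (trs (c1 * s p)) (trs (c2 * a * p)) (trs (s (c2 * a * p))).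
rewrite (trs (c1 * a * s r)) (trs (c2 * b * r)) (trs (s (c2 * b * r))).
by rewrite -!(trD cardK) !sM; congr trace; ring.
Qed.

Definition annihilates (pi : K * K) := forall x, trace_pairing m pi (polF T u x) = 0.

Lemma annih_eqn pi : annihilates pi <-> eqn1 pi = 0 /\ eqn2 pi = 0.
Proof.
split=> [h|[h1 h2] x]; last by rewrite (pairE x) trace_pairing_polF h1 h2 !mul0r addr0 tr0.
have h' p r : trace m (eqn1 pi * s (s p) + eqn2 pi * s (s r)) = 0 by rewrite -trace_pairing_polF.
split; apply: (tr_nondeg cardK m_gt1) => x;
  have [y <-] := fr_surj cardK k x; have [z <-] := fr_surj cardK k y.
  by have := h' z 0; rewrite !(fr0 cardK) mulr0 addr0.
by have := h' 0 z; rewrite !(fr0 cardK) mulr0 add0r.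
Qed.

(** The first coordinate of the adjoint always has trace 0; so the adjoint is not surjective, hence
    not injective. *)
Lemma annih_exists : exists2 pi, pi <> 0 & annihilates pi.
Proof.
pose E (pi : K * K) : K * K := (eqn1 pi, eqn2 pi).
have ED : additive_map E.
  move=> p q; rewrite /E /eqn1 /eqn2 /= !mulrDl !sD; congr (_, _) => /=; ring.
have nsurj : ~ (forall y, exists x, E x = y).
  move=> h; have /eqP := oner_neq0 K; apply; apply: (tr_nondeg cardK m_gt1) => y; rewrite mul1r.
  have [x [<- _]] := h (y, 0); rewrite /eqn1 !(trD cardK) !(tr_fr cardK m_gt1).
  by ring2 cardK.
have [/existsP[pi /andP[/eqP p0 /eqP e0]]|/existsPn e0] := boolP [exists pi, (pi != 0) && (E pi == 0)].
  by exists pi => //; apply/annih_eqn; move: e0; rewrite /E => -[].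
case: nsurj; apply: inj_surj; apply: additive_map_inj ED _ => pi /eqP e; apply/eqP.
by have := e0 pi; rewrite e andbT negbK.
Qed.

(** If pi lay in the second coordinate, put c = pi.2 f, e = c a and t = s(c) c s(b). The equations
    of the annihilator say that s(s(e)) = e and s t + t = s(e) e, an element of F_2, and from e and t
    one reads off a root of z^(s+1) + a z + b, which noroot forbids. *)
Lemma annih1_neq0 pi : pi <> 0 -> annihilates pi -> pi.1 <> 0.
Proof.
move=> pi0 /annih_eqn[]; case: pi pi0 => p1 p2 pi0; rewrite /eqn1 /eqn2 /= => E1 E2 p10.
have p2n0 : p2 != 0 by apply/eqP => p20; apply: pi0; rewrite p10 p20.
have c0 : p2 * f != 0 by rewrite mulf_neq0.
move: E1 E2; rewrite p10 !mul0r !(fr0 cardK) !add0r; set c := p2 * f in c0 * => E1 E2.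
have nr := noroot; have bne := b_neq0; clearbody c a b.
pose e := c * a; have esse : s (s e) = e by apply: (addK_eq0 cardK).
have Nfix : s (s e * e) = s e * e by rewrite sM esse mulrC.
pose t := s c * c * s b.
have scale0 : s c != 0 by rewrite fr_eq0.
have bn0 : b != 0 by apply/eqP.
have sbn0 : s b != 0 by rewrite fr_eq0.
have tn0 : t != 0 by rewrite !mulf_neq0.
have Et : s t + t = s e * e.
  apply: (addK_eq0 cardK); transitivity (s c * (s (s (c * b)) + c * (s a * a + s b))); last by rewrite E2 mulr0.
  by rewrite /t /e !sM; ring.
have [d dE] := fr_surj cardK k c^-1.
have dn0 : d != 0 by rewrite -(fr_eq0 k) dE invr_eq0.
have [t' t'E] := fr_surj cardK k t.
have bE : b = t' * (s d * d).
  by apply: (fr_inj cardK (k := k)); rewrite !sM t'E dE frV /t; field; rewrite ?scale0 ?c0.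
have aE : a = e * s d by rewrite /e dE; field; rewrite ?c0.
suff [z hz] : exists z, s z * z + e * z + t' = 0.
  apply: (nr (d * z)); rewrite {1}aE bE sM.
  by transitivity (s d * d * (s z * z + e * z + t')); [ring | rewrite hz mulr0].
have [N0|N1] := fr_fix cardK m_gt1 co Nfix.
  have e0 : e = 0 by move/eqP: N0; rewrite mulf_eq0 fr_eq0 orbb => /eqP.
  have st : s t = t by apply: (addK_eq0 cardK); rewrite Et N0.
  have t1 : t = 1 by case: (fr_fix cardK m_gt1 co st) => // h; rewrite h eqxx in tn0.
  have -> : t' = 1 by apply: (fr_inj cardK (k := k)); rewrite t'E fr1.
  by exists 1; rewrite e0 fr1; ring2 cardK.
have en0 : e != 0.
  by apply/eqP => e0; move/eqP: N1; rewrite e0 mulr0 eq_sym oner_eq0.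
have sen0 : s e != 0 by rewrite fr_eq0.
have st : s t = t + 1 by rewrite -N1 -Et; ring2 cardK.
have -> : t' = t + 1.
  by apply: (fr_inj cardK (k := k)); rewrite t'E sD fr1 st; ring2 cardK.
exists (t / e).
have n1 : t * (t + 1) = 1.
  have nfix : s (t * (t + 1)) = t * (t + 1) by rewrite sM sD fr1 st; ring2 cardK.
  case: (fr_fix cardK m_gt1 co nfix) => // /eqP; rewrite mulf_eq0 (negbTE tn0) /= => /eqP h.
  have t1 : t = 1 by apply: (addK_eq0 cardK).
  by move/eqP: st; rewrite t1 fr1 (addKK cardK) oner_eq0.
have z1 : s (t / e) * (t / e) = 1.
  transitivity (t * (t + 1) / (s e * e)); last by rewrite n1 N1 divr1.
  by rewrite sM frV st; field; rewrite ?en0 ?sen0.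
by rewrite z1 mulrC (divfK en0); ring2 cardK.
Qed.

(** By polF_ker the image of polF T u has index 2, so it is all of the hyperplane defined by pi. *)
Lemma annih_image pi w : pi <> 0 -> annihilates pi -> trace_pairing m pi w = 0 -> exists x, w = polF T u x.
Proof.
move=> pi0 ha hw.
have [w0 hw0] : exists w0, trace_pairing m pi w0 <> 0.
  have [/existsP[w0 /eqP ?]|/existsPn h] := boolP [exists w0, trace_pairing m pi w0 != 0]; first by exists w0.
  case: pi0; case: pi {ha hw} h => p1 p2 h; congr (_, _); apply: (tr_nondeg cardK m_gt1) => x.
    by have := h (x, 0); rewrite negbK /trace_pairing /= mulr0 addr0 => /eqP.
  by have := h (0, x); rewrite negbK /trace_pairing /= mulr0 add0r => /eqP.
apply: (@index_two_image _ K (addVV cardK) (polF T u) (trace_pairing m pi) u) hw0 w hw => //.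
- exact: polFD.
- exact: trace_pairingD.
- exact: polF_ker.
Qed.

(** If pi lies in the first coordinate then a = 0, so by noroot z^(s+1) omits the value b and is not
    injective; the quotient mu of two elements with the same value is a cube root of unity. *)
Lemma annih2_eq0 pi : pi <> 0 -> annihilates pi -> pi.2 = 0 ->
  pi.1 * f = 1 /\ exists mu, [/\ mu * mu + mu + 1 = 0, s mu * mu = 1 & trace m (1 : K) = 0].
Proof.
move=> pi0 /annih_eqn[]; case: pi pi0 => p1 p2 pi0; rewrite /eqn1 /eqn2 /= => E1 E2 p20.
have p1n0 : p1 != 0 by apply/eqP => p10; apply: pi0; rewrite p10 p20.
move: E1 E2; rewrite p20 !mul0r !(fr0 cardK) !addr0.
have c0 : p1 * f != 0 by rewrite mulf_neq0.
set c := p1 * f in c0 * => /(addK_eq0 cardK)/(fr_inj cardK) E1 E2.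
have c1 : c = 1 by case: (fr_fix cardK m_gt1 co E1) => // h; rewrite h eqxx in c0.
split=> //.
have a0 : a = 0 by move/eqP: E2; rewrite c1 mul1r fr_eq0 => /eqP.
have [x [y [xy hxy]]] : exists x y : K, x <> y /\ s x * x = s y * y.
  have [/existsP[x /existsP[y /andP[/eqP xy /eqP h]]]|h] :=
    boolP [exists x : K, exists y : K, (x != y) && (s x * x == s y * y)]; first by exists x, y.
  have inj : injective (fun x : K => s x * x).
    move=> x y /eqP e; apply/eqP; move/existsPn: h => /(_ x)/existsPn/(_ y).
    by rewrite e andbT negbK.
  have [z hz] := inj_surj inj b.
  by case: (@noroot z); rewrite hz a0 mul0r addr0 (addKK cardK).
have yn0 : y != 0.
  apply/eqP => y0; apply: xy; move/eqP: hxy; rewrite y0 mulr0 mulf_eq0 fr_eq0 orbb.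
  by move/eqP.
have syn0 : s y != 0 by rewrite fr_eq0.
pose mu := x / y.
have mun : s mu * mu = 1.
  rewrite /mu sM frV; transitivity (s x * x / (s y * y)); first by field; rewrite yn0 syn0.
  by rewrite hxy divff // mulf_neq0.
have mu0 : mu != 0 by apply/eqP => h; move/eqP: mun; rewrite h mulr0 eq_sym oner_eq0.
have smu : s mu = mu^-1 by rewrite -[s mu]mulr1 -(mulfV mu0) mulrA mun mul1r.
have fx : s (mu + s mu) = mu + s mu by rewrite smu sD frV smu invrK addrC.
have smu1 : s mu = mu + 1.
  case: (fr_fix cardK m_gt1 co fx) => h; last by rewrite -h; ring2 cardK.
  have mm : s mu = mu by apply/esym/(addK_eq0 cardK).
  case: (fr_fix cardK m_gt1 co mm) => h2; first by rewrite h2 eqxx in mu0.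
  by case: xy; rewrite -[x]mulr1 -(mulVf yn0) mulrA -/mu h2 mul1r.
have mu1 : mu * mu + mu + 1 = 0.
  by rewrite -[X in _ + X]mun smu1; ring2 cardK.
exists mu; split=> //.
have -> : (1 : K) = mu * mu + mu by apply/esym/(addK_eq0 cardK).
rewrite (trD cardK) -fr1E (tr_fr cardK m_gt1).
exact: addKK cardK _.
Qed.

End AtPoint.

(** Polarizing in x and moving everything onto one argument turns the hypothesis into a linear
    relation between the powers 0, 1, 3, 4 of the automorphism. *)
Lemma weights_indep (e : K * K) : (4 < m)%N -> (forall x : K, trace_pairing m e (torus k x (1, 1)) = 0) -> e = 0.
Proof.
move=> m4 h.
have trs (x : K) : trace m x = trace m (s x) by rewrite (tr_fr cardK m_gt1).
have hp (x y : K) : trace m ((s (s e.1) * s (s (s x)) + s e.1 * s x + s (s e.2) * s (s (s (s x))) + e.2 * x) * s (s y)) = 0.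
  have : trace_pairing m e (torus k (x + y) (1, 1)) - trace_pairing m e (torus k x (1, 1)) - trace_pairing m e (torus k y (1, 1)) = 0.
    by rewrite !h !subr0.
  rewrite -[in LHS]/(trace m _) => H; rewrite -[RHS]H /trace_pairing /torus /= !mulr1.
  transitivity (trace m (e.1 * s x * y) + trace m (e.1 * x * s y) + trace m (e.2 * s (s x) * y) + trace m (e.2 * x * s (s y))).
    rewrite (trs (e.1 * s x * y)) (trs (s (e.1 * s x * y))) (trs (e.1 * x * s y)) (trs (e.2 * s (s x) * y)) (trs (s (e.2 * s (s x) * y))).
    by rewrite -!(trD cardK) !sM; congr trace; ring.
  rewrite !sD; apply/eqP; rewrite !(oppr_pchar2 (pchar2 cardK)) -!(trD cardK).
  by apply/eqP; congr trace; ring2 cardK.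
pose c i := match i with 0 => e.2 | 1 => s e.1 | 3 => s (s e.1) | 4 => s (s e.2) | _ => 0 end.
have H := @frk_indep K m cardK m_gt1 k 5 c co m4.
have {}H : forall i, (i < 5)%N -> c i = 0.
  apply: H => x; rewrite !big_ord_recl big_ord0 /=.
  rewrite !(muln0, muln1); set X := _ + _.
  have -> : X = s (s e.1) * s (s (s x)) + s e.1 * s x + s (s e.2) * s (s (s (s x))) + e.2 * x.
    rewrite /X !fr_comp /bump /= !addn0 !add1n.
    have -> : (k * 3 = k + (k + k))%N by lia.
    have -> : (k * 4 = k + (k + (k + k)))%N by lia.
    by rewrite !fr0E !addnA; ring.
  apply: (tr_nondeg cardK m_gt1) => z.
  by have [y <-] := fr_surj cardK k z; have [y' <-] := fr_surj cardK k y; apply: hp.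
have e2 : e.2 = 0 := H 0 isT; have /eqP := H 1 isT; rewrite /= fr_eq0 => /eqP e1.
by rewrite [e]surjective_pairing e1 e2.
Qed.

End Local.

(** * Elements generating the field as a ring *)

(** Stated as an induction principle: a property stable under sums and products and true of c holds
    for every element of K. *)
Definition ring_generator (K : finFieldType) (c : K) := forall S : pred K, S 1 ->
  (forall x y, S x -> S y -> S (x + y)) -> (forall x y, S x -> S y -> S (x * y)) ->
  S c -> forall x, S x.

Definition p_element (K : finFieldType) (p : nat) (c : K) := c <> 1 /\ exists n, c ^+ (p ^ n) = 1.

Section Rigid.
Variables (K : finFieldType) (m p : nat).
Hypothesis cardK : #|K| = (2 ^ m)%N.
Hypothesis m_gt1 : (1 < m)%N.
Hypothesis pm : primitive p m.
Let pp : prime p. Proof. by case: pm. Qed.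

Lemma p_element_order (c : K) : p_element p c -> exists n, (c ^+ n) ^+ p = 1 /\ c ^+ n <> 1.
Proof.
case=> c1 [n]; elim: n c c1 => [|n IH] c c1; first by rewrite expn0 expr1.
rewrite expnS exprM => h; have [e|/eqP ne] := eqVneq (c ^+ p) 1; first by exists 1%N; rewrite expr1.
by have [n' [e1 e2]] := IH _ ne h; exists (p * n')%N; rewrite exprM.
Qed.

(** A subring is a subfield of order 2^d; its unit group contains an element of order p, so that
    p divides 2^d - 1 and d = m. *)
Lemma p_element_generates (c : K) : p_element p c -> ring_generator c.
Proof.
move=> hc S S1 SD SM Sc.
have [n [hp hn]] := p_element_order hc; set g := c ^+ n in hp hn.
have Sg : S g by rewrite /g; elim: (n) => [|i IH]; rewrite ?expr0 // exprS SM.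
have S0 : S 0 by rewrite -(addKK cardK 1) SD.
pose H := [set x | S x].
have gH : group_set H by apply/group_setP; split=> [|x y]; rewrite !inE => *; rewrite ?S0 ?SD.
have : (#|H| %| 2 ^ m)%N.
  by rewrite -cardK -cardsT; apply: (@cardSg _ [set: K]%G (Group gH)); apply: subsetT.
case/(dvdn_pfactor _ _ (isT : prime 2)) => d dm Hd.
pose U := [set u : {unit K} | S (val u)].
have gU : group_set U.
  by apply/group_setP; split=> [|x y]; rewrite !inE ?val_unit1 // ?val_unitM => *; rewrite ?SM.
have cU : #|U| = (2 ^ d).-1.
  rewrite -Hd (cardsD1 0 H) inE S0 /= -(card_imset _ val_inj); apply: eq_card => x.
  rewrite !inE; apply/imsetP/andP => [[u] | [x0 Sx]].
    by rewrite inE => Su ->; split=> //; rewrite -unitfE; apply: (valP u).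
  by rewrite -unitfE in x0; exists (FinRing.unit K x0); rewrite ?inE.
have gu : g \is a GRing.unit by rewrite unitfE; apply/eqP => g0; move/eqP: hp; rewrite g0 expr0n (gtn_eqF (prime_gt0 pp)) eq_sym oner_eq0.
pose u := FinRing.unit K gu.
have ou : #[u]%g = p.
  apply/prime_nt_dvdP => //.
    rewrite order_eq1; apply: contra_notN hn => /eqP e; exact: (congr1 val e).
  by rewrite order_dvdn; apply/eqP/val_inj; rewrite FinRing.val_unitX.
have : (p %| (2 ^ d).-1)%N.
  by rewrite -cU -ou; apply: (@order_dvdG _ (Group gU)); rewrite inE.
have [_ _ prim] := pm => pd.
have dE : d = m.
  apply/eqP; rewrite eqn_leq dm leqNgt; apply/negP => lt.
  have d0 : (0 < d)%N.
    rewrite lt0n; apply/eqP => d0; move: Hd; rewrite d0 expn0 => /eqP/cards1P[z Hz].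
    have : 0 \in H by rewrite inE.
    have : 1 \in H by rewrite inE.
    by rewrite Hz !inE => /eqP <-; rewrite eq_sym oner_eq0.
  by have := prim d; rewrite d0 lt pd => /(_ isT).
have : H = [set: K] by apply/eqP; rewrite eqEcard subsetT cardsT Hd cardK dE leqnn.
by move=> /setP HT x; have := HT x; rewrite !inE.
Qed.

Lemma dvd_pow2_period i : (p %| (2 ^ i).-1)%N -> (m %| i)%N.
Proof.
have [_ pdm prim] := pm.
rewrite pred_pow2_mod // => h; rewrite /dvdn; apply/negPn/negP; rewrite -lt0n => im.
have := prim (i %% m)%N; rewrite im ltn_pmod ?(ltnW m_gt1) // pred_pow2_mod // => /(_ isT)/negP; apply.
have hm : ((2 ^ m) ^ (i %/ m) = 1 %[mod p])%N.
  by move: pdm; rewrite pred_pow2_mod // => /eqP e; rewrite -modnXm e modnXm exp1n.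
move: h; rewrite {1}(divn_eq i m) expnD [(_ %/ _ * _)%N]mulnC expnM => /eqP h; apply/eqP.
by rewrite -h -[in RHS]modnMml hm modnMml mul1n.
Qed.

(** Otherwise 2^i = -1 modulo p, so that p divides 2^(2i) - 1 and m divides 2 i. *)
Lemma p_element_weight i (c : K) : ~~ (m %| i * 2)%N -> p_element p c -> p_element p (frob i c * c).
Proof.
move=> mi hc; split; last first.
  by case: hc => _ [n hn]; exists n; rewrite exprMn /frob -exprM mulnC exprM hn expr1n mulr1.
move=> e; case/negP: mi; apply: dvd_pow2_period.
have [n [hp hn]] := p_element_order hc; set g := c ^+ n in hp hn.
have ge : g ^+ (2 ^ i).+1 = 1.
  by rewrite /g -exprM mulnC exprM exprS mulrC -/(frob i c) e expr1n.
have pr : p.-primitive_root g.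
  have [q pq qp] := prim_order_exists (prime_gt0 pp) hp.
  move: (pp) qp => /primeP[_ h] /h /orP[]/eqP q1; last by rewrite -q1.
  by case: hn; have := prim_expr_order pq; rewrite q1 expr1.
have : (p %| (2 ^ i).+1)%N by rewrite (prim_order_dvd pr) ge.
move=> h; have -> : ((2 ^ (i * 2)).-1 = (2 ^ i).-1 * (2 ^ i).+1)%N.
  by rewrite expnM -mulnn; case: (2 ^ i)%N => // x; rewrite /= plusE -mulnS.
exact: dvdn_mull.
Qed.

Lemma primitive_neq3 : (2 < m)%N -> p <> 3%N.
Proof.
move=> m2 p3; case: pm => _ _ /(_ 2); rewrite p3 m2 => /(_ isT).
by [].
Qed.

End Rigid.

(** * Additive maps between graphs *)

Lemma vec_ext (R : Type) (u v : R * R) : u.1 = v.1 -> u.2 = v.2 -> u = v.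
Proof. by case: u v => [a b] [c d] /= -> ->. Qed.

Ltac vec2 H := apply: vec_ext; rewrite /=; ring2 H.

(** The automorphism of the graph of quadF T induced by the multiplication by c. *)
Definition torus_act (K : finFieldType) k (c : K) (x : (K * K) * (K * K)) : (K * K) * (K * K) :=
  (scale c x.1, torus k c x.2).

(** The second coordinate of the image of a graph point is the value at the first; as the map is
    injective on a finite set, it sends the graph of quadF T onto that of quadF T'. *)
Definition graph_map (K : finFieldType) (T T' : K * K -> K * K) (A : (K * K) * (K * K) -> (K * K) * (K * K)) :=
  [/\ additive_map A, injective A & forall v, (A (v, quadF T v)).2 = quadF T' (A (v, quadF T v)).1].

Section Span.
Variables (K : finFieldType) (m k : nat).
Hypothesis cardK : #|K| = (2 ^ m)%N.
Hypothesis m_gt4 : (4 < m)%N.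
Hypothesis co : coprime k m.
Variable T : K * K -> K * K.
Hypothesis Tlin : frob_semilinear k T.
Hypothesis Tirr : irred T.
Let m_gt1 : (1 < m)%N. Proof. exact: leq_trans m_gt4. Qed.
Local Notation W := ((K * K) * (K * K))%type.
Implicit Types (u v w d : K * K).

Lemma scale_torus_annih c u pi : c <> 0 -> annihilates m T u pi -> annihilates m T (scale c u) (torus k c^-1 pi).
Proof.
move=> /eqP c0 h x; rewrite trace_pairing_torus.
have -> : x = scale c (scale c^-1 x) by rewrite scaleA mulfV // scale1.
by rewrite (polF_sc Tlin) (torusM) mulVf // (torus1) // h.
Qed.

Lemma trace_pairing_off_image u pi w : u <> 0 -> pi <> 0 -> annihilates m T u pi ->
  (forall x, w <> polF T u x) -> trace_pairing m pi w = 1.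
Proof.
move=> u0 pi0 ha hw; have [h|//] := tr01 cardK m_gt1 (pi.1 * w.1 + pi.2 * w.2).
by have [x] := annih_image cardK m_gt1 co Tlin Tirr u0 pi0 ha h; move/hw.
Qed.

Lemma e1_neq0 : ((1, 0) : K * K) <> 0.
Proof. by case=> /eqP; rewrite oner_eq0. Qed.

Lemma coord_mul_eq0 (pi d : K * K) :
  (forall x : K, trace_pairing m pi (torus k x d) = 0) -> pi.1 * d.1 = 0 /\ pi.2 * d.2 = 0.
Proof.
move=> h; suff [-> ->] : (pi.1 * d.1, pi.2 * d.2) = 0 :> K * K by [].
apply: (weights_indep cardK m_gt1 co m_gt4) => x.
rewrite -(h x) /trace_pairing /torus /=; congr trace; ring.
Qed.

Lemma exists_third : exists c : K, c <> 0 /\ c <> 1.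
Proof.
have [/existsP[c /andP[/eqP c0 /eqP c1]]|h] := boolP [exists c : K, (c != 0) && (c != 1)]; first by exists c.
have : (m %| 1)%N.
  apply: (fr_id_dvd cardK m_gt1) => x; rewrite fr1E.
  have [->|x0] := eqVneq x 0; first by rewrite mulr0.
  have [->|x1] := eqVneq x 1; first by rewrite mulr1.
  by case/negP: h; apply/existsP; exists x; rewrite x0.
by rewrite dvdn1; lia.
Qed.

(** Suppose E is proper. A vector w outside E lies in no image of polF T a, so it pairs to 1 with
    every annihilator; thus two such vectors have a difference that pairs to 0 with all of them, and
    by weights_indep the same first coordinate. Adding values of polF to w, one sees that the first
    coordinate of polF vanishes identically, which annih2_eq0 forbids. *)
Lemma polF_span (E : pred (K * K)) : (forall u v, E u -> E v -> E (u + v)) ->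
  (forall u v, E (polF T u v)) -> forall w, E w.
Proof.
move=> ED EB w; apply: contraT => nEw; exfalso.
have nEx (x : K) u : x <> 0 -> ~~ E u -> forall pi, pi <> 0 -> annihilates m T (1, 0) pi -> trace_pairing m pi (torus k x u) = 1.
  move=> /eqP x0 nE pi pi0 ha; rewrite -trace_pairing_torus.
  apply: (@trace_pairing_off_image (scale x^-1 (1, 0))).
  - by move/scale_eq0 => [/eqP|/e1_neq0//]; rewrite invr_eq0 (negbTE x0).
  - move=> h; apply: pi0; rewrite -(torus1 k pi) -(mulVf x0) -(torusM) h.
    by rewrite /torus /= !mulr0.
  - rewrite -{2}[x]invrK; apply: scale_torus_annih ha; apply/eqP; by rewrite invr_eq0.
  - by move=> y e; case/negP: nE; rewrite e.
have [pi pi0 ha] := annih_exists cardK m_gt1 Tlin Tirr e1_neq0.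
have pi1 := annih1_neq0 cardK m_gt1 co Tlin Tirr e1_neq0 pi0 ha.
have same u v : ~~ E u -> ~~ E v -> u.1 = v.1.
  move=> nu nv; apply: (addK_eq0 cardK).
  have [|+ _] := @coord_mul_eq0 pi (u + v); last by move/eqP; rewrite mulf_eq0 => /orP[]/eqP.
  move=> x; have [->|/eqP x0] := eqVneq x 0; first by rewrite /torus !mulr0 !mul0r /trace_pairing /= !mulr0 addr0 (tr0 cardK).
  by rewrite torusD (trace_pairingD cardK) !nEx // (addKK cardK).
have B1 u v : (polF T u v).1 = 0.
  have nE : ~~ E (w + polF T u v).
    apply: contra nEw => h; have := ED _ _ h (EB u v); by rewrite -addrA (addVV cardK) addr0.
  by have := same _ _ nEw nE; rewrite /= -{1}[w.1]addr0 => /addrI.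
have [c [c0 c1]] := exists_third.
have f0 := Tirr e1_neq0; set f := det _ _ in f0.
have ha' : annihilates m T (1, 0) (c / f, 0).
  by move=> x; rewrite /trace_pairing B1 /= mulr0 mul0r addr0 (tr0 cardK).
have := annih2_eq0 cardK m_gt1 co Tlin Tirr e1_neq0 _ ha' (erefl 0).
case=> [[/eqP]|]; first by rewrite mulf_eq0 invr_eq0 => /orP[]/eqP.
by rewrite /= -/f divfK //; apply/eqP.
Qed.

Lemma graph_span (A A' : W -> W) : additive_map A -> additive_map A' ->
  (forall v, A (v, quadF T v) = A' (v, quadF T v)) -> forall x, A x = A' x.
Proof.
move=> AD AD' h.
have hB w : A (0, w) = A' (0, w).
  apply/eqP; apply: (@polF_span (fun w => A (0, w) == A' (0, w))) => [u v /eqP eu /eqP ev|u v]; apply/eqP.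
    by rewrite (_ : (0, u + v) = (0, u) + (0, v)) ?AD ?AD' ?eu ?ev // -[in LHS](addr0 0).
  have -> : (0, polF T u v) = (u + v, quadF T (u + v)) + (u, quadF T u) + (v, quadF T v).
    have e (a b c : K * K) : c = a + b + c + a + b by vec2 cardK.
    rewrite (quadF_polar Tlin); congr (_, _); last exact: e.
    by rewrite /= -addrA (addVV cardK).
  by rewrite !AD !AD' !h.
case=> v w; rewrite (_ : (v, w) = (v, quadF T v) + (0, w + quadF T v)) ?AD ?AD' ?h ?hB //.
by congr (_, _); rewrite /= ?addr0 // addrCA (addVV cardK) addr0.
Qed.
End Span.

(** * The subspace of second coordinates is preserved *)

(** Let h be the bijection of the plane that the map of graphs A induces, so that h v = al v + be (F v)
with al and be additive. As h is injective, whenever al a = be w with a <> 0, the vector w + F a is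
outside the image of polF T a. The set of those a is stable under multiplication by scalars because
A commutes with a generator of K. If it is the whole plane, be is bijective, and distinct vectors
a have distinct annihilators, so that (0, 1) annihilates some image; this is impossible by
annih1_neq0. If it contains a line but not the plane, be has a nonzero kernel, which annihilators of
that line kill; this forces the exceptional situation of annih2_eq0, and adding up the three
multiples of a vector by cube roots of unity gives 1 = 0. So it is zero, whence be = 0. *)

Section Key.
Variables (K : finFieldType) (m k k' : nat).
Hypothesis cardK : #|K| = (2 ^ m)%N.
Hypothesis m_gt4 : (4 < m)%N.
Hypothesis co : coprime k m.
Hypothesis co' : coprime k' m.
Variables T T' : K * K -> K * K.
Hypothesis Tlin : frob_semilinear k T.
Hypothesis Tirr : irred T.
Hypothesis Tlin' : frob_semilinear k' T'.
Hypothesis Tirr' : irred T'.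
Let m_gt1 : (1 < m)%N. Proof. exact: leq_trans m_gt4. Qed.
Local Notation W := ((K * K) * (K * K))%type.
Local Notation F := (quadF T).
Variables (A : W -> W) (c c' : K).
Hypothesis hA : graph_map T T' A.
Hypothesis cR : ring_generator c.
Hypothesis hAz : forall x, A (torus_act k c x) = torus_act k' c' (A x).
Implicit Types (u v w d : K * K).

Let AD : additive_map A. Proof. by case: hA. Qed.
Let al v := (A (v, 0)).1.
Let be w := (A (0, w)).1.

Let splitA v w : A (v, w) = A (v, 0) + A (0, w).
Proof. by rewrite -AD; congr (A (_, _)); rewrite ?addr0 ?add0r. Qed.

Let alD : additive_map al.
Proof. by move=> u v; rewrite /al -[0 in LHS]addr0 -[_.1 + _.1]/(_ + _).1 -AD. Qed.

Let beD : additive_map be.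
Proof. by move=> u v; rewrite /be -[0 in LHS]addr0 -[_.1 + _.1]/(_ + _).1 -AD. Qed.

Let h v := (A (v, F v)).1.
Let hE v : h v = al v + be (F v).
Proof. by rewrite /h splitA. Qed.

Let h_inj : injective h.
Proof.
move=> u v e; case: hA => _ Ai hG.
have : A (u, F u) = A (v, F v).
  by rewrite [LHS]surjective_pairing [RHS]surjective_pairing !hG -/(h u) -/(h v) e.
by move/Ai => [].
Qed.

Let h_surj y : exists v, h v = y. Proof. exact: inj_surj h_inj y. Qed.

(** Otherwise h takes the same value at x and a + x. *)
Let avoid a w : a <> 0 -> al a = be w -> forall x, w + F a <> polF T a x.
Proof.
move=> a0 aw x e; apply: a0.
suff : h (a + x) = h x by move/h_inj/(congr1 (+%R^~ x)); rewrite -addrA (addVV cardK) addr0.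
rewrite !hE (quadF_polar Tlin) alD aw -e !beD.
have E (b f g a' : K * K) : b + a' + (f + g + (b + f)) = a' + g by vec2 cardK.
exact: E.
Qed.

Let inV v := [exists w, al v == be w].

Let inV_D u v : inV u -> inV v -> inV (u + v).
Proof.
move=> /existsP[w /eqP hw] /existsP[w' /eqP hw']; apply/existsP; exists (w + w').
by rewrite alD beD hw hw'.
Qed.

Let al_c v : al (scale c v) = scale c' (al v).
Proof.
rewrite /al (_ : (scale c v, 0) = torus_act k c (v, 0)) ?hAz //.
by rewrite /torus_act /torus /= !mulr0.
Qed.

Let be_c w : be (torus k c w) = scale c' (be w).
Proof.
by rewrite /be (_ : (0, torus k c w) = torus_act k c (0, w)) ?hAz // /torus_act /= scaler0.
Qed.

Let inV_sc (x : K) v : inV v -> inV (scale x v).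
Proof.
suff : [forall v, inV v ==> inV (scale x v)] by move/forallP/(_ v)/implyP.
move: x {v}; apply: (cR (S := fun x => [forall v, inV v ==> inV (scale x v)])).
- by apply/forallP => v; rewrite scale1 implybb.
- move=> x y /forallP hx /forallP hy; apply/forallP => v; apply/implyP => hv.
  by rewrite scaleDl; apply: inV_D; [apply: (implyP (hx v)) | apply: (implyP (hy v))].
- move=> x y /forallP hx /forallP hy; apply/forallP => v; apply/implyP => hv.
  by rewrite -scaleA; apply: (implyP (hx _)); apply: (implyP (hy v)).
apply/forallP => v; apply/implyP => /existsP[w /eqP e]; apply/existsP; exists (torus k c w).
by rewrite al_c be_c e.
Qed.

Let be_inj_of_all : (forall v, inV v) -> injective be.
Proof.
move=> all_in; apply: surj_inj => y; have [v hv] := h_surj y.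
have /existsP[w /eqP e] := all_in v; exists (w + F v); by rewrite beD -e -hE.
Qed.

(** If be were bijective, a -> pi(a) would be injective on nonzero vectors, hence would take the
    value (0, 1). *)
Let not_all_in : ~ (forall v, inV v).
Proof.
move=> all_in; have be_inj := be_inj_of_all all_in.
have /fin_all_exists[wt wtE] : forall a, exists w, al a = be w.
  by move=> a; have /existsP[w /eqP e] := all_in a; exists w.
have /fin_all_exists[pi piE] : forall a, exists pi : K * K,
    (a = 0 -> pi = 0) /\ (a <> 0 -> pi <> 0 /\ annihilates m T a pi).
  move=> a; have [->|/eqP a0] := eqVneq a 0; first by exists 0.
  by have [pi pi0 ha] := annih_exists cardK m_gt1 Tlin Tirr a0; exists pi.
have wtD a b : wt (a + b) = wt a + wt b by apply: be_inj; rewrite beD -!wtE alD.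
have dot1 a b : a <> 0 -> pi b = pi a -> trace_pairing m (pi b) (wt a + F a) = 1.
  move=> a0 ->; have [_ /(_ a0)[pi0 ha]] := piE a.
  exact: (trace_pairing_off_image cardK m_gt4 co Tlin Tirr a0 pi0 ha (avoid a0 (wtE a))).
have pi_inj : injective pi.
  move=> a b e; have [a0|/eqP a0] := eqVneq a 0.
    have [b0|/eqP b0] := eqVneq b 0; first by rewrite a0 b0.
    by have [_ /(_ b0)[]] := piE b; rewrite -e (proj1 (piE a) a0).
  have [b0|/eqP b0] := eqVneq b 0.
    by have [_ /(_ a0)[]] := piE a; rewrite e (proj1 (piE b) b0).
  apply: (addV_eq0 cardK); have [//|/eqP ab0] := eqVneq (a + b) 0.
  have [_ /(_ a0)[pi0 ha]] := piE a; have [_ /(_ b0)[_ hb]] := piE b.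
  have hab : annihilates m T (a + b) (pi a).
    move=> x; rewrite (polFC _ _ x) (polFD Tlin) (trace_pairingD cardK) !(polFC _ x) ha e hb addr0 //.
  have := trace_pairing_off_image cardK m_gt4 co Tlin Tirr ab0 pi0 hab (avoid ab0 (wtE _)).
  rewrite wtD (quadF_polar Tlin).
  have -> : wt a + wt b + (F a + F b + polF T a b) = (wt a + F a) + (wt b + F b) + polF T a b.
    by rewrite addrA addrACA.
  rewrite (trace_pairingD cardK _ (_ + _) (polF _ _ _)) (trace_pairingD cardK _ (wt a + F a)).
  rewrite (dot1 a a) // (dot1 b a) // ha addr0 (addKK cardK) => /eqP.
  by rewrite eq_sym oner_eq0.
have [a aE] := inj_surj pi_inj (0, 1).
have a0 : a <> 0.
  by move=> a0; have := proj1 (piE a) a0; rewrite aE => -[/eqP]; rewrite oner_eq0.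
have [_ /(_ a0)[pi0 ha]] := piE a.
by have := annih1_neq0 cardK m_gt1 co Tlin Tirr a0 pi0 ha; rewrite aE.
Qed.

(** Both w and w + d satisfy al a = be w, so both w + F a and w + d + F a pair to 1 with the
    annihilator of a; this holds for all multiples a of v0, and weights_indep separates the two
    coordinates. *)
Let ker_annih v0 d pi : v0 <> 0 -> inV v0 -> be d = 0 -> pi <> 0 -> annihilates m T v0 pi ->
  pi.1 * d.1 = 0 /\ pi.2 * d.2 = 0.
Proof.
move=> v00 hv0 bd pi0 ha; apply: (coord_mul_eq0 cardK m_gt4 co) => x.
have [->|/eqP x0] := eqVneq x 0; first by rewrite /torus !mulr0 !mul0r /trace_pairing /= !mulr0 addr0 (tr0 cardK).
have x'0 : x^-1 <> 0 by apply/eqP; rewrite invr_eq0; apply/eqP.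
have a0 : scale x^-1 v0 <> 0 by move/scale_eq0 => [].
have haa := scale_torus_annih Tlin x'0 ha; rewrite invrK in haa.
have pa0 : torus k x pi <> 0.
  move=> e; apply: pi0; rewrite -(torus1 k pi) -(@mulVf _ x); last exact/eqP.
  by rewrite -torusM e /torus /= !mulr0.
have /existsP[w /eqP aw] := inV_sc x^-1 hv0.
have H w' (e : al (scale x^-1 v0) = be w') :=
  trace_pairing_off_image cardK m_gt4 co Tlin Tirr a0 pa0 haa (avoid a0 e).
have aw' : al (scale x^-1 v0) = be (w + d) by rewrite beD bd addr0.
rewrite -trace_pairing_torus; have := H _ aw'.
by rewrite addrAC (trace_pairingD cardK) (H _ aw) -{2}[1]addr0 => /addrI.
Qed.

Let be0 w : be w = 0.
Proof.
have [/existsP[v0 /andP[/eqP v00 hv0]]|none] := boolP [exists v, (v != 0) && inV v]; last first.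
  have [v hv] := h_surj (be w).
  have inv : inV v.
    apply/existsP; exists (w + F v); rewrite beD -hv hE -addrA (addVV cardK) addr0 //.
  have v0 : v = 0.
    by apply/eqP; apply: contraR none => vn0; apply/existsP; exists v; rewrite vn0.
  by rewrite -hv hE v0 (quadF0 T) (additive_map0 alD) (additive_map0 beD) addr0.
exfalso.
have [pi pi0 ha] := annih_exists cardK m_gt1 Tlin Tirr v00.
have p1 := annih1_neq0 cardK m_gt1 co Tlin Tirr v00 pi0 ha.
have ker d : be d = 0 -> d.1 = 0 /\ pi.2 * d.2 = 0.
  move=> bd; have [/eqP + ->] := ker_annih v00 hv0 bd pi0 ha.
  by rewrite mulf_eq0 => /orP[]/eqP // ->.
have p2 : pi.2 = 0.
  apply/eqP/negPn/negP => p20; apply: not_all_in => v; apply/existsP.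
  have be_inj : injective be.
    apply: (additive_map_inj beD) => d /ker[d1 /eqP]; rewrite mulf_eq0 (negbTE p20) /= => /eqP d2.
    by apply: vec_ext.
  by have [w' hw] := inj_surj be_inj (al v); exists w'; rewrite hw.
have [p1f [mu [mu1 muN tr1]]] := annih2_eq0 cardK m_gt1 co Tlin Tirr v00 pi0 ha p2.
have mu0 : mu != 0 by apply/eqP => mu0; move/eqP: muN; rewrite mu0 mulr0 eq_sym oner_eq0.
(* The three vectors x v0, with x a cube root of unity, add up to 0 and share the value of f. *)
have dot1 x w' : x != 0 -> frob k x * x = 1 -> al (scale x v0) = be w' -> trace_pairing m pi (w' + F v0) = 1.
  move=> /eqP x0 xN aw; have a0 : scale x v0 <> 0 by move/scale_eq0 => [].
  have haa := scale_torus_annih Tlin x0 ha.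
  have xN' : frob k x^-1 * x^-1 = 1 by rewrite frV -invfM xN invr1.
  have piE : torus k x^-1 pi = pi.
    by apply: vec_ext; rewrite /torus /= ?xN' ?mul1r // p2 mulr0.
  rewrite piE in haa; have := trace_pairing_off_image cardK m_gt4 co Tlin Tirr a0 pi0 haa (avoid a0 aw).
  by rewrite (quadF_sc Tlin) /trace_pairing /torus /= p2 !mul0r xN mul1r.
have exw x : exists w', al (scale x v0) = be w'.
  by have /existsP[w' /eqP e] := inV_sc x hv0; exists w'.
have [w1 e1] := exw 1; have [w2 e2] := exw mu; have [w3 e3] := exw (mu * mu).
have muN2 : frob k (mu * mu) * (mu * mu) = 1 by rewrite frM mulrACA muN mulr1.
have H1 := dot1 _ _ (oner_neq0 K) (etrans (mulr1 _) (fr1 K k)) e1.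
have H2 := dot1 _ _ mu0 muN e2.
have H3 := dot1 _ _ (mulf_neq0 mu0 mu0) muN2 e3.
have s0 : be (w1 + w2 + w3) = 0.
  rewrite !beD -e1 -e2 -e3 -!alD -!scaleDl.
  have -> : 1 + mu + mu * mu = 0 by rewrite -mu1; ring.
  by rewrite scale0 (additive_map0 alD).
have [s1 _] := ker _ s0.
have : trace_pairing m pi ((w1 + F v0) + (w2 + F v0) + (w3 + F v0)) = 1.
  by rewrite !(trace_pairingD cardK _ (_ + _) (_ + F v0)) H1 H2 H3; ring2 cardK.
have -> : (w1 + F v0) + (w2 + F v0) + (w3 + F v0) = (w1 + w2 + w3) + F v0 by vec2 cardK.
rewrite (trace_pairingD cardK) /trace_pairing p2 !mul0r !addr0 s1 mulr0 (tr0 cardK) add0r /= p1f tr1 => /eqP.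
by rewrite eq_sym oner_eq0.
Qed.

Lemma graph_map_zero w : (A (0, w)).1 = 0. Proof. exact: be0. Qed.

End Key.

(** * Semilinear equivalences and their weights *)

Definition field_mono (K : finFieldType) (r : K -> K) :=
  [/\ additive_map r, (forall x y, r (x * y) = r x * r y) & injective r].

(** The data extracted from a map of graphs: L acts on arguments, M on the values of the polar
    forms, and r is the automorphism of the field for which L is semilinear. *)
Definition semilinear_equiv (K : finFieldType) k k' (T T' L M : K * K -> K * K) (r : K -> K) :=
  [/\ semilinear r L /\ injective L, additive_map M /\ injective M, field_mono r,
      (forall x w, M (torus k x w) = torus k' (r x) (M w)) &
      (forall u v, M (polF T u v) = polF T' (L u) (L v))].

Section MonoLemmas.
Variables (K : finFieldType) (r : K -> K).
Hypothesis rM : field_mono r.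

Lemma mono0 : r 0 = 0. Proof. by case: rM => /additive_map0. Qed.

Lemma mono1 : r 1 = 1.
Proof.
case: rM => _ M inj; have : r 1 * r 1 = r 1 by rewrite -M mulr1.
have r1 : r 1 != 0 by rewrite -mono0; apply/eqP => /inj/eqP; rewrite oner_eq0.
by rewrite -{3}[r 1]mulr1 => /(mulfI r1).
Qed.

Lemma mono_neq0 x : x <> 0 -> r x <> 0.
Proof. by case: rM => _ _ inj x0 h; apply: x0; apply: inj; rewrite h mono0. Qed.

Lemma mono_fr i x : r (frob i x) = frob i (r x).
Proof.
case: rM => _ M _; rewrite /frob; elim: (2 ^ i)%N => [|n IH]; first by rewrite !expr0 mono1.
by rewrite !exprS M IH.
Qed.

Lemma mono_surj y : exists x, r x = y.
Proof. by case: rM => _ _ /inj_surj. Qed.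
End MonoLemmas.

Section Structure.
Variables (K : finFieldType) (m k k' : nat).
Hypothesis cardK : #|K| = (2 ^ m)%N.
Hypothesis m_gt4 : (4 < m)%N.
Hypothesis co : coprime k m.
Hypothesis co' : coprime k' m.
Variables T T' : K * K -> K * K.
Hypothesis Tlin : frob_semilinear k T.
Hypothesis Tirr : irred T.
Hypothesis Tlin' : frob_semilinear k' T'.
Hypothesis Tirr' : irred T'.
Local Notation W := ((K * K) * (K * K))%type.

(** The scalars x for which L (x v) is a multiple of L v form a subring containing c, hence all of K.
    The last clause holds because both sides agree on the graph, which spans. *)
Lemma graph_map_structure (A : W -> W) (c c' : K) : graph_map T T' A -> ring_generator c ->
  (forall x, A (torus_act k c x) = torus_act k' c' (A x)) ->
  exists L M r, [/\ semilinear_equiv k k' T T' L M r, r c = c' ,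
    (forall v, A (v, quadF T v) = (L v, quadF T' (L v))),
    (forall w, A (0, w) = (0, M w)) &
    (forall x w, A (torus_act k x w) = torus_act k' (r x) (A w))].
Proof.
move=> hA cR hAz; have [AD Ai hG] := hA.
have A0 w : (A (0, w)).1 = 0 := graph_map_zero cardK m_gt4 co Tlin Tirr hA cR hAz w.
pose L v := (A (v, 0)).1; pose M w := (A (0, w)).2.
have AM w : A (0, w) = (0, M w) by rewrite [LHS]surjective_pairing A0.
have A1 v w : (A (v, w)).1 = L v.
  by rewrite (_ : (v, w) = (v, 0) + (0, w)) ?AD /= ?A0 ?addr0 //; congr (_, _); rewrite /= ?addr0 ?add0r.
have LD : additive_map L by move=> u v; rewrite -(A1 _ 0) -(A1 u 0) -(A1 v 0) -[0 in LHS]addr0 -[_.1 + _.1]/(_ + _).1 -AD.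
have MD : additive_map M by move=> u v; rewrite /M -[0 in LHS]addr0 -[_.2 + _.2]/(_ + _).2 -AD.
have AG v : A (v, quadF T v) = (L v, quadF T' (L v)).
  by rewrite [LHS]surjective_pairing hG A1.
have Li : injective L.
  move=> u v e; have : A (u, quadF T u) = A (v, quadF T v) by rewrite !AG e.
  by move/Ai => [].
have Mi : injective M.
  move=> u v e; have : A (0, u) = A (0, v) by rewrite !AM e.
  by move/Ai => [].
have Lc v : L (scale c v) = scale c' (L v).
  rewrite /L (_ : (scale c v, 0) = torus_act k c (v, 0)) ?hAz //.
  by rewrite /torus_act /torus /= !mulr0.
have ex x : exists y, forall v, L (scale x v) = scale y (L v).
  suff : [exists y, forall v, L (scale x v) == scale y (L v)].
    by case/existsP => y /forallP hy; exists y => v; apply/eqP.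
  move: x; apply: (cR (fun x => [exists y, forall v, L (scale x v) == scale y (L v)])).
  - by apply/existsP; exists 1; apply/forallP => v; rewrite !scale1.
  - move=> x y /existsP[x' /forallP hx] /existsP[y' /forallP hy].
    apply/existsP; exists (x' + y'); apply/forallP => v.
    by rewrite !scaleDl LD (eqP (hx v)) (eqP (hy v)).
  - move=> x y /existsP[x' /forallP hx] /existsP[y' /forallP hy].
    apply/existsP; exists (x' * y'); apply/forallP => v.
    by rewrite -!scaleA (eqP (hx _)) (eqP (hy v)).
  by apply/existsP; exists c'; apply/forallP => v; rewrite Lc.
have [r Lr] := fin_all_exists ex.
have Le0 : L (1, 0) <> 0.
  rewrite -(additive_map0 LD) => /Li; exact: e1_neq0.
have scI x y : scale x (L (1, 0)) = scale y (L (1, 0)) -> x = y.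
  move=> e; apply: (addK_eq0 cardK).
  have : scale (x + y) (L (1, 0)) = 0 by rewrite scaleDl e (addVV cardK).
  by move/scale_eq0 => [].
have rmono : field_mono r.
  split=> [x y|x y|x y e].
  - by apply: scI; rewrite scaleDl -!Lr scaleDl LD.
  - by apply: scI; rewrite -scaleA -!Lr -scaleA.
  have : L (scale x (1, 0)) = L (scale y (1, 0)) by rewrite !Lr e.
  by move/Li => []; rewrite !mulr1.
have rc : r c = c' by apply: scI; rewrite -Lr Lc.
have torus_actD kk x : additive_map (@torus_act K kk x).
  by move=> u v; rewrite /torus_act /= scaleD torusD.
have Az x w : A (torus_act k x w) = torus_act k' (r x) (A w).
  apply: (graph_span cardK m_gt4 co Tlin Tirr (A := fun w => A (torus_act k x w)) (A' := fun w => torus_act k' (r x) (A w))).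
  - by move=> u v; rewrite torus_actD AD.
  - by move=> u v; rewrite AD torus_actD.
  by move=> v; rewrite /torus_act /= -(quadF_sc Tlin) !AG /= Lr (quadF_sc Tlin').
exists L, M, r; split=> //; split=> //.
  by move=> x w; rewrite /M -[RHS]/(torus_act k' (r x) (A (0, w))).2 -Az /torus_act /= scaler0.
move=> u v; have : A (u + v, quadF T (u + v)) = A (u, quadF T u) + A (v, quadF T v) + A (0, polF T u v).
  rewrite -!AD; congr A; rewrite (quadF_polar Tlin).
  by congr (_, _); rewrite /= addr0.
rewrite !AG AM LD (quadF_polar Tlin') => /(congr1 snd) /= /addrI -> //.
Qed.
End Structure.

Section Weights.
Variables (K : finFieldType) (m : nat).
Hypothesis cardK : #|K| = (2 ^ m)%N.
Hypothesis m_gt4 : (4 < m)%N.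
Let m_gt1 : (1 < m)%N. Proof. exact: leq_trans m_gt4. Qed.

(** A group is not the union of two proper subgroups. *)
Lemma union_subgroups (U : zmodType) (S1 S2 : pred U) :
  (forall x y, S1 (x + y) -> S1 x -> S1 y) -> (forall x y, S2 (x + y) -> S2 x -> S2 y) ->
  (forall x, S1 x || S2 x) -> (forall x y, S1 (x + y) -> S1 y -> S1 x) ->
  forall x0, ~~ S1 x0 -> forall x, S2 x.
Proof.
move=> h1 h2 cov h1' x0 n1 x; have := cov x; case s2: (S2 x); rewrite // orbF => s1.
have n2 : ~~ S1 (x0 + x) by apply: contra n1 => h; apply: h1' h s1.
have := cov (x0 + x); rewrite (negbTE n2) /= => s2'.
have := cov x0; rewrite (negbTE n1) /= => s20.
by have := h2 _ _ s2' s20; rewrite s2.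
Qed.

(** After normalization phi becomes a ring homomorphism psi with psi^s psi = r^t r; comparing the
    values at x and x + 1 shows that psi x and its image under s are the roots of
    (Y + r x) (Y + (r x)^t). *)
Lemma weight_lemma i j (phi r : K -> K) (c : K) : additive_map phi -> (exists w, phi w <> 0) ->
  field_mono r -> ring_generator (frob i c * c) ->
  (forall x w, phi (frob i x * x * w) = frob j (r x) * r x * phi w) ->
  exists2 b, b <> 0 & (forall w, phi w = b * r w) /\ (forall x : K, frob i x = frob j x) \/
                      (forall w, phi w = b * frob j (r w)) /\ (forall x : K, frob i (frob j x) = x).
Proof.
move=> phiD [w0 /eqP pw0] rmono cR hphi; have [rD rM ri] := rmono.
have mul x w : phi (x * w) * phi w0 = phi (x * w0) * phi w.
  suff : [forall w, phi (x * w) * phi w0 == phi (x * w0) * phi w] by move/forallP/(_ w)/eqP.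
  move: x {w}; apply: (cR (fun x => [forall w, phi (x * w) * phi w0 == phi (x * w0) * phi w])).
  - by apply/forallP => w; rewrite !mul1r mulrC.
  - move=> x y /forallP hx /forallP hy; apply/forallP => w.
    by rewrite !mulrDl !phiD !mulrDl (eqP (hx w)) (eqP (hy w)).
  - move=> x y /forallP hx /forallP hy; apply/forallP => w; apply/eqP/(mulIf pw0).
    rewrite -(mulrA x y w) (eqP (hx _)) -(mulrA x y w0) [RHS]mulrAC (eqP (hx _)).
    by rewrite -mulrA (eqP (hy w)) mulrA.
  apply/forallP => w; rewrite !hphi; apply/eqP; ring.
pose psi x := phi (x * w0) / phi w0.
have phiE x w : phi (x * w) = psi x * phi w.
  by apply: (mulIf pw0); rewrite mul /psi; field.
have psiD : additive_map psi by move=> x y; rewrite /psi mulrDl phiD mulrDl.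
have psiM x y : psi (x * y) = psi x * psi y.
  by rewrite {1}/psi -mulrA phiE /psi; field.
have psi1 : psi 1 = 1 by rewrite /psi mul1r divff.
have psiX n x : psi (x ^+ n) = psi x ^+ n.
  by elim: n => [|n IH]; rewrite ?expr0 // !exprS psiM IH.
have psiN x : frob i (psi x) * psi x = frob j (r x) * r x.
  rewrite /frob -psiX -psiM -/(frob i x); apply: (mulIf pw0).
  by rewrite -phiE hphi.
have psiS x : frob i (psi x) + psi x = frob j (r x) + r x.
  have := psiN (x + 1); rewrite psiD psi1 rD (mono1 rmono) !(frD cardK) !fr1 => h.
  have := psiN x => h'.
  transitivity ((frob i (psi x) + 1) * (psi x + 1) - frob i (psi x) * psi x - 1); first by ring.
  by rewrite h h'; ring.
have roots x : (psi x + r x) * (psi x + frob j (r x)) = 0.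
  transitivity (psi x * psi x + psi x * (frob j (r x) + r x) + frob j (r x) * r x); first by ring.
  by rewrite -psiS -psiN; ring2 cardK.
have cov x : (psi x == r x) || (psi x == frob j (r x)).
  have /eqP := roots x; rewrite mulf_eq0 => /orP[]/eqP/(addK_eq0 cardK) ->; by rewrite eqxx ?orbT.
have phi_psi w : phi w = (phi w0 / psi w0) * psi w.
  have e : phi (w * w0) = psi w * phi w0 := phiE w w0.
  have p0 : psi w0 != 0.
    apply/eqP => h; move: (phiE w0 1); rewrite mulr1 h mul0r => /eqP; by rewrite (negbTE pw0).
  have := phiE w0 w; rewrite mulrC e => {}e.
  by apply: (mulfI p0); rewrite -e; field.
have p0 : phi w0 / psi w0 <> 0.
  move=> h; have := phi_psi w0; rewrite h mul0r => /eqP; by rewrite (negbTE pw0).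
exists (phi w0 / psi w0) => //.
have sur := mono_surj rmono.
have [/forallP h1|/forallPn[x0 n1]] := boolP [forall x, psi x == r x].
  left; split=> [w|x]; first by rewrite phi_psi (eqP (h1 w)).
  have [y <-] := sur x; have [->|/eqP y0] := eqVneq y 0; first by rewrite (mono0 rmono) !(fr0 cardK).
  have /eqP ry := mono_neq0 rmono y0.
  by have := psiN y; rewrite (eqP (h1 y)) => /(mulIf ry).
have h2 : forall x, psi x == frob j (r x).
  apply: (@union_subgroups _ (fun x => psi x == r x) _ _ _ cov _ x0 n1) => x y /=; rewrite ?psiD ?rD ?(frD cardK).
  - move=> h /eqP e; rewrite e in h; by move/eqP/addrI: h => ->.
  - move=> h /eqP e; rewrite e in h; by move/eqP/addrI: h => ->.
  - move=> h /eqP e; rewrite e in h; by move/eqP/addIr: h => ->.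
right; split=> [w|x]; first by rewrite phi_psi (eqP (h2 w)).
have [y <-] := sur x; have [->|/eqP y0] := eqVneq y 0; first by rewrite (mono0 rmono) !(fr0 cardK).
have /eqP ry := mono_neq0 rmono y0.
have jr : frob j (r y) != 0 by rewrite fr_eq0.
by have := psiN y; rewrite (eqP (h2 y)) mulrC => /(mulfI jr).
Qed.

(** Take x = 1, then x not fixed by the automorphism. *)
Lemma split_weights j (P Q : K) : ~~ (m %| j)%N -> (forall x : K, x * P + frob j x * Q = 0) -> P = 0 /\ Q = 0.
Proof.
move=> mj h; have [c /eqP hc] : exists c : K, frob j c != c.
  apply/existsP; apply: contraR mj => /existsPn hn.
  apply: (fr_id_dvd cardK m_gt1) => x; apply/eqP; by have := hn x; rewrite negbK.
have e : P = Q by apply: (addK_eq0 cardK); have := h 1; rewrite fr1 !mul1r.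
have : (c + frob j c) * P = 0 by rewrite mulrDl {2}e.
move/eqP; rewrite mulf_eq0 => /orP[/eqP hc0|/eqP P0]; last by rewrite -e P0.
by case: hc; apply/esym/(addK_eq0 cardK).
Qed.

End Weights.

(** * Maps commuting with an irreducible semilinear map *)

Section Galois.
Variables (K : finFieldType) (m k : nat).
Hypothesis cardK : #|K| = (2 ^ m)%N.
Hypothesis m_gt1 : (1 < m)%N.
Hypothesis co : coprime k m.

(** Independence of the powers of the automorphism, as in Hilbert's Theorem 90. *)
Lemma galois_average (g : nat -> K * K) : g 0 <> 0 ->
  exists x, \sum_(i < m) scale (frob (k * i) x) (g i) <> 0.
Proof.
move=> g0.
have [/existsP[x /eqP hx]|/existsPn h] :=
  boolP [exists x, \sum_(i < m) scale (frob (k * i) x) (g i) != 0]; first by exists x.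
have {}h x : \sum_(i < m) scale (frob (k * i) x) (g i) = 0.
  by apply/eqP; have := h x; rewrite negbK.
have m0 : (0 < m)%N := ltnW m_gt1.
case: g0; apply: vec_ext.
  apply: (frk_indep cardK m_gt1 (c := fun i => (g i).1) co (leqnn m) _ m0) => x.
  transitivity (\sum_(i < m) scale (frob (k * i) x) (g i)).1; last by rewrite h.
  rewrite (big_morph (fun v : K * K => v.1) (id1 := 0) (op1 := +%R)) //.
  by apply: eq_bigr => i _; rewrite /= mulrC.
apply: (frk_indep cardK m_gt1 (c := fun i => (g i).2) co (leqnn m) _ m0) => x.
transitivity (\sum_(i < m) scale (frob (k * i) x) (g i)).2; last by rewrite h.
rewrite (big_morph (fun v : K * K => v.2) (id1 := 0) (op1 := +%R)) //.
by apply: eq_bigr => i _; rewrite /= mulrC.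
Qed.

Lemma frk_m x : frob (k * m) x = x :> K.
Proof. by rewrite mulnC (frmM cardK). Qed.

Variable T : K * K -> K * K.
Hypothesis Tlin : frob_semilinear k T.
Hypothesis Tirr : irred T.

Lemma iter_semilinear i : frob_semilinear (k * i) (iter i T).
Proof.
case: Tlin => TD TZ; elim: i => [|i [ID IZ]].
  by split=> // a v /=; rewrite muln0 fr0E.
split=> [u v|a v] /=; first by rewrite ID TD.
by rewrite IZ TZ fr_comp mulnS.
Qed.

Lemma Tirr_fix v : T v = v -> v = 0.
Proof.
move=> h; have [//|/eqP/Tirr] := eqVneq v 0.
by rewrite h (det_id cardK).
Qed.

(** Otherwise the average of a multiple of (1, 0) over the powers of T would be fixed by T. *)
Lemma iter_order_nontrivial : ~ (forall v, iter m T v = v).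
Proof.
move=> h; case: Tlin => TD TZ.
have [x] := @galois_average (fun i => iter i T (1, 0)) (@e1_neq0 K).
apply; apply: Tirr_fix; rewrite (additive_map_sum _ _ _ TD).
have m0 : (0 < m)%N := ltnW m_gt1.
have st i : T (scale (frob (k * i) x) (iter i T (1, 0))) = scale (frob (k * i.+1) x) (iter i.+1 T (1, 0)).
  by rewrite TZ fr_comp mulnS.
rewrite -[in RHS](prednK m0) -(prednK m0) big_ord_recr [RHS]big_ord_recl /= addrC.
rewrite st prednK // frk_m h muln0 fr0E /=; congr (_ + _).
by apply: eq_bigr => i _; rewrite st.
Qed.

(** If X kills v it kills T v, and these two vectors form a basis. *)
Lemma commutant_ker (X : K * K -> K * K) v : semilinear id X -> (forall u, X (T u) = T (X u)) ->
  v <> 0 -> X v = 0 -> forall u, X u = 0.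
Proof.
move=> [XD XZ] XT v0 Xv u; have [TD TZ] := Tlin.
rewrite (det_basis cardK (Tirr v0) u) XD !XZ Xv XT Xv (additive_map0 TD).
by rewrite !scaler0 addr0.
Qed.

Section Commutant.
Variable X : K * K -> K * K.
Hypothesis Xlin : semilinear id X.
Hypothesis XT : forall v, X (T v) = T (X v).

Lemma cayley_hamilton : exists t d, forall v, X (X v) = scale t (X v) + scale d v.
Proof.
have [XD XZ] := Xlin.
exists (det (X (1, 0)) (0, 1) + det (1, 0) (X (0, 1))), (det (X (1, 0)) (X (0, 1))).
have E v : X v = scale v.1 (X (1, 0)) + scale v.2 (X (0, 1)).
  by rewrite {1}(coordE v) XD !XZ.
move=> v; rewrite !(E (X v)) !(E v); case: v => a b /=.
by case: (X (1, 0)) => p q; case: (X (0, 1)) => r s; rewrite /det /scale; vec2 cardK.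
Qed.

Let X1 v := X v + v.
Let X1lin : semilinear id X1.
Proof.
have [XD XZ] := Xlin; split=> [u v|a v]; first by rewrite /X1 XD addrACA.
by rewrite /X1 XZ scaleD.
Qed.
Let X1T u : X1 (T u) = T (X1 u).
Proof. by case: Tlin => TD _; rewrite /X1 TD XT. Qed.

Let X1_id v : v <> 0 -> X1 v = 0 -> forall u, X u = u.
Proof.
move=> v0 h u; apply: (addV_eq0 cardK).
exact: (commutant_ker X1lin X1T v0 h).
Qed.

(** The trace and determinant of X are fixed by the automorphism, hence lie in F_2. By
    commutant_ker the polynomial X^2 + X + 1 is then the only one available to a non-scalar X. *)
Lemma commutant : [\/ forall v, X v = 0, forall v, X v = v |
   (forall v, X (X v) = X v + v) /\ exists v, det (X v) v <> 0].
Proof.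
have [XD XZ] := Xlin; have [TD TZ] := Tlin.
have T_surj y : exists v, T v = y by apply: inj_surj; apply: (T_inj Tlin Tirr).
have [/existsP[v /eqP hv]|/existsPn h] := boolP [exists v, det (X v) v != 0]; last first.
  have {}h v : det (X v) v = 0 by apply/eqP; have := h v; rewrite negbK.
  have e1 := @e1_neq0 K; have [c hc] := det_eq0 cardK e1 (h (1, 0)).
  have cc : frob k c = c.
    have := h ((1, 0) + T (1, 0)); rewrite XD XT hc TZ detDl !detDr !detZl !(det_id cardK).
    rewrite !mulr0 add0r addr0 (detC (1, 0)) -mulrDl => /eqP; rewrite mulf_eq0.
    by case/orP => /eqP; [move/(addK_eq0 cardK) | move/(Tirr e1)].
  case: (fr_fix cardK m_gt1 co cc) => c01.
    by apply: Or31; apply: (commutant_ker Xlin XT e1); rewrite hc c01 scale0.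
  by apply: Or32; apply: (X1_id e1); rewrite /X1 hc c01 scale1 (addVV cardK).
have v0 : v <> 0 by move=> v0; apply: hv; rewrite v0 det0r.
have [t [d CH]] := cayley_hamilton.
have [tf df] : frob k t = t /\ frob k d = d.
  have E w : scale (frob k t + t) (X (T w)) + scale (frob k d + d) (T w) = 0.
    have := CH (T w); rewrite XT XT (CH w) TD !TZ => e.
    have E4 (a b c' d' : K * K) : a + b = c' + d' -> (a + c') + (b + d') = 0.
      by move=> e4; rewrite addrACA e4 (addVV cardK).
    by rewrite !scaleDl; apply: E4.
  have [u hu] := T_surj v.
  have := E u; rewrite hu => h.
  have ht : frob k t + t = 0.
    have := congr1 (fun w => det w v) h; rewrite detDl !detZl (det_id cardK) mulr0 addr0 det0l.
    by move/eqP; rewrite mulf_eq0 => /orP[]/eqP.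
  split; apply: (addK_eq0 cardK) => //.
  by move: h; rewrite ht scale0 add0r => /scale_eq0[].
have [d0|d1] := fr_fix cardK m_gt1 co df.
  exfalso; apply: (hv).
  have Xv0 : X v + scale t v <> 0.
    move=> e; apply: hv; have := congr1 (fun w => det w v) e.
    by rewrite detDl detZl (det_id cardK) mulr0 addr0 det0l.
  rewrite (commutant_ker Xlin XT Xv0) ?det0l //.
  by rewrite XD XZ CH d0 scale0 addr0 (addVV cardK).
have [t0|t1] := fr_fix cardK m_gt1 co tf; last first.
  by apply: Or33; split=> [w|]; [rewrite CH t1 d1 !scale1 | exists v].
exfalso; apply: (hv).
have Xv0 : X1 v <> 0.
  move=> e; apply: hv; have := congr1 (fun w => det w v) e.
  by rewrite /X1 detDl (det_id cardK) addr0 det0l.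
rewrite (X1_id Xv0) ?(det_id cardK) //.
rewrite /X1 XD CH t0 d1 scale0 add0r scale1.
have E (a b : K * K) : a + b + (b + a) = 0 by vec2 cardK.
exact: E.
Qed.
End Commutant.
End Galois.

(** * Consequences for a semilinear equivalence *)

Lemma fr_period (K : finFieldType) (m k n : nat) : #|K| = (2 ^ m)%N -> (1 < m)%N -> coprime k m ->
  (forall x : K, frob (k * n) x = x) -> (m %| n)%N.
Proof.
move=> cardK m_gt1 co h; have := fr_id_dvd cardK m_gt1 h.
by rewrite Gauss_dvdr // coprime_sym.
Qed.

Section Semi.
Variables (K : finFieldType) (m p k k' : nat).
Hypothesis cardK : #|K| = (2 ^ m)%N.
Hypothesis m_gt4 : (4 < m)%N.
Hypothesis pm : primitive p m.
Hypothesis co : coprime k m.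
Hypothesis co' : coprime k' m.
Variables T T' : K * K -> K * K.
Hypothesis Tlin : frob_semilinear k T.
Hypothesis Tirr : irred T.
Hypothesis Tlin' : frob_semilinear k' T'.
Hypothesis Tirr' : irred T'.
Variables (L M : K * K -> K * K) (r : K -> K) (c : K).
Hypothesis hS : semilinear_equiv k k' T T' L M r.
Hypothesis cp : p_element p c.
Let m_gt1 : (1 < m)%N. Proof. exact: leq_trans m_gt4. Qed.
Let rM : field_mono r. Proof. by case: hS. Qed.
Let LD : additive_map L. Proof. by case: hS => -[[]]. Qed.
Let LZ a v : L (scale a v) = scale (r a) (L v). Proof. by case: hS => -[[]]. Qed.
Let L_inj : injective L. Proof. by case: hS => -[]. Qed.
Let MD : additive_map M. Proof. by case: hS => _ []. Qed.
Let M_inj : injective M. Proof. by case: hS => _ []. Qed.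
Let Mt x w : M (torus k x w) = torus k' (r x) (M w). Proof. by case: hS. Qed.
Let MB u v : M (polF T u v) = polF T' (L u) (L v). Proof. by case: hS. Qed.
Let L_surj y : exists v, L v = y. Proof. exact: inj_surj L_inj y. Qed.
Let M_surj y : exists v, M v = y. Proof. exact: inj_surj M_inj y. Qed.

Let small n : (0 < n < 5)%N -> (m %| n)%N -> False.
Proof. by case/andP=> n0 n5 /(dvdn_leq n0); rewrite leqNgt (leq_trans n5 m_gt4). Qed.

Let rig i : ~~ (m %| i * 2)%N -> ring_generator (frob i c * c).
Proof. by move=> h; apply: (p_element_generates cardK pm); apply: (p_element_weight m_gt1 pm). Qed.

Let rig1 : ring_generator (frob k c * c).
Proof.
apply: rig; apply/negP; rewrite Gauss_dvdr 1?coprime_sym //; exact: small.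
Qed.

Let rig2 : ring_generator (frob (k + k) c * c).
Proof.
apply: rig; apply/negP; rewrite addnn -muln2 -mulnA Gauss_dvdr 1?coprime_sym //; exact: small.
Qed.

Let m11 y := (M (y, 0)).1.
Let m12 y := (M (0, y)).1.
Let m21 y := (M (y, 0)).2.
Let m22 y := (M (0, y)).2.

Let ME w : M w = (m11 w.1 + m12 w.2, m21 w.1 + m22 w.2).
Proof.
rewrite {1}(_ : w = (w.1, 0) + (0, w.2)) ?MD; first by [].
by apply: vec_ext; rewrite /= ?addr0 ?add0r.
Qed.

Let m1D y z : M (y + z, 0) = M (y, 0) + M (z, 0).
Proof. by rewrite -MD; congr M; apply: vec_ext; rewrite /= ?addr0. Qed.
Let m2D y z : M (0, y + z) = M (0, y) + M (0, z).
Proof. by rewrite -MD; congr M; apply: vec_ext; rewrite /= ?addr0. Qed.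

Let Mt1 x y : M (frob k x * x * y, 0) = torus k' (r x) (M (y, 0)).
Proof. by rewrite -Mt; congr M; rewrite /torus /= mulr0. Qed.
Let Mt2 x y : M (0, frob (k + k) x * x * y) = torus k' (r x) (M (0, y)).
Proof. by rewrite -Mt; congr M; rewrite /torus /= mulr0 fr_comp. Qed.

Let ex_or (f : K -> K) : (exists y, f y <> 0) \/ forall y, f y = 0.
Proof.
have [/existsP[y /eqP h]|/existsPn h] := boolP [exists y, f y != 0]; [left | right] => [|y].
  by exists y.
by apply/eqP; have := h y; rewrite negbK.
Qed.

Let det_L : exists2 d, d <> 0 & forall u v, det (L u) (L v) = d * r (det u v).
Proof.
case: rM => rD rMul _.
exists (det (L (1, 0)) (L (0, 1))); last exact: (semilinear_det cardK rD rMul (conj LD LZ)).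
move=> d0; have Le0 : L (1, 0) <> 0 by rewrite -(additive_map0 LD) => /L_inj/(@e1_neq0 K).
apply: Le0; apply: det_nondeg => v; have [u <-] := L_surj v.
by rewrite (semilinear_det cardK rD rMul (conj LD LZ)) d0 mul0r.
Qed.

(** Two proportional linear forms come from proportional vectors. *)
Let form_eq d P x b : d <> 0 -> (forall u v, det (L u) (L v) = d * r (det u v)) ->
  (forall v, det P (L v) = b * r (det x v)) -> P = scale (d^-1 * b) (L x).
Proof.
move=> /eqP d0 dE h.
apply: (addV_eq0 cardK); apply: det_nondeg => y; have [v <-] := L_surj y.
by rewrite detDl detZl h dE mulrAC mulKf // mulrC (addKK cardK).
Qed.

Let M1E u v : (M (polF T u v)).1 = det (T' (L u)) (L v) + det (T' (L v)) (L u).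
Proof. by rewrite MB. Qed.
Let M2E u v : (M (polF T u v)).2 = det (T' (T' (L u))) (L v) + det (T' (T' (L v))) (L u).
Proof. by rewrite MB. Qed.

Let TZ a v : T (scale a v) = scale (frob k a) (T v). Proof. by case: Tlin. Qed.
Let TZ' a v : T' (scale a v) = scale (frob k' a) (T' v). Proof. by case: Tlin'. Qed.

(** Compare the parts that are linear in x after replacing v by x v. *)
Let match_forms i (P Q P0 Q0 : K) : ~~ (m %| i)%N ->
  (forall x, r x * P + frob i (r x) * Q = r x * P0 + frob i (r x) * Q0) -> P = P0.
Proof.
move=> mi h; suff [+ _] : P + P0 = 0 /\ Q + Q0 = 0 by move/(addK_eq0 cardK).
apply: (split_weights cardK m_gt4 mi) => x; have [y <-] := mono_surj rM x.
rewrite !mulrDr; have := h y; set a := _ * P; set b := _ * Q => e.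
by rewrite addrACA e (addKK cardK).
Qed.

(** By weights M preserves the first coordinate up to a constant b. Then T L is proportional to L T,
    and a multiple of L commutes with T; its cube is the identity by commutant. *)
Lemma semi_cube : k' = k -> (forall v, T' v = T v) -> (forall x, r x = x) ->
  exists2 d, d <> 0 & forall v, L (L (L v)) = scale d v.
Proof.
move=> kk TT r1; have rD : additive_map r by case: rM.
have m12_0 : forall y, m12 y = 0.
  case: (ex_or m12) => // h; exfalso.
  have hw x w : m12 (frob (k + k) x * x * w) = frob k' (r x) * r x * m12 w by rewrite /m12 Mt2.
  have m12D : additive_map m12 by move=> y z; rewrite /m12 m2D.
  have [b _ [[_ e]|[_ e]]] := weight_lemma cardK m12D h rM rig2 hw.
    apply: (@small 1) => //; apply: (fr_period cardK m_gt1 co) => x.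
    by apply: (fr_inj cardK (k := k)); rewrite muln1 fr_comp e kk.
  apply: (@small 3) => //; apply: (fr_period cardK m_gt1 co) => x.
  by rewrite -[RHS]e kk fr_comp; congr frob; lia.
have m11_n0 : exists y, m11 y <> 0.
  case: (ex_or m11) => // h; exfalso; have [w] := M_surj (1, 0).
  by rewrite ME h m12_0 addr0 => -[/eqP]; rewrite eq_sym oner_eq0.
have hw x w : m11 (frob k x * x * w) = frob k' (r x) * r x * m11 w by rewrite /m11 Mt1.
have m11D : additive_map m11 by move=> y z; rewrite /m11 m1D.
have [b /eqP b0 [[bE _]|[_ e]]] := weight_lemma cardK m11D m11_n0 rM rig1 hw; last first.
  exfalso; apply: (@small 2) => //; apply: (fr_period cardK m_gt1 co) => x.
  by rewrite -[RHS]e kk fr_comp; congr frob; lia.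
have mk : ~~ (m %| k)%N.
  apply/negP; rewrite -[k]muln1 Gauss_dvdr 1?coprime_sym //; exact: small.
have form u v : det (T (L u)) (L v) = b * r (det (T u) v).
  apply: (@match_forms k _ (det (T (L v)) (L u)) _ (b * r (det (T v) u)) mk) => x.
  have := M1E u (scale x v); rewrite ME /= m12_0 addr0 bE rD !TT LZ !TZ !(detZl, detZr).
  case: rM => _ rMul _; rewrite !rMul (mono_fr rM) mulrDr => e.
  by rewrite -e; ring.
have [d0 d0n dE] := det_L.
have comm u : T (L u) = scale (d0^-1 * b) (L (T u)).
  by apply: form_eq => // v; rewrite form.
set e := d0^-1 * b in comm.
have e0 : e != 0 by rewrite mulf_neq0 // invr_eq0; apply/eqP.
(* The map x -> x^(s-1) permutes the nonzero elements, as only 0 and 1 are fixed by s. *)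
have [z z0 zE] : exists2 z : K, z != 0 & frob k z * e = z.
  pose f (x : K) := if x == 0 then 0 else frob k x / x.
  have f_inj : injective f.
    move=> x y; rewrite /f; have [->|x0] := eqVneq x 0.
      have [->//|y0] := eqVneq y 0; move/eqP; rewrite eq_sym mulf_eq0 invr_eq0 fr_eq0.
      by rewrite (negbTE y0).
    have [->|y0] := eqVneq y 0.
      by move/eqP; rewrite mulf_eq0 invr_eq0 fr_eq0 (negbTE x0).
    move=> h; have fx : frob k (x / y) = x / y.
      have y0' : frob k y != 0 by rewrite fr_eq0.
      rewrite frM frV; apply: (mulIf y0'); rewrite -mulrA mulVf // mulr1.
      have -> : frob k x = frob k y / y * x by rewrite -h -mulrA mulVf // mulr1.
      by field.
    case: (fr_fix cardK m_gt1 co fx) => [/eqP|xy].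
      by rewrite mulf_eq0 invr_eq0 (negbTE x0) (negbTE y0).
    by rewrite -[x]mulr1 -(mulVf y0) mulrA xy mul1r.
  have [z hz] := inj_surj f_inj e^-1; move: hz; rewrite /f.
  case: eqP => [_ /eqP|/eqP z0 hz]; first by rewrite eq_sym invr_eq0 (negbTE e0).
  exists z => //; apply: (mulIf (invr_neq0 e0)); rewrite -mulrA mulfV // mulr1 -hz.
  by rewrite mulrCA mulfV // mulr1.
pose X v := scale z (L v).
have Xlin : semilinear id X.
  by split=> [u v|a v]; rewrite /X ?LD ?scaleD // LZ r1 !scaleA mulrC.
have XT v : X (T v) = T (X v) by rewrite /X TZ comm scaleA zE.
have X3 v : X (X (X v)) = v.
  have Xn0 : X (1, 0) <> 0.
    move/scale_eq0 => [/eqP|]; first by rewrite (negbTE z0).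
    by rewrite -(additive_map0 LD) => /L_inj; exact: e1_neq0.
  case: (commutant cardK m_gt1 co Tlin Tirr Xlin XT) => [h|h|[h _]].
  - by case: Xn0.
  - by rewrite !h.
  by rewrite h h addrAC (addVV cardK) add0r.
have zz : z * z * z != 0 by rewrite !mulf_neq0.
exists (z * z * z)^-1; first by apply/eqP; rewrite invr_eq0.
move=> v; rewrite -[v in RHS]X3 /X !LZ !r1 !scaleA.
by rewrite -!(mulrA (_^-1)) mulVf ?scale1.
Qed.

(** If the weights of the two coordinates are exchanged with s^2 = t and s t^2 = 1, the two
    coordinates express T' through T^2 and T'^2 through T^(-1), whence m = 5 and T^5 = 1, against
    iter_order_nontrivial. *)
Let no_exchange d1 d2 : m11 =1 (fun=> 0) -> d1 <> 0 -> d2 <> 0 ->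
  (forall w, m12 w = d1 * r w) -> (forall w, m21 w = d2 * frob (k' + k') (r w)) -> m22 =1 (fun=> 0) ->
  (forall x : K, frob (k + k) x = frob k' x) -> (forall x : K, frob k (frob (k' + k') x) = x) -> False.
Proof.
move=> h11 /eqP d10 /eqP d20 h12 h21 h22 e1 e2; have [rD rMul _] := rM.
have k5 (x : K) : frob (k * 5) x = x.
  by rewrite -[RHS]e2 -fr_comp -!e1 !fr_comp; congr frob; lia.
have m5 : m = 5%N.
  have := fr_period cardK m_gt1 co k5 => /dvdn_leq; lia.
have mk' : ~~ (m %| k')%N.
  apply/negP; rewrite -[k']muln1 Gauss_dvdr 1?coprime_sym //; exact: small.
have mk2 : ~~ (m %| k' + k')%N.
  apply/negP; rewrite addnn -muln2 Gauss_dvdr 1?coprime_sym //; exact: small.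
have [d /eqP d0 dE] := det_L.
have form1 u v : det (T' (L u)) (L v) = d1 * r (det (T (T u)) v).
  apply: (@match_forms k' _ (det (T' (L v)) (L u)) _ (d1 * r (det (T (T v)) u)) mk') => x.
  have := M1E u (scale x v); rewrite ME /= h11 add0r h12 LZ TZ' !TZ !(detZl, detZr) rD !rMul.
  by rewrite fr_comp (mono_fr rM) e1 mulrDr => e; rewrite -e; ring.
have form2 u v : det (T' (T' (L u))) (L v) = d2 * frob (k' + k') (r (det (T v) u)).
  apply: (@match_forms (k' + k') _ (det (T' (T' (L v))) (L u)) _
           (d2 * frob (k' + k') (r (det (T u) v))) mk2) => x.
  have := M2E u (scale x v); rewrite ME /= h22 addr0 h21 LZ !TZ' !TZ !(detZl, detZr) rD !rMul.
  rewrite (frD cardK) !frM (mono_fr rM) (frC (k' + k') k) e2 fr_comp mulrDr => e.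
  by rewrite -e; ring.
have c1 u : T' (L u) = scale (d^-1 * d1) (L (T (T u))).
  by apply: form_eq; [exact/eqP | exact: dE | move=> v; rewrite form1].
set b1 := d^-1 * d1 in c1.
have b10 : b1 != 0 by rewrite mulf_neq0 // invr_eq0.
pose dT := det (T (1, 0)) (T (0, 1)).
have dTE u v : det (T u) (T v) = dT * frob k (det u v).
  exact: (semilinear_det cardK (frD cardK k) (@frM K k) Tlin).
have c2 x : T' (T' (L (T x))) = scale (d^-1 * (d2 * frob (k' + k') (r dT))) (L x).
  apply: form_eq; [exact/eqP | exact: dE | move=> v].
  rewrite form2 dTE rMul frM (mono_fr rM) (frC (k' + k') k) e2 (detC v).
  by rewrite mulrA.
set b2 := d^-1 * _ in c2.
have T5 x : scale (frob k' b1 * b1) (L (T (T (T (T (T x)))))) = scale b2 (L x).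
  by rewrite -c2 c1 TZ' c1 scaleA.
have [b3 b3E] := mono_surj rM (b2 / (frob k' b1 * b1)).
have bb0 : frob k' b1 * b1 != 0 by rewrite mulf_neq0 ?fr_eq0.
have T5' x : T (T (T (T (T x)))) = scale b3 x.
  apply: L_inj; rewrite LZ b3E mulrC -scaleA -T5 scaleA mulVf // scale1 //.
have b3f : frob k b3 = b3.
  apply: (addK_eq0 cardK); have h := T5' (T (1, 0)).
  rewrite (T5' (1, 0)) TZ in h.
  have : scale (frob k b3 + b3) (T (1, 0)) = 0 by rewrite scaleDl h (addVV cardK).
  case/scale_eq0 => // T0'; have := Tirr (@e1_neq0 K); by rewrite T0' det0l.
have b31 : b3 = 1.
  case: (fr_fix cardK m_gt1 co b3f) => // b30; exfalso.
  have := T5' (1, 0); rewrite b30 scale0.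
  have TI v : T v = 0 -> v = 0 by move=> h; apply: (T_inj Tlin Tirr); rewrite h (additive_map0 (proj1 Tlin)).
  by move/TI/TI/TI/TI/TI; exact: e1_neq0.
apply: (iter_order_nontrivial cardK m_gt1 co Tlin Tirr) => v.
by rewrite m5 /= T5' b31 scale1.
Qed.

(** As M is bijective, m11 is nonzero, or else both m12 and m21 are; weight_lemma relates the
    automorphisms for each nonzero component. *)
Lemma semi_weights : m <> 6%N ->
  [\/ forall x : K, frob k x = frob k' x, forall x : K, frob k (frob k' x) = x |
      (forall x : K, frob (k + k) (frob k' x) = x) /\ (forall x : K, frob k x = frob (k' + k') x)].
Proof.
move=> m6.
have m11D : additive_map m11 by move=> y z; rewrite /m11 m1D.
have m12D : additive_map m12 by move=> y z; rewrite /m12 m2D.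
have m21D : additive_map m21 by move=> y z; rewrite /m21 m1D.
have m22D : additive_map m22 by move=> y z; rewrite /m22 m2D.
have w11 x w : m11 (frob k x * x * w) = frob k' (r x) * r x * m11 w by rewrite /m11 Mt1.
have w12 x w : m12 (frob (k + k) x * x * w) = frob k' (r x) * r x * m12 w by rewrite /m12 Mt2.
have w21 x w : m21 (frob k x * x * w) = frob (k' + k') (r x) * r x * m21 w.
  by rewrite /m21 Mt1 /torus /= fr_comp.
have w22 x w : m22 (frob (k + k) x * x * w) = frob (k' + k') (r x) * r x * m22 w.
  by rewrite /m22 Mt2 /torus /= fr_comp.
have [n11|h11] := ex_or m11.
  by have [b _ [[_ e]|[_ e]]] := weight_lemma cardK m11D n11 rM rig1 w11; [apply: Or31 | apply: Or32].
have n12 : exists y, m12 y <> 0.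
  case: (ex_or m12) => // h; exfalso; have [w] := M_surj (1, 0).
  by rewrite ME h h11 addr0 => -[/eqP]; rewrite eq_sym oner_eq0.
have n21 : exists y, m21 y <> 0.
  case: (ex_or m21) => // h; exfalso.
  have : M (1, 0) = M 0 by rewrite !ME /= !h !h11.
  by move/M_inj/(@e1_neq0 K).
have kill n : (0 < n < 5)%N -> (forall x : K, frob (k * n) x = x) -> False.
  by move=> n5 /(fr_period cardK m_gt1 co); apply: small.
have kill' n : (0 < n < 5)%N -> (forall x : K, frob (k' * n) x = x) -> False.
  by move=> n5 /(fr_period cardK m_gt1 co'); apply: small.
have [b1 b10 [[h12 e1]|[h12 e1]]] := weight_lemma cardK m12D n12 rM rig2 w12;
have [b2 b20 [[h21 e2]|[h21 e2]]] := weight_lemma cardK m21D n21 rM rig1 w21.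
- exfalso; apply: (kill' 3) => // x; apply: (fr_inj cardK (k := k')).
  by rewrite -[RHS]e1 -fr_comp !e2 !fr_comp; congr frob; lia.
- exfalso; apply: (no_exchange h11 b10 b20 h12 h21 _ e1 e2).
  have [n22|//] := ex_or m22; exfalso.
  have k5 (x : K) : frob (k * 5) x = x by rewrite -[RHS]e2 -fr_comp -!e1 !fr_comp; congr frob; lia.
  have [b3 _ [[_ e3]|[_ e3]]] := weight_lemma cardK m22D n22 rM rig2 w22.
    apply: (kill 2) => // x; apply: (fr_inj cardK (k := k + k)).
    by rewrite [RHS]e3 -[RHS]fr_comp -!e1 !fr_comp; congr frob; lia.
  apply: (kill 1) => // x; apply: (fr_inj cardK (k := k * 5)).
  by rewrite [RHS]k5 -[RHS]e3 -[frob (k' + k') x]fr_comp -!e1 !fr_comp; congr frob; lia.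
- by apply: Or33.
exfalso; apply: (kill 3) => // x.
rewrite -{1}[x]e2 -[RHS]e1 -{2}[x]e1 !fr_comp; congr frob; lia.
Qed.

End Semi.

(** * The torus as a Sylow subgroup of the automorphism group *)

Section TorusGroup.
Variables (K : finFieldType) (m p k : nat).
Hypothesis cardK : #|K| = (2 ^ m)%N.
Hypothesis pm : primitive p m.
Local Notation W := ((K * K) * (K * K))%type.

Lemma torus_actM (a b : K) (x : W) : torus_act k a (torus_act k b x) = torus_act k (a * b) x.
Proof. by rewrite /torus_act /= scaleA torusM. Qed.

Lemma torus_act1 (x : W) : torus_act k 1 x = x.
Proof. by case: x => v w; rewrite /torus_act /= scale1 torus1. Qed.

Lemma torus_actD (a : K) : additive_map (@torus_act K k a).
Proof. by move=> u v; rewrite /torus_act /= scaleD torusD. Qed.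

Lemma torus_act_inj (u : {unit K}) : injective (torus_act k (val u)).
Proof.
apply: (can_inj (g := torus_act k (val u)^-1)) => x; rewrite torus_actM mulVr ?torus_act1 //; exact: (valP u).
Qed.

Definition torus_perm (u : {unit K}) : {perm W} := perm (@torus_act_inj u).

Lemma torus_permE u x : torus_perm u x = torus_act k (val u) x.
Proof. by rewrite permE. Qed.

Lemma torus_perm_morph : {in [set: {unit K}] &, {morph torus_perm : u v / (u * v)%g}}.
Proof.
by move=> u v _ _; apply/permP => x; rewrite permM !torus_permE torus_actM mulrC FinRing.val_unitM.
Qed.
Canonical torus_perm_morphism := Morphism torus_perm_morph.

Definition torus_group := (torus_perm @* [set: {unit K}])%G.

Lemma torus_groupP g : reflect (exists u, g = torus_perm u) (g \in torus_group).
Proof.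
apply: (iffP morphimP) => [[u _ _ ->]|[u ->]]; first by exists u.
by exists u; rewrite ?inE.
Qed.

Lemma torus_perm_inj : injective torus_perm.
Proof.
move=> u v /permP/(_ ((1, 0), 0)); rewrite !torus_permE /torus_act /= => -[].
by rewrite !mulr1 => + _ => /val_inj.
Qed.

Lemma torus_abelian : abelian torus_group.
Proof.
apply: morphim_abelian; apply/centsP => u _ v _; apply/val_inj.
by rewrite !FinRing.val_unitM mulrC.
Qed.

Lemma zperm_p_element u : (p.-elt (torus_perm u))%g -> torus_perm u <> 1%g -> p_element p (val u).
Proof.
move=> pu nu; split.
  move=> u1; apply: nu; rewrite (_ : u = 1%g); last exact/val_inj.
  exact: (morph1 torus_perm_morphism).
have [n nE] := p_natP pu; exists n.
have : (torus_perm u ^+ (p ^ n) = 1)%g by rewrite -nE expg_order.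
rewrite -(morphX torus_perm_morphism) ?inE // -(morph1 torus_perm_morphism) => /torus_perm_inj/(congr1 val).
by rewrite FinRing.val_unitX.
Qed.

Lemma torus_p_nontrivial (P : {group {perm W}}) : p.-Sylow(torus_group)%g P -> (P != 1 :> {set _})%g.
Proof.
move=> sP; have [pp pd _] := pm.
have pU : (p %| #|[set: {unit K}]|)%N by rewrite card_finField_unit cardK.
have [u _ ou] := Cauchy pp pU.
have nP : (P <| torus_group)%g by rewrite -sub_abelian_normal ?torus_abelian // (pHall_sub sP).
have uZ : torus_perm u \in torus_group by apply/torus_groupP; exists u.
have uP : torus_perm u \in P.
  rewrite (mem_normal_Hall sP nP uZ) /p_elt.
  have : (#[torus_perm u]%g %| p)%N by rewrite -ou; apply: (morph_order torus_perm_morphism); rewrite inE.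
  by move/pnat_dvd; apply; apply: pnat_id.
apply/trivgPn; exists (torus_perm u) => //.
apply/eqP => e; have : u = 1%g by apply: torus_perm_inj; rewrite e (morph1 torus_perm_morphism).
by move=> u1; move: ou pp; rewrite u1 order1 => <-.
Qed.
End TorusGroup.

Section Aut.
Variables (K : finFieldType).
Local Notation W := ((K * K) * (K * K))%type.

Definition graph_mapb (T T' : K * K -> K * K) (g : {perm W}) : bool :=
  [forall u, forall v, g (u + v) == g u + g v] &&
  [forall v, (g (v, quadF T v)).2 == quadF T' (g (v, quadF T v)).1].

Lemma graph_mapP T T' (g : {perm W}) : reflect (graph_map T T' g) (graph_mapb T T' g).
Proof.
apply: (iffP andP) => [[/forallP h1 /forallP h2]|[h1 _ h2]].
  split; [move=> u v; exact/eqP/(forallP (h1 u)) | exact: perm_inj | move=> v; exact/eqP].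
by split; apply/forallP => u; [apply/forallP => v|]; apply/eqP.
Qed.

Lemma graph_map_mul (T1 T2 T3 : K * K -> K * K) (g h : {perm W}) :
  graph_map T1 T2 g -> graph_map T2 T3 h -> graph_map T1 T3 (g * h)%g.
Proof.
move=> [g1 _ g2] [h1 _ h2]; split; [|exact: perm_inj|].
  by move=> u v; rewrite !permM g1 h1.
by move=> v; rewrite !permM [g _]surjective_pairing g2 h2.
Qed.

Lemma graph_map_inv (T1 T2 : K * K -> K * K) (g : {perm W}) :
  graph_map T1 T2 g -> graph_map T2 T1 g^-1%g.
Proof.
move=> [g1 _ g2]; split; [|exact: perm_inj|].
  by move=> u v; apply: (@perm_inj _ g); rewrite g1 !permKV.
move=> v; pose hh v := (g (v, quadF T1 v)).1.
have hi : injective hh.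
  move=> a b e; have : g (a, quadF T1 a) = g (b, quadF T1 b).
    by rewrite [LHS]surjective_pairing [RHS]surjective_pairing !g2 -/(hh a) -/(hh b) e.
  by move/perm_inj => [].
have [a <-] := inj_surj hi v.
by rewrite /hh -g2 -surjective_pairing permK.
Qed.

Definition auto_set (T : K * K -> K * K) : {set {perm W}} := [set g | graph_mapb T T g].

Lemma auto_group_set T : group_set (auto_set T).
Proof.
apply/group_setP; split=> [|g h]; rewrite !inE.
  apply/graph_mapP; split=> [u v||v]; rewrite ?perm1 //; exact: perm_inj.
by move=> /graph_mapP hg /graph_mapP hh; apply/graph_mapP/(graph_map_mul hg hh).
Qed.
Canonical auto_group T := Group (auto_group_set T).

Lemma auto_conj T1 T2 (a : {perm W}) : graph_map T1 T2 a -> (auto_group T1 :^ a)%g = auto_group T2 :> {set _}.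
Proof.
move=> ha; have hi := graph_map_inv ha.
apply/setP => g; rewrite mem_conjg !inE; apply/graph_mapP/graph_mapP => hg.
  have -> : g = (a^-1 * (g ^ a^-1) * a)%g by rewrite conjgE invgK !mulgA mulVg mul1g mulgKV.
  exact: graph_map_mul (graph_map_mul hi hg) ha.
rewrite conjgE invgK mulgA; exact: graph_map_mul (graph_map_mul ha hg) hi.
Qed.
End Aut.

Section SylowTorus.
Variables (K : finFieldType) (m p k : nat).
Hypothesis cardK : #|K| = (2 ^ m)%N.
Hypothesis m_gt4 : (4 < m)%N.
Hypothesis pm : primitive p m.
Hypothesis co : coprime k m.
Variables T : K * K -> K * K.
Hypothesis Tlin : frob_semilinear k T.
Hypothesis Tirr : irred T.
Local Notation W := ((K * K) * (K * K))%type.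
Let m_gt1 : (1 < m)%N. Proof. exact: leq_trans m_gt4. Qed.
Local Notation Z := (torus_group K k).

Lemma torus_auto : Z \subset auto_group T.
Proof.
apply/subsetP => _ /torus_groupP[u ->]; rewrite inE; apply/graph_mapP; split.
- by move=> x y; rewrite !torus_permE torus_actD.
- exact: perm_inj.
by move=> v; rewrite torus_permE /torus_act /= (quadF_sc Tlin).
Qed.

(** By graph_map_structure g acts linearly over K on arguments, with scalar cube by semi_cube; on the
    graph, which spans, its cube agrees with the torus element of that scalar. *)
Lemma commute_cube u (g : {perm W}) : p_element p (val u) -> g \in auto_group T ->
  commute g (torus_perm k u) -> (g ^+ 3 \in Z)%g.
Proof.
move=> pu; rewrite inE => /graph_mapP hg cg.
have cR := p_element_generates cardK pm pu.
have gz x : g (torus_act k (val u) x) = torus_act k (val u) (g x).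
  by rewrite -!(@torus_permE K k) -!permM cg.
have [L [M [r [hS rc AG AM Az]]]] :=
  graph_map_structure cardK m_gt4 co Tlin Tirr Tlin hg cR gz.
have [_ _ rM _ _] := hS; have [rD rMul _] := rM.
have r1 x : r x = x.
  apply/eqP; move: x; apply: (cR (fun x => r x == x)).
  - by rewrite (mono1 rM).
  - by move=> x y /eqP hx /eqP hy; rewrite rD hx hy.
  - by move=> x y /eqP hx /eqP hy; rewrite rMul hx hy.
  by rewrite rc.
have [d /eqP d0 dE] := semi_cube cardK m_gt4 pm co co Tlin Tirr hS pu erefl (fun=> erefl) r1.
have dU : d \is a GRing.unit by rewrite unitfE.
apply/torus_groupP; exists (FinRing.unit K dU); apply/permP => x; rewrite torus_permE /=.
have [gD _ _] := hg.
apply: (graph_span cardK m_gt4 co Tlin Tirr (A := (g ^+ 3)%g) (A' := torus_act k d)).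
- by move=> a b; rewrite !expgS expg0 mulg1 !permM !gD.
- exact: torus_actD.
by move=> v; rewrite !expgS expg0 mulg1 !permM !AG dE /torus_act /= (quadF_sc Tlin).
Qed.

(** Let S be a Sylow subgroup containing P. Some nontrivial element of P is central in the normalizer
    of P in S, so commute_cube applies to that normalizer; as p is not 3, the normalizer is P itself, and
    so is S. *)
Lemma torus_Sylow (P : {group {perm W}}) : p.-Sylow(Z)%g P -> p.-Sylow(auto_group T)%g P.
Proof.
move=> sP; have pP := pHall_pgroup sP; have PZ := pHall_sub sP.
have [S sS PS] := Sylow_superset (subset_trans PZ torus_auto) pP.
have pS := pHall_pgroup sS.
suff -> : P = S by [].
apply/esym/val_inj; apply: (nilpotent_sub_norm (pgroup_nil pS) PS).
have nP : (P <| 'N_S(P))%g by apply: normalSG.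
have pN : p.-group%g ('N_S(P))%g by apply: pgroupS pS; apply: subsetIl.
have /trivgPn[z] := meet_center_nil (pgroup_nil pN) nP (torus_p_nontrivial cardK pm sP).
rewrite inE => /andP[zP /centerP[_ zC]] z1.
have /torus_groupP[u uE] := subsetP PZ z zP.
have pu : p_element p (val u).
  by apply: (zperm_p_element (k := k)); rewrite -uE; [apply: mem_p_elt pP zP | apply/eqP].
apply/subsetP => g gN; have gS : g \in S by move: gN; rewrite inE => /andP[].
have gX : g \in auto_group T := subsetP (pHall_sub sS) g gS.
have g3 : (g ^+ 3 \in Z)%g.
  by apply: (commute_cube pu gX); rewrite -uE; apply: commute_sym; apply: zC.
have pg := mem_p_elt pS gS.
have nPZ : (P <| Z)%g by rewrite -sub_abelian_normal // torus_abelian.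
have g3P : (g ^+ 3 \in P)%g.
  by rewrite (mem_normal_Hall sP nPZ g3); apply: mem_p_elt pS (groupX _ gS).
have cop : coprime #[g]%g 3.
  have [pp _ _] := pm; have [n ->] := p_natP pg; apply: coprimeXl; rewrite prime_coprime //.
  rewrite dvdn_prime2 //; apply/eqP; exact: (primitive_neq3 pm (ltn_trans (isT : 2 < 4)%N m_gt4)).
have : g \in <[g]>%g := cycle_id g.
have := generator_coprime g 3; rewrite cop => /eqP ->.
by apply/subsetP; rewrite cycle_subG.
Qed.
End SylowTorus.

(** * Inequivalence for different automorphisms *)

Section Inequivalence.
Variables (K : finFieldType) (m p : nat).
Hypothesis cardK : #|K| = (2 ^ m)%N.
Hypothesis m_gt4 : (4 < m)%N.
Hypothesis m_neq6 : m <> 6%N.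
Hypothesis pm : primitive p m.
Local Notation W := ((K * K) * (K * K))%type.
Let m_gt1 : (1 < m)%N. Proof. exact: leq_trans m_gt4. Qed.

(** After composing with an automorphism given by Sylow's theorem, the map of graphs conjugates a
    torus element of one side to a torus element of the other. *)
Lemma graph_map_weights k k' (T T' : K * K -> K * K) (a : {perm W}) :
  coprime k m -> coprime k' m -> frob_semilinear k T -> irred T -> frob_semilinear k' T' -> irred T' ->
  graph_map T T' a ->
  [\/ forall x : K, frob k x = frob k' x, forall x : K, frob k (frob k' x) = x |
      (forall x : K, frob (k + k) (frob k' x) = x) /\ (forall x : K, frob k x = frob (k' + k') x)].
Proof.
move=> co co' Tlin Tirr Tlin' Tirr' ha.
have [P sP] := Sylow_exists p (torus_group K k).
have [P' sP'] := Sylow_exists p (torus_group K k').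
have sX := torus_Sylow cardK m_gt4 pm co Tlin Tirr sP.
have sX' := torus_Sylow cardK m_gt4 pm co' Tlin' Tirr' sP'.
have sXa : p.-Sylow(auto_group T')%g (P :^ a)%g by rewrite -(auto_conj ha) pHallJ2.
have [x xX P'E] := Sylow_trans sXa sX'.
have hx : graph_map T' T' x by move: xX; rewrite inE => /graph_mapP.
have hax := graph_map_mul ha hx.
have /trivgPn[z zP z1] := torus_p_nontrivial cardK pm sP.
have /torus_groupP[u uE] := subsetP (pHall_sub sP) z zP.
have pu : p_element p (val u).
  by apply: (zperm_p_element (k := k)); rewrite -uE; [apply: mem_p_elt (pHall_pgroup sP) zP | apply/eqP].
have zP' : (z ^ (a * x) \in P')%g.
  by rewrite P'E /= conjgM !memJ_conjg.
have /torus_groupP[u' uE'] := subsetP (pHall_sub sP') _ zP'.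
have hz w : (a * x)%g (torus_act k (val u) w) = torus_act k' (val u') ((a * x)%g w).
  rewrite -(torus_permE k) -(torus_permE k') -uE -uE' -!permM conjgE !mulgA mulgV mul1g //.
have cR := p_element_generates cardK pm pu.
have [L [M [r [hS _ _ _ _]]]] := graph_map_structure cardK m_gt4 co Tlin Tirr Tlin' hax cR hz.
exact: (semi_weights cardK m_gt4 pm co co' Tlin Tirr Tlin' hS pu m_neq6).
Qed.

(** The third possibility of graph_map_weights, applied to a map and to its inverse, would make the
    third power of an automorphism of order m > 4 trivial. *)
Lemma graph_map_frob k k' (T T' : K * K -> K * K) (a : {perm W}) :
  coprime k m -> coprime k' m -> frob_semilinear k T -> irred T -> frob_semilinear k' T' -> irred T' ->
  graph_map T T' a ->
  (forall x : K, frob k x = frob k' x) \/ (forall x : K, frob k (frob k' x) = x).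
Proof.
move=> co co' Tlin Tirr Tlin' Tirr' ha.
have [h|h|[e1 e2]] := graph_map_weights co co' Tlin Tirr Tlin' Tirr' ha; [by left | by right |].
have [h|h|[e3 e4]] := graph_map_weights co' co Tlin' Tirr' Tlin Tirr (graph_map_inv ha).
- by left=> x; rewrite h.
- by right=> x; rewrite frC h.
exfalso; have : (m %| 3)%N.
  apply: (fr_period cardK m_gt1 co) => x; apply: (fr_inj cardK (k := k)).
  rewrite [RHS]e2 -[RHS]fr_comp !e4 !fr_comp; congr frob; lia.
by move/dvdn_leq; lia.
Qed.
End Inequivalence.

(** * Equivalence for equal or inverse automorphisms *)

Section BipMap.
Variables (K : finFieldType) (m k : nat).
Hypothesis cardK : #|K| = (2 ^ m)%N.

Definition bipT (a : K) (v : K * K) : K * K := (a * frob k v.2, frob k v.1 + frob k v.2).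

Lemma bipT_lin a : frob_semilinear k (bipT a).
Proof.
split=> [u v|c v]; rewrite /bipT /= ?(frD cardK) ?frM; apply: vec_ext => /=; ring.
Qed.

Lemma bipT_irred a : no_root (@frob K k) a -> irred (bipT a).
Proof.
move=> /forallP nr [x y] v0; rewrite /det /bipT /= => h.
have [y0|yn0] := eqVneq y 0.
  apply: v0; move: h; rewrite y0 (fr0 cardK) !mulr0 addr0 add0r => /eqP.
  by rewrite mulf_eq0 fr_eq0 orbb => /eqP ->.
have := nr (x / y); have syn0 : frob k y != 0 by rewrite fr_eq0.
rewrite frM frV => /eqP; apply; apply: (mulIf (mulf_neq0 syn0 yn0)).
rewrite mul0r -[RHS]h; field; by rewrite yn0 syn0.
Qed.

Lemma bipF_quadF a v : bipF a (@frob K k) v = quadF (bipT a) v.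
Proof.
rewrite ffunE /quadF /bipT /fpart /gpart /det /= !(frD cardK) !frM.
by apply: vec_ext => /=; ring.
Qed.
End BipMap.

Section Intertwiner.
Variables (K : finFieldType) (m k : nat).
Hypothesis cardK : #|K| = (2 ^ m)%N.
Hypothesis m_gt1 : (1 < m)%N.
Hypothesis co : coprime k m.

(** T^m is linear and commutes with T; it is not the identity by iter_order_nontrivial. *)
Lemma iter_m_order3 (T : K * K -> K * K) : frob_semilinear k T -> irred T ->
  [/\ semilinear id (iter m T), forall v, iter m T (iter m T v) = iter m T v + v &
      exists v, det (iter m T v) v <> 0].
Proof.
move=> Tlin Tirr.
have lin : semilinear id (iter m T).
  have [ID IZ] := iter_semilinear Tlin m; split=> // a v; by rewrite IZ (frk_m _ cardK).
have comm v : iter m T (T v) = T (iter m T v) by rewrite -iterSr -iterS.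
case: (commutant cardK m_gt1 co Tlin Tirr lin comm) => [h|h|[h1 h2]]; last by [].
  exfalso; apply: (@e1_neq0 K); have := h (1, 0).
  have TI v : T v = 0 -> v = 0 by move=> e; apply: (T_inj Tlin Tirr); rewrite e (additive_map0 (proj1 Tlin)).
  by elim: (m) => //= n IH /TI.
by case: (iter_order_nontrivial cardK m_gt1 co Tlin Tirr).
Qed.

(** In the basis (u, A u) the matrix of A depends only on the relation A^2 = A + 1. *)
Lemma order3_intertwiner (A B : K * K -> K * K) : semilinear id A -> semilinear id B ->
  (forall v, A (A v) = A v + v) -> (forall v, B (B v) = B v + v) ->
  (exists u, det (A u) u <> 0) ->
  exists X, [/\ semilinear id X, exists v, X v <> 0 & forall v, X (A v) = B (X v)].
Proof.
move=> [AD AZ] [BD BZ] A2 B2 [u hu]; have hu' : det u (A u) <> 0 by rewrite detC.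
pose c1 v := det v (A u) / det u (A u); pose c2 v := det v u / det u (A u).
have vE v : v = scale (c1 v) u + scale (c2 v) (A u) := det_basis cardK hu' v.
have c1D : additive_map c1 by move=> x y; rewrite /c1 detDl mulrDl.
have c2D : additive_map c2 by move=> x y; rewrite /c2 detDl mulrDl.
have c1Z a v : c1 (scale a v) = a * c1 v by rewrite /c1 detZl mulrA.
have c2Z a v : c2 (scale a v) = a * c2 v by rewrite /c2 detZl mulrA.
have hu0 : det u (A u) != 0 by exact/eqP.
have c1u : c1 u = 1 by rewrite /c1 divff.
have c2u : c2 u = 0 by rewrite /c2 (det_id cardK) mul0r.
have c1A : c1 (A u) = 0 by rewrite /c1 (det_id cardK) mul0r.
have c2A : c2 (A u) = 1 by rewrite /c2 detC divff.
pose w : K * K := (1, 0).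
pose X v := scale (c1 v) w + scale (c2 v) (B w).
exists X; split.
- split=> [x y|a v]; first by rewrite /X c1D c2D !scaleDl addrACA.
  by rewrite /X c1Z c2Z scaleD !scaleA.
- by exists u; rewrite /X c1u c2u scale1 scale0 addr0; apply: e1_neq0.
move=> v; have Av : A v = scale (c2 v) u + scale (c1 v + c2 v) (A u).
  by rewrite {1}(vE v) AD !AZ A2 scaleD scaleDl addrA [LHS]addrC.
have Bv : B (X v) = scale (c2 v) w + scale (c1 v + c2 v) (B w).
  by rewrite /X BD !BZ B2 scaleD scaleDl addrA [LHS]addrC.
by rewrite Bv {1}/X Av c1D c2D !c1Z !c2Z c1u c2u c1A c2A !mulr1 !mulr0 addr0 add0r.
Qed.

(** The sum over i < m of T'^i (x X) T^(-i), where X intertwines T^m and T'^m, intertwines T and T';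
    it is nonzero for some scalar x by galois_average, and injective since T is irreducible. *)
Lemma intertwiner (T T' : K * K -> K * K) : frob_semilinear k T -> irred T -> frob_semilinear k T' -> irred T' ->
  exists Y, [/\ semilinear id Y, injective Y & forall v, Y (T v) = T' (Y v)].
Proof.
move=> Tlin Tirr Tlin' Tirr'; have [TD TZ] := Tlin; have [TD' TZ'] := Tlin'.
have [Alin A2 Au] := iter_m_order3 Tlin Tirr.
have [Blin B2 _] := iter_m_order3 Tlin' Tirr'.
have [X [Xlin [v0 Xv0] XAB]] := order3_intertwiner Alin Blin A2 B2 Au.
have [XD XZ] := Xlin.
have Tinj := T_inj Tlin Tirr; pose Ti := invF Tinj.
have TiK v : T (Ti v) = v by apply: f_invF.
have TKi v : Ti (T v) = v by apply: invF_f.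
have TiD : additive_map Ti by move=> x y; apply: (Tinj); rewrite TD !TiK.
have TiZ a v : Ti (scale (frob k a) v) = scale a (Ti v) by apply: (Tinj); rewrite TZ !TiK.
have iTiD i : additive_map (iter i Ti) by elim: i => // i IH x y; rewrite /= IH TiD.
have iTiZ i a v : iter i Ti (scale (frob (k * i) a) v) = scale a (iter i Ti v).
  by elim: i a v => [|i IH] a v; [rewrite muln0 fr0E | rewrite !iterSr mulnS -fr_comp TiZ IH].
pose g v i := iter i T' (X (iter i Ti v)).
have [x hx] := galois_average cardK m_gt1 co (g := g v0) Xv0.
pose Y v := \sum_(i < m) scale (frob (k * i) x) (g v i).
have [iD iZ] : (forall i, additive_map (iter i T')) /\ (forall i a v, iter i T' (scale a v) = scale (frob (k * i) a) (iter i T' v)).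
  by split=> i; case: (iter_semilinear Tlin' i).
have Ylin : semilinear id Y.
  split=> [u v|a v].
    rewrite /Y -big_split; apply: eq_bigr => i _ /=.
    by rewrite /g iTiD XD iD scaleD.
  have scDa : additive_map (@scale K a) := @scaleD K a.
  rewrite /Y (additive_map_sum _ _ _ scDa).
  apply: eq_bigr => i _; rewrite /g; have [b <-] := fr_surj cardK (k * i) a.
  by rewrite iTiZ XZ iZ !scaleA mulrC.
have YT v : Y (T v) = T' (Y v).
  have m0 : (0 < m)%N := ltnW m_gt1.
  have st i : T' (scale (frob (k * i) x) (g v i)) = scale (frob (k * i.+1) x) (g (T v) i.+1).
    by rewrite TZ' fr_comp mulnS /g iterS iterSr TKi.
  rewrite /Y (additive_map_sum _ _ _ TD').
  rewrite -(prednK m0) big_ord_recl [RHS]big_ord_recr /= [LHS]addrC; congr (_ + _).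
    by apply: eq_bigr => i _; rewrite st.
  rewrite st prednK // (frk_m _ cardK) muln0 fr0E; congr (scale x _).
  have iK i w : iter i T (iter i Ti w) = w.
    by elim: i w => // i IH w; rewrite iterSr iterS TiK IH.
  by rewrite /g /= -XAB iK.
exists Y; split=> //; have [YD YZ] := Ylin; apply: (additive_map_inj YD) => v Yv.
have [//|/eqP vn0] := eqVneq v 0; case: hx.
have -> : \sum_(i < m) scale (frob (k * i) x) (g v0 i) = Y v0 by [].
by rewrite (det_basis cardK (Tirr _ vn0) v0) YD !YZ YT Yv (additive_map0 TD') !scaler0 addr0.
Qed.

Lemma intertwiner_quadF (T T' Y : K * K -> K * K) : semilinear id Y -> injective Y -> (forall v, Y (T v) = T' (Y v)) ->
  exists2 d : K, d <> 0 & forall v, quadF T' (Y v) = scale d (quadF T v).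
Proof.
move=> [YD YZ] Yi YT; pose d := det (Y (1, 0)) (Y (0, 1)).
have dE u v : det (Y u) (Y v) = d * det u v.
  exact: (@semilinear_det K m cardK id Y (fun _ _ => erefl) (fun _ _ => erefl) (conj YD YZ)).
clearbody d; exists d; last by move=> v; rewrite /quadF -!YT !dE.
move=> d0; apply: (@e1_neq0 K); apply: (Yi); rewrite (additive_map0 YD); apply: det_nondeg => y.
by have [v <-] := inj_surj Yi y; rewrite dE d0 mul0r.
Qed.

(** Since T preserves det up to a scalar and the automorphism, the quadratic maps of T and of its
    inverse differ by an additive bijection. *)
Lemma inverse_quadF k' (T : K * K -> K * K) : frob_semilinear k T -> irred T -> (forall x : K, frob k (frob k' x) = x) ->
  exists Ti M, [/\ frob_semilinear k' Ti, irred Ti, additive_map M, injective M & forall v, quadF T v = M (quadF Ti v)].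
Proof.
move=> Tlin Tirr kk; have [TD TZ] := Tlin.
have Tinj := T_inj Tlin Tirr; pose Ti := invF Tinj.
have TiK v : T (Ti v) = v by apply: f_invF.
have TKi v : Ti (T v) = v by apply: invF_f.
pose d := det (T (1, 0)) (T (0, 1)).
have dE u v : det (T u) (T v) = d * frob k (det u v) := semilinear_det cardK (frD cardK k) (@frM K k) Tlin u v.
clearbody d.
have d0 : d != 0.
  apply/eqP => d0; apply: (@e1_neq0 K); apply: (Tinj); rewrite (additive_map0 TD); apply: det_nondeg => y.
  by rewrite -[y]TiK dE d0 mul0r.
exists Ti, (fun w => (d * frob k w.1, d * frob k (d * frob k w.2))); split.
- split=> [x y|a v]; apply: (Tinj); first by rewrite TD !TiK.
  by rewrite TZ kk !TiK.
- move=> v v0; rewrite -[v in det _ v]TiK detC; apply: Tirr => h.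
  by apply: v0; rewrite -[v]TiK h (additive_map0 TD).
- move=> x y; rewrite /= !(frD cardK) !mulrDr !(frD cardK) !mulrDr //.
- move=> x y [] /(mulfI d0)/(fr_inj cardK) e1 /(mulfI d0)/(fr_inj cardK)/(mulfI d0)/(fr_inj cardK) e2.
  exact: vec_ext.
move=> v; rewrite /quadF /=; apply: vec_ext => /=; first by rewrite -dE TiK detC.
by rewrite -!dE !TiK detC.
Qed.

End Intertwiner.

(** * CCZ-equivalence *)

Section Affine.
Variable V : finZmodType.
Implicit Types (f : V -> V) (F G H : {ffun V -> V}).

Lemma F2affineP f : reflect (exists L c, additive_map L /\ forall v, f v = L v + c) (F2affine f).
Proof.
apply: (iffP existsP) => [[L /existsP[c /andP[/forallP hL /forallP hf]]]|[L [c [LD hf]]]].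
  by exists L, c; split=> [u v|v]; apply/eqP; rewrite ?hf //; apply: (forallP (hL u)).
exists [ffun v => L v]; apply/existsP; exists c; apply/andP; split.
  by apply/forallP => u; apply/forallP => v; rewrite !ffunE LD.
by apply/forallP => v; rewrite ffunE hf.
Qed.

Lemma F2affine_mul (g h : {perm V}) : F2affine g -> F2affine h -> F2affine (g * h)%g.
Proof.
move=> /F2affineP[L [c [LD hg]]] /F2affineP[M [d [MD hh]]]; apply/F2affineP.
exists (M \o L), (M c + d); split=> [u v|v]; first by rewrite /= LD MD.
by rewrite permM hg hh MD addrA.
Qed.

Lemma F2affine_inv (g : {perm V}) : F2affine g -> F2affine g^-1%g.
Proof.
move=> /F2affineP[L [c [LD hg]]]; apply/F2affineP.
have LE v : L (g^-1%g (v + c)) = v by apply: (addIr c); rewrite -hg permKV.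
have Li : injective L.
  by move=> u v e; apply: (@perm_inj _ g); rewrite !hg e.
exists (fun v => g^-1%g (v + c)), (g^-1%g 0); split=> [u v|v].
  by apply: Li; rewrite LD !LE.
apply: Li; rewrite LD LE; have := LE (v - c); rewrite subrK => ->.
by have := LE (- c); rewrite addNr => ->.
Qed.

Lemma in_graph F v w : ((v, w) \in graph F) = (w == F v).
Proof.
apply/imsetP/eqP => [[u _ [-> ->]] //|->]; by exists v; rewrite ?inE.
Qed.

End Affine.

Section CczEquivalence.
Variable V : finZmodType.
Implicit Types (F G H : {ffun V -> V}).

Lemma ccz_refl F : ccz F F.
Proof.
apply/existsP; exists 1%g; apply/andP; split.
  apply/F2affineP; exists id, 0; split=> // v; by rewrite perm1 addr0.
apply/eqP/setP => x; apply/imsetP/idP => [[y yF ->]|xF]; first by rewrite perm1.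
by exists x; rewrite ?perm1.
Qed.

Lemma ccz_sym F G : ccz F G -> ccz G F.
Proof.
case/existsP => A /andP[hA /eqP hG]; apply/existsP; exists A^-1%g; rewrite F2affine_inv //=.
rewrite -hG -imset_comp; apply/eqP/setP => x; apply/imsetP/idP => [[y yF ->]|xF].
  by rewrite /= permK.
by exists x; rewrite //= permK.
Qed.

Lemma ccz_trans F G H : ccz F G -> ccz G H -> ccz F H.
Proof.
case/existsP => A /andP[hA /eqP hG] /existsP[B /andP[hB /eqP hH]].
apply/existsP; exists (A * B)%g; rewrite F2affine_mul //= -hH -hG -imset_comp.
by apply/eqP/eq_imset => x; rewrite permM.
Qed.

Lemma ccz_linear (F G : {ffun V -> V}) (L M : V -> V) : additive_map L -> injective L -> additive_map M -> injective M ->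
  (forall v, G (L v) = M (F v)) -> ccz F G.
Proof.
move=> LD Li MD Mi h.
pose A (x : V * V) := (L x.1, M x.2).
have Ai : injective A by move=> [a b] [a' b'] [] /Li -> /Mi ->.
apply/existsP; exists (perm Ai); apply/andP; split.
  apply/F2affineP; exists A, 0; split=> [x y|x]; last by rewrite permE addr0.
  by rewrite /A /= LD MD.
apply/eqP/setP => -[v w]; rewrite in_graph; apply/imsetP/eqP => [[[a b]]|->].
  by rewrite in_graph permE => /eqP -> [-> ->]; rewrite h.
have [u <-] := inj_surj Li v; exists (u, F u); first by rewrite in_graph.
by rewrite permE /A /= h.
Qed.

Lemma ccz_equivalence : {in [set: {ffun V -> V}] & &, equivalence_rel (@ccz V)}.
Proof.
move=> F G H _ _ _; split; first exact: ccz_refl.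
move=> FG; apply/idP/idP; first exact: (ccz_trans (ccz_sym FG)).
exact: ccz_trans FG.
Qed.

End CczEquivalence.

Section CczQuadratic.
Variables (K : finFieldType) (m : nat).
Hypothesis cardK : #|K| = (2 ^ m)%N.
Local Notation W := ((K * K) * (K * K))%type.

(** Composing with an automorphism of the second graph that moves the image of the origin back
    makes the affine map additive. *)
Lemma ccz_graph_map k k' (T T' : K * K -> K * K) (F G : {ffun K * K -> K * K}) :
  frob_semilinear k T -> frob_semilinear k' T' -> (forall v, F v = quadF T v) -> (forall v, G v = quadF T' v) ->
  ccz F G -> exists a : {perm W}, graph_map T T' a.
Proof.
move=> Tlin Tlin' FE GE /existsP[A /andP[/F2affineP[L [c [LD hA]]] /eqP hG]].
have img v : (A (v, quadF T v)).2 = quadF T' (A (v, quadF T v)).1.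
  have : A (v, quadF T v) \in graph G by rewrite -hG imset_f // in_graph FE.
  by rewrite {1}[A _]surjective_pairing in_graph GE => /eqP.
have L0 : L 0 = 0 := additive_map0 LD.
have c2 : c.2 = quadF T' c.1.
  have := img 0; rewrite (quadF0 T) hA -[(0, 0)]/(0 : W) L0 add0r //.
pose B (x : W) : W := ((L x).1, (L x).2 + polF T' (L x).1 c.1).
have BD : additive_map B.
  move=> x y; rewrite /B LD /= polFC (polFD Tlin') !(polFC _ c.1) addrACA //.
have Bi : injective B.
  move=> x y e; have e1 : (L x).1 = (L y).1 := congr1 fst e.
  have e2 : (L x).2 = (L y).2 by move: (congr1 snd e); rewrite /B /= e1 => /addIr.
  have eL : L x = L y by apply: vec_ext.
  have : A x = A y by rewrite !hA eL.
  exact: perm_inj.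
exists (perm Bi); split; [by move=> x y; rewrite !permE BD | exact: perm_inj |].
move=> v; rewrite permE /B /=; have := img v; rewrite hA /= (quadF_polar Tlin') c2.
rewrite addrAC => /addIr ->.
have E (a b : K * K) : a + b + b = a by vec2 cardK.
exact: E.
Qed.
End CczQuadratic.

(** * The classes of the family *)

Lemma coprime_sub_self k n : (k <= n)%N -> coprime k n -> coprime (n - k) n.
Proof.
move=> le; rewrite /coprime; suff -> : gcdn (n - k) n = gcdn k n by [].
by rewrite -{2}(subnK le) gcdnDl gcdnC -gcdnDl subnKC.
Qed.

Section Family.
Variables (K : finFieldType) (m : nat).
Hypothesis cardK : #|K| = (2 ^ m)%N.
Hypothesis m_gt2 : (2 < m)%N.
Hypothesis m_neq4 : m <> 4%N.
Hypothesis m_neq6 : m <> 6%N.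
Let m_gt1 : (1 < m)%N. Proof. exact: leq_trans m_gt2. Qed.
Local Notation bip k a := (bipF a (@frob K k)).

Lemma bipF_ext (a : K) (s t : K -> K) : s =1 t -> bipF a s = bipF a t.
Proof. by move=> e; apply/ffunP => v; rewrite !ffunE /fpart /gpart !e. Qed.

Lemma no_root_ext (a : K) (s t : K -> K) : s =1 t -> no_root s a = no_root t a.
Proof. by move=> e; apply: eq_forallb => x; rewrite e. Qed.

Lemma is_frobP k (s : {perm K}) : reflect (s =1 @frob K k) (is_frob k s).
Proof. by apply: (iffP forallP) => h x; apply/eqP. Qed.

Lemma small_frob k l : m = 3%N -> coprime k m -> coprime l m ->
  (forall x : K, frob k x = frob l x) \/ (forall x : K, frob k (frob l x) = x).
Proof.
move=> m3 ck cl.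
have r12 i : coprime i m -> (i %% m = 1 \/ i %% m = 2)%N.
  move=> ci; have : (i %% m < m)%N by rewrite ltn_pmod // m3.
  have : (i %% m <> 0)%N.
    by move=> i0; move: ci; rewrite coprime_sym -coprime_modr i0 /coprime gcdn0 m3.
  by rewrite m3; lia.
have same : (k %% m = l %% m)%N -> forall x : K, frob k x = frob l x.
  by move=> e x; rewrite -(fr_mod cardK) e (fr_mod cardK).
have opp : (k %% m + l %% m = m)%N -> forall x : K, frob k (frob l x) = x.
  move=> e x; rewrite -(fr_mod cardK k) -(fr_mod cardK l) fr_comp e.
  exact: frm cardK x.
have [ek|ek] := r12 k ck; have [el|el] := r12 l cl.
- by left; apply: same; rewrite ek el.
- by right; apply: opp; rewrite ek el m3.
- by right; apply: opp; rewrite ek el m3.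
by left; apply: same; rewrite ek el.
Qed.

Lemma bip_ccz k l (a b : K) : coprime k m -> coprime l m ->
  no_root (@frob K k) a -> no_root (@frob K l) b ->
  ccz (bip k a) (bip l b) <->
  (forall x : K, frob k x = frob l x) \/ (forall x : K, frob k (frob l x) = x).
Proof.
move=> ck cl na nb.
have Tlin := bipT_lin k cardK a; have Tirr := bipT_irred cardK na.
have Tlin' := bipT_lin l cardK b; have Tirr' := bipT_irred cardK nb.
have FE v : bip k a v = quadF (bipT k a) v by exact: (bipF_quadF k cardK).
have GE v : bip l b v = quadF (bipT l b) v by exact: (bipF_quadF l cardK).
split=> [h|].
  have [m5|m5] := ltnP 4 m; last by apply: small_frob => //; lia.
  have [g hg] := ccz_graph_map cardK Tlin Tlin' FE GE h.
  have [p pm] := primitive_prime m_gt2 m_neq6.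
  exact: (graph_map_frob cardK m5 m_neq6 pm ck cl Tlin Tirr Tlin' Tirr' hg).
(* When the automorphisms agree, any two irreducible semilinear maps are intertwined. *)
have conj T : frob_semilinear l T -> irred T -> forall F : {ffun K * K -> K * K}, (forall v, F v = quadF T v) ->
    ccz F (bip l b).
  move=> lin irr F EF.
  have [Y [[YD YZ] Yi YT]] := intertwiner cardK m_gt1 cl lin irr Tlin' Tirr'.
  have [d d0 dE] := intertwiner_quadF cardK (conj YD YZ) Yi YT.
  apply: (ccz_linear (L := Y) (M := scale d)) => //.
  - exact: scaleD.
  - apply: additive_map_inj; first exact: scaleD.
    by move=> v /scale_eq0[].
  by move=> v; rewrite GE dE EF.
case=> [e|e].
  apply: (conj (bipT k a)) FE => //.
  by have [TD TZ] := Tlin; split=> // c v; rewrite TZ e.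
have [Ti [M [Tilin Tiirr MD Mi hM]]] := inverse_quadF cardK Tlin Tirr e.
apply: (@ccz_trans _ _ [ffun v => quadF Ti v]).
  apply: ccz_sym; apply: (ccz_linear (L := id) (M := M)) => //.
  by move=> v; rewrite FE ffunE hM.
by apply: (conj Ti) => // v; rewrite ffunE.
Qed.

(** The map x -> x^(s+1) + x sends both 0 and 1 to 0, so it misses some value. *)
Lemma no_root_exists k : exists a : K, no_root (@frob K k) a.
Proof.
have [/existsP[a h]|/existsPn h] := boolP [exists a, no_root (@frob K k) a]; first by exists a.
exfalso; pose f (x : K) := frob k x * x + x.
have fs a : exists x, f x = a.
  have /forallPn[x] := h a; rewrite negbK => /eqP e; exists x.
  exact: (addK_eq0 cardK e).
have /eqP := oner_neq0 K; apply; apply: (surj_inj fs).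
by rewrite /f fr1 mulr1 (addKK cardK) mulr0 addr0.
Qed.

Definition frob_perm k : {perm K} := perm (@fr_inj K m cardK k).

Lemma frob_permE k : frob_perm k =1 @frob K k.
Proof. by move=> x; rewrite permE. Qed.

Lemma bip_familyP (F : {ffun K * K -> K * K}) :
  reflect (exists (k : 'I_m) (a : K), [/\ coprime k m, no_root (@frob K k) a & F = bip k a])
          (F \in bip_family K m).
Proof.
rewrite inE; apply: (iffP existsP) => [[s /existsP[k /existsP[a]]]|[k [a [ck na ->]]]].
  case/and4P => ck /is_frobP sk na /eqP ->; exists k, a.
  by rewrite -(no_root_ext _ sk) (bipF_ext _ sk).
exists (frob_perm k); apply/existsP; exists k; apply/existsP; exists a.
rewrite ck (no_root_ext _ (frob_permE k)) na (bipF_ext _ (frob_permE k)) eqxx andbT /=.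
by rewrite andbT; apply/is_frobP/frob_permE.
Qed.

Definition opp_ord (k : 'I_m) : 'I_m := insubd k (m - k)%N.

Lemma opp_ordE (k : 'I_m) : coprime k m -> opp_ord k = (m - k)%N :> nat.
Proof. by move=> /(coprime_gt0 m_gt1) k0; rewrite /opp_ord val_insubd; case: ifP => //; lia. Qed.

(** Choosing one function for each exponent coprime to m, the map from exponents to classes is onto,
    and its fibres are the pairs made of k and m - k, which differ as m > 2. *)
Lemma card_classes :
  (2 * #|equivalence_partition (@ccz (K * K)%type) (bip_family K m)|)%N = totient m.
Proof.
have /fin_all_exists[a aP] : forall k : 'I_m, exists a : K, no_root (@frob K k) a.
  by move=> k; apply: no_root_exists.
pose E := bip_family K m; pose P := equivalence_partition (@ccz (K * K)%type) E.
pose C := [set k : 'I_m | coprime k m].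
pose h (k : 'I_m) := [set G in E | ccz (bip k (a k)) G].
have cE (F G H : {ffun K * K -> K * K}) : ccz F G -> ccz F H = ccz G H :=
  snd (ccz_equivalence (in_setT F) (in_setT G) (in_setT H)).
have hP k : k \in C -> h k \in P.
  rewrite inE => ck; apply/imsetP; exists (bip k (a k)) => //.
  by apply/bip_familyP; exists k, (a k).
have hE k l : k \in C -> l \in C -> (h k == h l) = (l \in [set k; opp_ord k]).
  rewrite !inE => ck cl.
  have -> : (h k == h l) = ccz (bip k (a k)) (bip l (a l)).
    apply/eqP/idP => [e|e]; last by apply/setP => F; rewrite !inE (cE _ _ _ e).
    have : bip l (a l) \in h l by rewrite inE ccz_refl andbT; apply/bip_familyP; exists l, (a l).
    by rewrite -e inE => /andP[].
  apply/idP/orP => [/(bip_ccz ck cl (aP k) (aP l))[e|e]|].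
  - left; apply/eqP/val_inj => /=; have [kl|lk] := leqP k l.
      have : (m %| l - k)%N.
        apply: (fr_id_dvd cardK m_gt1) => x; apply: (fr_inj cardK (k := k)).
        by rewrite fr_comp subnKC // e.
      by case: (posnP (l - k)%N) => [|d0 /(dvdn_leq d0)]; have := ltn_ord l; lia.
    have : (m %| k - l)%N.
      apply: (fr_id_dvd cardK m_gt1) => x; apply: (fr_inj cardK (k := l)).
      by rewrite fr_comp subnKC ?(ltnW lk) // e.
    by case: (posnP (k - l)%N) => [|d0 /(dvdn_leq d0)]; have := ltn_ord k; lia.
  - right; apply/eqP/val_inj; rewrite /= opp_ordE //.
    have : (m %| k + l)%N by apply: (fr_id_dvd cardK m_gt1) => x; rewrite -fr_comp e.
    case/dvdnP => q; have := coprime_gt0 m_gt1 ck; have := ltn_ord k; have := ltn_ord l.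
    by case: q => [|[|q]]; rewrite ?mulSn; lia.
  move=> kl; apply/(bip_ccz ck cl (aP k) (aP l)); case: kl => /eqP ->; [by left | right] => x.
  by rewrite fr_comp opp_ordE // subnKC ?(ltnW (ltn_ord k)) // (frm cardK).
have hsur B : B \in P -> exists2 k, k \in C & B = h k.
  case/imsetP => F /bip_familyP[k [b [ck nb ->]]] ->; exists k; first by rewrite inE.
  apply/setP => G; rewrite !inE; congr (_ && _); apply: cE.
  by apply/(bip_ccz ck ck nb (aP k)); left.
have -> : totient m = #|C|.
  rewrite totient_count_coprime -big_mkcond big_mkord -sum1_card.
  by apply: eq_bigl => i; rewrite inE coprime_sym.
rewrite -[RHS]sum1_card [RHS](partition_big h (mem P)) //= mulnC -sum_nat_const.
apply: eq_bigr => B /hsur[k kC ->].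
rewrite (eq_bigl (mem [set k; opp_ord k])) ?sum1_card ?cards2.
  have ck : coprime k m by move: kC; rewrite inE.
  case: eqP => // /(congr1 val) /=; rewrite opp_ordE // => e.
  have mk : m = (2 * k)%N by have := ltn_ord k; lia.
  have /gcdn_idPl gk : (k %| m)%N by apply/dvdnP; exists 2%N.
  by move: ck; rewrite /coprime gk => /eqP k1; lia.
move=> l; apply/andP/idP => [[lC /eqP e]|].
  by rewrite /= -hE // e.
move=> lk; have lC : l \in C.
  move: (lk) kC; rewrite !inE => /orP[/eqP -> //|/eqP ->] ck.
  by rewrite opp_ordE // coprime_sub_self // ltnW.
by split=> //; rewrite eq_sym hE.
Qed.

End Family.

Theorem theorem3p6 (m : nat) (K : finFieldType)
    (m_gt2 : (2 < m)%N) (m_neq4 : m <> 4%N) (m_neq6 : m <> 6%N)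
    (cardK : #|K| = (2 ^ m)%N) :
  (forall (k l : nat) (sigma tau : {perm K}) (alpha1 alpha2 : K),
     coprime k m -> coprime l m ->
     is_frob k sigma -> is_frob l tau ->
     no_root sigma alpha1 -> no_root tau alpha2 ->
     ccz (bipF alpha1 sigma) (bipF alpha2 tau) <->
       sigma = tau \/ sigma = (tau^-1)%g) /\
  (2 * #|equivalence_partition (@ccz (K * K)%type) (bip_family K m)|)%N
    = totient m.
Proof.
split; last exact: card_classes.
move=> k l s t a b ck cl /is_frobP sk /is_frobP tl.
rewrite (no_root_ext _ sk) (no_root_ext _ tl) (bipF_ext _ sk) (bipF_ext _ tl) => na nb.
apply: (iff_trans (bip_ccz cardK m_gt2 m_neq4 m_neq6 ck cl na nb)).
split=> -[e|e]; [left | right | left | right].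
- by apply/permP => x; rewrite sk tl e.
- by apply/permP => x; rewrite -{1}[x](permKV t) tl sk e.
- by move=> x; rewrite -sk -tl e.
by move=> x; rewrite -tl -sk e permK.
Qed.
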